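(* Let $\mathcal{E}=\mathcal{E}_1\cup\mathcal{E}_2$ be a finite set, with $\mathcal{E}_1,\mathcal{E}_2$ non-empty and disjoint, and let $K$ be a sub-Markovian kernel on $\mathcal{E}$ such that: (1) for $i=1,2$, $x\hookrightarrow y$ for all $x,y\in\mathcal{E}_i$; (2) $\mathcal{E}_1\hookrightarrow\mathcal{E}_2$; (3) $\mathcal{E}_2\not\hookrightarrow\mathcal{E}_1$; (4) there is $x\in\mathcal{E}_2$ with $K(x,\mathcal{E})<1$, while $K(x,\mathcal{E})=1$ for all $x\in\mathcal{E}_1$. Let $\Theta_1,\Theta_2$ be the extinction rates (spectral radii) of the restrictions $K_1,K_2$ of $K$ to $\mathcal{E}_1,\mathcal{E}_2$, and let $\mu_2^\star$ be the unique quasi-stationary distribution of $K_2$, viewed as an element of $\mathcal{P}(\mathcal{E})$. Suppose $\Theta_1>\Theta_2$. Then there is another quasi-stationary distribution $\mu^\star$ of $K$ having full support (i.e. $\mu^\star(x)>0$ for all $x\in\mathcal{E}$). Moreover, if $(\gamma_n)_{n\ge0}$ is non-increasing with $\sum_{n\ge0}\gamma_n=+\infty$ and $\lim_{n\to\infty}\gamma_n\ln(n)=0$, then: (i) $(\mu_n)_{n\ge0}$ converges almost surely to a random limit $\mu_\infty\in\{\mu_2^\star,\mu^\star\}$. (ii) If $X_0\in\mathcal{E}_2$, then $X_n\in\mathcal{E}_2$ for all $n$ and $\mu_\infty=\mu_2^\star$ with probability one. (iii) If $X_0\in\mathcal{E}_1$, the event $\{\mu_\infty=\mu^\star\}$ has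 positive probability. (iv) If $\sum_n\prod_{i=1}^n(1-\gamma_i)<+\infty$, the event $\{\exists N\in\mathbb{N}: X_n\in\mathcal{E}_2\text{ for all }n\ge N\}$ has positive probability, and on this event $\mu_\infty=\mu_2^\star$.
   Context: $K(x,y)=K(x,\{y\})$; $\mathbf{1}$ is the constant function $1$. $\mathcal{P}(\mathcal{E})$ is the set of probabilities on $\mathcal{E}$; $\mathcal{P}(\mathcal{E}_i)$ is identified with the probabilities on $\mathcal{E}$ supported in $\mathcal{E}_i$. A sub-Markovian kernel $K$ on $\mathcal{E}$ is a matrix with non-negative entries and $0<K(x,\mathcal{E})=\sum_yK(x,y)\le1$ for every $x$; $K^n$ is its $n$-th power. For $x,y\in\mathcal{E}$, $x\hookrightarrow y$ means $\sum_{n\ge0}K^n(x,y)>0$; for $A,B\subset\mathcal{E}$, $A\hookrightarrow B$ means that $x\hookrightarrow y$ for some $x\in A$, $y\in B$. A quasi-stationary distribution (QSD) of a kernel $Q$ is a probability $\mu$ with $\mu=\mu Q/(\mu Q\mathbf{1})$, and its extinction rate is $\mu Q\mathbf{1}$. $K_i=(K(x,y))_{x,y\in\mathcal{E}_i}$; by irreducibility and Perron–Frobenius, the extinction rate $\Theta_i$ of the unique QSD of $K_i$ is the spectral radius of $K_i$. Algorithm: let $\delta(x)=1-K(x,\mathcal{E})$ and $K_\mu(x,A)=K(x,A)+\delta(x)\mu(A)$ for $\mu\in\mathcal{P}(\mathcal{E})$. $(\eta_n)_{n\ge0}$ are positive numbers, $\gamma_n=\eta_n/\sum_{k=0}^n\eta_k$.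 $(X_n)_{n\ge0}$ is an $\mathcal{E}$-valued process adapted to a filtration $(\mathcal{F}_n)$ with $X_0=x\in\mathcal{E}$ deterministic and $\mathbb{P}(X_{n+1}\in dy\mid\mathcal{F}_n)=K_{\mu_n}(X_n,dy)$, where $\mu_n=\sum_{k=0}^n\eta_k\delta_{X_k}/\sum_{k=0}^n\eta_k$. *)

(* Defs.v *)
From mathcomp Require Import all_boot all_order all_algebra.
From mathcomp Require Import all_classical all_reals all_analysis.
Import Order.TTheory GRing.Theory Num.Theory.
Import numFieldNormedType.Exports.

Set Implicit Arguments.
Unset Strict Implicit.
Unset Printing Implicit Defensive.

Local Open Scope classical_set_scope.
Local Open Scope ring_scope.

(** Kernels and measures on a finite set [T] are functions [T -> T -> R] and
    [T -> R]; [K x y] stands for [K(x,{y})]. *)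

Section Kernels.
Variables (R : realType) (T : finType).
Implicit Types (K Q : T -> T -> R) (mu : T -> R).

Definition mass mu (A : {set T}) : R := \sum_(y in A) mu y.

Definition total_mass mu : R := \sum_y mu y.

Definition is_prob mu : Prop := (forall x, 0 <= mu x) /\ total_mass mu = 1.

Definition sub_markovian K : Prop :=
  (forall x y, 0 <= K x y) /\ (forall x, 0 < total_mass (K x) <= 1).

Fixpoint kernel_pow K (n : nat) (x y : T) : R :=
  if n is m.+1 then \sum_z K x z * kernel_pow K m z y else (x == y)%:R.

Definition leads K (x y : T) : Prop :=
  (0 < \sum_(0 <= n <oo) (kernel_pow K n x y)%:E)%E.

Definition leads_set K (A B : {set T}) : Prop :=
  exists x y, [/\ x \in A, y \in B & leads K x y].

Definition mu_mul mu Q : T -> R := fun y => \sum_x mu x * Q x y.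

Definition extinction_rate Q mu : R := total_mass (mu_mul mu Q).

(** A probability [mu] whose image [mu_mul mu Q] is null is not
    quasi-stationary: division by [0] gives [0], which would force [mu] to
    vanish. *)
Definition is_qsd Q mu : Prop :=
  is_prob mu /\ (forall y, mu y = mu_mul mu Q y / extinction_rate Q mu).

Definition killing K (x : T) : R := 1 - total_mass (K x).

Definition resurrected K mu (x : T) (A : {set T}) : R :=
  mass (K x) A + killing K x * mass mu A.

End Kernels.

Section Restriction.
Variables (R : realType) (T : finType) (A : {set T}).

Definition restrict_kernel (K : T -> T -> R) (x y : {x : T | x \in A}) : R :=
  K (val x) (val y).

(** Identification of measures on [A] with measures on [T] supported in [A]. *)
Definition extend_by0 (mu : {x : T | x \in A} -> R) (x : T) : R :=
  if insub x is Some u then mu u else 0.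

End Restriction.
Arguments restrict_kernel {R T} A K.

Section Process.
Variables (R : realType) (d : measure_display) (Omega : measurableType d).
Variable P : probability Omega R.

(** [Z] is a version of the conditional probability of [A] given the
    sub-sigma-algebra [G]. *)
Definition is_cond_prob (G : set (set Omega)) (A : set Omega) (Z : Omega -> R)
    : Prop :=
  [/\ forall Y : set R, measurable Y -> G (Z @^-1` Y),
      P.-integrable setT (EFin \o Z)
    & forall B, G B -> P (A `&` B) = (\int[P]_(w in B) (Z w)%:E)%E].

Definition filtration (F : nat -> set (set Omega)) : Prop :=
  [/\ forall n, sigma_algebra setT (F n),
      forall n, F n `<=` measurable
    & forall m n, (m <= n)%N -> F m `<=` F n].

Variable T : finType.

Definition adapted (F : nat -> set (set Omega)) (X : nat -> Omega -> T) : Prop :=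
  forall n (A : set T), F n (X n @^-1` A).

Definition occupation (eta : nat -> R) (X : nat -> Omega -> T) (n : nat)
    (w : Omega) (x : T) : R :=
  (\sum_(k < n.+1) eta k * (X k w == x)%:R) / \sum_(k < n.+1) eta k.

Definition reinforced (K : T -> T -> R) (eta : nat -> R)
    (F : nat -> set (set Omega)) (x0 : T) (X : nat -> Omega -> T) : Prop :=
  [/\ filtration F, adapted F X, forall w, X 0 w = x0
    & forall n (A : {set T}),
        is_cond_prob (F n) [set w | X n.+1 w \in A]
          (fun w => resurrected K (occupation eta X n w) (X n w) A)].

End Process.

Definition gamma_ (R : realType) (eta : nat -> R) (n : nat) : R :=
  eta n / \sum_(k < n.+1) eta k.

(* Main.v *)
(**
Let A = (I - K)^{-1} be the Green kernel, A(x) = A(x, E), and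
Pi_mu = mu A / mu(A), the invariant probability of K_mu. The function
q_mu(x, .) = A(x, .) - A(x) Pi_mu solves the Poisson equation of K_mu
explicitly, so that delta_{X_{n+1}} - Pi_{mu_n} is a martingale increment plus
a telescoping term whose weighted averages vanish. The weighted average of the
martingale increments tends to 0 almost surely: because gamma_n ln n -> 0, an
exponential supermartingale bounds the probability that, restarted from 0 at
time m, it ever exceeds eps by O(1/m), conditionally on the past. Hence mu_n
stays close to Z_n, where Z_{n+1} = (1 - gamma) Z_n + gamma Pi_{mu_n}, and, up
to vanishing errors, Z is a normalized linear recursion driven by A.

A has the same eigenvectors as K. Let h be the right eigenvector of K for
Theta_1, positive on E1 and zero on E2, and mu* the left one, which has full
support since Theta_1 > Theta_2. By Dobrushin's argument A contracts, relative
to its eigenvalue 1/(1 - Theta_1), a weighted l^1 norm on {nu h = 0}, so the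
ratio of the norm of Z_n - (Z_n h) mu* (with mu* h = 1) to Z_n h decreases as
long as Z_n h does not vanish. If Z_n h does not tend to 0 this gives
mu_n -> mu*; otherwise mu_n(E1) -> 0 and the same argument on E2 gives
mu_n -> mu_2*. The persistence of a lower bound on Z_n h, applied after a path
staying in E1 up to a large time, gives (iii). For (iv), as long as the chain
stays in E2 after time N, mu_n(E1) is proportional to prod_{i <= n} (1 - gamma_i)
and bounds the probability of returning to E1 at the next step.
*)

Require Import Defs.
From mathcomp Require Import all_boot all_order all_algebra.
From mathcomp Require Import all_classical all_reals all_analysis.
From mathcomp Require Import ring lra.
Import Order.TTheory GRing.Theory Num.Theory.
Import numFieldNormedType.Exports.

Set Implicit Arguments.
Unset Strict Implicit.
Unset Printing Implicit Defensive.

Local Open Scope classical_set_scope.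
Local Open Scope ring_scope.

(** * Linear algebra and Perron-Frobenius theory on a finite set *)

Section FiniteKernels.
Variables (R : realType) (T : finType).
Implicit Types (M K : T -> T -> R) (mu nu f : T -> R) (S : {set T}).

(** Probability enters only through finite histories: given the list of the first n + 1 states, the
    next transition probability is a number, so supermartingale arguments become inequalities
    between finite sums. Restarting the noise at m has two purposes: an O(1/m) bound makes the event
    of large noise for every m null, and a bound conditional on the past can be combined with a
    prescribed path in E1. The obstacle in the deterministic part is that the dominant coordinate
    may approach 0 while the errors are small only in absolute size. A measure of mass at least 1/2
    cannot have both a small coordinate and a small complementary part; hence a bound on their ratio
    bounds the coordinate from below, and the errors become small relative to it. Eigenvectors come
    from finite linear algebra: left and right null vectors exist together, and signs are recovered
    by pairing absolute values with a positive eigenvector of the other side, which turns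
    inequalities into equalities. The Green kernel comes from a minimum principle instead of a
    spectral radius estimate. *)

Definition dotp mu f : R := \sum_x mu x * f x.

Definition app M f (x : T) : R := \sum_y M x y * f y.

Lemma dotp_mul mu M f : dotp (mu_mul mu M) f = dotp mu (app M f).
Proof.
rewrite /dotp /mu_mul /app.
under eq_bigr => y _ do rewrite mulr_suml.
rewrite exchange_big /=; apply: eq_bigr => x _; rewrite mulr_sumr.
by apply: eq_bigr => y _; rewrite mulrA.
Qed.

Lemma sum_delta_l (F : T -> R) x : \sum_y (x == y)%:R * F y = F x.
Proof.
rewrite (bigD1 x) //= eqxx mul1r big1 ?addr0 // => y.
by rewrite eq_sym => /negPf->; rewrite mul0r.
Qed.

Lemma sum_delta_r (F : T -> R) x : \sum_y F y * (y == x)%:R = F x.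
Proof.
by rewrite -[RHS]sum_delta_l; apply: eq_bigr => y _; rewrite mulrC eq_sym.
Qed.

Lemma sum_delta (x : T) : \sum_y (x == y)%:R = 1 :> R.
Proof.
by rewrite -[RHS](sum_delta_l (fun=> 1) x); apply: eq_bigr => y _; rewrite mulr1.
Qed.

Lemma sumT_ord (F : T -> R) : \sum_x F x = \sum_(i < #|T|) F (enum_val i).
Proof. by rewrite (reindex (@enum_val T T)) //; exact/onW_bij/enum_val_bij. Qed.

Definition kernel_mx M : 'M[R]_#|T| := \matrix_(i, j) M (enum_val i) (enum_val j).

(** A square matrix and its transpose have the same determinant, so a nonzero left null vector
    produces a right one. *)
Lemma singular_right M nu x0 : nu x0 != 0 -> (forall y, mu_mul nu M y = 0) ->
  exists2 f, (exists x, f x != 0) & forall x, app M f x = 0.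
Proof.
move=> nux0 nuM.
have : \det (kernel_mx M) == 0.
  apply/det0P; exists (\row_i nu (enum_val i)).
    apply/eqP => /rowP /(_ (enum_rank x0)); rewrite !mxE enum_rankK => H.
    by rewrite H eqxx in nux0.
  apply/rowP => j; rewrite !mxE -[RHS](nuM (enum_val j)) /mu_mul sumT_ord.
  by apply: eq_bigr => i _; rewrite !mxE.
rewrite -det_tr => /det0P[v v0 vM].
exists (fun x => v ord0 (enum_rank x)).
  have /existsP[i vi] : [exists i, v ord0 i != 0].
    apply: contraNT v0; rewrite negb_exists => /forallP H.
    by apply/eqP/rowP => i; rewrite mxE; apply/eqP; rewrite -[_ == _]negbK.
  by exists (enum_val i); rewrite enum_valK.
move=> x; move/rowP: vM => /(_ (enum_rank x)); rewrite !mxE => <-.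
rewrite /app sumT_ord; apply: eq_bigr => i _.
by rewrite !mxE enum_valK enum_rankK mulrC.
Qed.

Lemma singular_left M f x0 : f x0 != 0 -> (forall x, app M f x = 0) ->
  exists2 nu, (exists x, nu x != 0) & forall y, mu_mul nu M y = 0.
Proof.
move=> fx0 Mf.
have [|nu nu0 nuM] := @singular_right (fun x y => M y x) f x0 fx0.
  by move=> y; rewrite -[RHS](Mf y); apply: eq_bigr => x _; rewrite mulrC.
exists nu => // y; rewrite -[RHS](nuM y).
by apply: eq_bigr => x _; rewrite mulrC.
Qed.

Lemma inverse_exists M :
  (forall f, (forall x, app M f x = 0) -> forall x, f x = 0) ->
  exists A : T -> T -> R,
    (forall x z, \sum_y M x y * A y z = (x == z)%:R) /\
    (forall x z, \sum_y A x y * M y z = (x == z)%:R).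
Proof.
move=> Minj.
have Munit : kernel_mx M \in unitmx.
  rewrite unitmxE unitfE; apply/negP; rewrite -det_tr => /det0P[v v0 vM].
  suff : v = 0 by move=> v0'; rewrite v0' eqxx in v0.
  apply/rowP => i; rewrite mxE.
  have := Minj (fun x => v ord0 (enum_rank x)) _ (enum_val i).
  rewrite enum_valK; apply=> x.
  move/rowP: vM => /(_ (enum_rank x)); rewrite !mxE => <-.
  rewrite /app sumT_ord; apply: eq_bigr => j _.
  by rewrite !mxE enum_valK enum_rankK mulrC.
exists (fun x y => invmx (kernel_mx M) (enum_rank x) (enum_rank y)).
split=> x z.
  have /matrixP/(_ (enum_rank x) (enum_rank z)) := mulmxV Munit.
  rewrite !mxE (can_eq enum_rankK) => <-; rewrite sumT_ord.
  by apply: eq_bigr => j _; rewrite !mxE enum_valK enum_rankK.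
have /matrixP/(_ (enum_rank x) (enum_rank z)) := mulVmx Munit.
rewrite !mxE (can_eq enum_rankK) => <-; rewrite sumT_ord.
by apply: eq_bigr => j _; rewrite !mxE enum_valK enum_rankK.
Qed.

Lemma kernel_pow_ge0 K n x y : (forall x y, 0 <= K x y) -> 0 <= kernel_pow K n x y.
Proof.
move=> K0; elim: n x => [|n IH] x /=; first by rewrite ler0n.
by apply: sumr_ge0 => z _; rewrite mulr_ge0.
Qed.

Lemma leads_pow K x y : (forall x y, 0 <= K x y) ->
  leads K x y <-> exists n, 0 < kernel_pow K n x y.
Proof.
move=> K0; split=> [|[n Kn]].
  move=> L; apply: contrapT => /forallNP H; move: L; rewrite /leads eseries0 ?ltxx//.
  move=> n _ _; congr (_%:E); apply/eqP; rewrite eq_le kernel_pow_ge0 // andbT.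
  by rewrite leNgt; apply/negP/H.
have ge0 i : (0 <= (kernel_pow K i x y)%:E)%E by rewrite lee_fin kernel_pow_ge0.
rewrite /leads; apply: (@lt_le_trans _ _ (\sum_(0 <= i < n.+1) (kernel_pow K i x y)%:E)%E).
  rewrite big_nat_recr //=; apply: (@lt_le_trans _ _ ((kernel_pow K n x y)%:E)).
    by rewrite lte_fin.
  by rewrite leeDr // sume_ge0.
exact: nneseries_lim_ge.
Qed.

Lemma leads1 K x y : (forall x y, 0 <= K x y) -> 0 < K x y -> leads K x y.
Proof.
move=> K0 Kxy; apply/leads_pow => //; exists 1%N => /=.
rewrite (bigD1 y) //= eqxx mulr1 ltr_wpDr // sumr_ge0 // => z _.
by rewrite mulr_ge0.
Qed.

(** Hypotheses of the form [leads K x y] are exploited only through this induction principle, which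
    replaces powers of the kernel by single transitions. *)
Lemma leads_closed K (C : T -> Prop) x y : (forall x y, 0 <= K x y) ->
  (forall x y, C x -> 0 < K x y -> C y) -> leads K x y -> C x -> C y.
Proof.
move=> K0 Ccl /leads_pow-/(_ K0)[n]; elim: n x => [|n IH] x /=.
  by have [->|] := eqVneq x y; rewrite ?ltxx.
move=> Kn Cx; have [z Kz] : exists z, 0 < K x z * kernel_pow K n z y.
  apply: contrapT => /forallNP H; move: Kn; rewrite ltNge => /negP; apply.
  by apply: sumr_le0 => z _; rewrite leNgt; apply/negP/H.
have Kxz : 0 < K x z.
  rewrite lt_neqAle K0 andbT; apply/eqP => K0xz.
  by move: Kz; rewrite -K0xz mul0r ltxx.
apply: (IH z); last exact: Ccl Kxz.
by move: Kz; rewrite pmulr_rgt0.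
Qed.

(** Irreducibility of the block of [K] on [S], in a form that applies directly to positivity sets
    and zero sets of eigenvectors and needs no kernel on a subtype. *)
Definition irreducible_on S K := forall C : T -> Prop,
  (forall x y, x \in S -> y \in S -> C x -> 0 < K x y -> C y) ->
  forall x y, x \in S -> y \in S -> C x -> C y.

Lemma sum_supp S (F : T -> R) : (forall x, x \notin S -> F x = 0) ->
  \sum_x F x = \sum_(x in S) F x.
Proof.
move=> F0; rewrite (bigID (fun x => x \in S)) /= [X in _ + X]big1 ?addr0 //.
Qed.

Lemma sum_gt0_ex (I : finType) (F : I -> R) : 0 < \sum_i F i -> exists i, 0 < F i.
Proof.
move=> s0; apply: contrapT => /forallNP H; move: s0; rewrite ltNge => /negP; apply.
by apply: sumr_le0 => z _; rewrite leNgt; apply/negP/H.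
Qed.

Lemma sum_le_eq (I : finType) (P : pred I) (F G : I -> R) : (forall i, P i -> F i <= G i) ->
  \sum_(i | P i) F i = \sum_(i | P i) G i -> forall i, P i -> F i = G i.
Proof.
move=> FG sFG i Pi; apply/eqP; rewrite -subr_eq0 -oppr_eq0 opprB.
have /allP/(_ i) : all (fun i => P i ==> (G i - F i == 0)) (index_enum I).
  rewrite -psumr_eq0; last by move=> j Pj; rewrite subr_ge0 FG.
  by rewrite big_split /= sumrN sFG subrr.
by rewrite mem_index_enum Pi /= => /(_ isT).
Qed.

(** The support of [m] is closed under transitions inside [S]: a transition from the support into y
    makes the left side of the eigenvalue equation at y positive. *)
Lemma eigen_pos S K m Th : (forall x y, 0 <= K x y) -> irreducible_on S K ->
  (forall x, 0 <= m x) -> (exists2 x, x \in S & 0 < m x) ->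
  (forall y, y \in S -> mu_mul m K y = Th * m y) -> forall x, x \in S -> 0 < m x.
Proof.
move=> K0 irr m0 [x xS mx] mK y yS.
apply: (irr (fun y => 0 < m y) _ x) => // {y yS x xS mx} x y xS yS mx Kxy.
rewrite lt_neqAle m0 andbT; apply/eqP => my0.
have : 0 < mu_mul m K y.
  rewrite /mu_mul (bigD1 x) //= ltr_pwDl ?mulr_gt0 // sumr_ge0 // => z _.
  by rewrite mulr_ge0.
by rewrite mK // -my0 mulr0 ltxx.
Qed.

(* A positive left eigenvector turns the inequality K|f| >= Th |f| for a real
   right eigenvector f into an equality. *)
Lemma perron_right S K m Th : (forall x y, 0 <= K x y) -> irreducible_on S K ->
  0 < Th -> (forall x, x \in S -> 0 < m x) -> (exists x, x \in S) ->
  (forall y, y \in S -> \sum_(x in S) m x * K x y = Th * m y) ->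
  exists h, [/\ forall x, x \in S -> 0 < h x, forall x, x \notin S -> h x = 0
    & forall x, x \in S -> app K h x = Th * h x].
Proof.
move=> K0 irr Th0 mpos [x0 x0S] mK.
(* Rows outside [S] of the truncated operator reduce to - Th on the diagonal, so a right null vector
   vanishes there. *)
pose KS x y : R := if (x \in S) && (y \in S) then K x y else 0.
pose mS x : R := if x \in S then m x else 0.
have [||f [z fz] Mf] := @singular_right (fun x y => KS x y - Th * (x == y)%:R) mS x0.
- by rewrite /mS x0S gt_eqF ?mpos.
- move=> y; rewrite /mu_mul.
  under eq_bigr => x _ do rewrite mulrBr.
  rewrite sumrB; apply/eqP; rewrite subr_eq0; apply/eqP.
  under [RHS]eq_bigr => x _ do rewrite mulrA.
  rewrite sum_delta_r.
  rewrite /mS; have [yS|ynS] := boolP (y \in S).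
    rewrite mulrC -mK // (bigID (fun x => x \in S)) /= addrC big1 ?add0r.
      by apply: eq_bigr => x xS; rewrite xS /KS xS yS.
    by move=> x /negPf->; rewrite mul0r.
  by rewrite mul0r big1 // => x _; rewrite /KS (negPf ynS) andbF mulr0.
have KSf x : app KS f x = Th * f x.
  apply/eqP; rewrite -subr_eq0 -(Mf x) /app.
  under [X in _ == X]eq_bigr => y _ do rewrite mulrBl.
  rewrite sumrB; apply/eqP; congr (_ - _).
  under eq_bigr => y _ do rewrite -mulrA.
  by rewrite -mulr_sumr sum_delta_l.
have f0 x : x \notin S -> f x = 0.
  move=> xS; have := KSf x; rewrite /app big1.
    by move/esym/eqP; rewrite mulf_eq0 gt_eqF //= => /eqP.
  by move=> y _; rewrite /KS (negPf xS) mul0r.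
pose h x := `|f x|.
have KSK x : x \in S -> app KS h x = app K h x.
  move=> xS; rewrite /app; apply: eq_bigr => y _; rewrite /KS xS /=.
  by case: ifPn => // yS; rewrite /h f0 // normr0 !mulr0.
have sub x : x \in S -> Th * h x <= app K h x.
  move=> xS; rewrite -KSK // -{1}(gtr0_norm Th0) -normrM -KSf.
  apply: le_trans (ler_norm_sum _ _ _) _; apply: ler_sum => y _.
  by rewrite normrM /KS; case: ifP; rewrite ?normr0 // ger0_norm.
have Kh x : x \in S -> app K h x = Th * h x.
  move=> xS; apply/esym; apply: (mulfI (lt0r_neq0 (mpos x xS))).
  apply: (@sum_le_eq _ (mem S) (fun x => m x * (Th * h x)) (fun x => m x * app K h x)) => //.
    by move=> y yS; rewrite ler_wpM2l ?sub // ltW // mpos.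
  transitivity (\sum_(x in S) \sum_(y in S) m x * K x y * h y); last first.
    apply: eq_bigr => y yS; rewrite /app mulr_sumr (@sum_supp S).
      by apply: eq_bigr => w _; rewrite mulrA.
    by move=> w wS; rewrite /h f0 // normr0 !mulr0.
  rewrite exchange_big /=; apply: eq_bigr => y yS.
  by rewrite -mulr_suml mK // [m y * _]mulrC mulrAC.
have zS : z \in S by apply: contraNT fz => /f0->.
exists h; split=> //; last by move=> x xS; rewrite /h f0 ?normr0.
move=> x xS; rewrite lt_neqAle normr_ge0 andbT; apply/eqP => hx.
(* At a zero of [h] the nonnegative terms K x y * h y sum to 0, so zeros propagate inside [S] up to
   z. *)
have : h z = 0.
  apply: (irr (fun x => h x = 0) _ x z) => // {hx xS} {}x y xS yS hx Kxy.
  have := Kh x xS; rewrite hx mulr0 /app => /eqP.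
  rewrite psumr_eq0 => [/allP/(_ y)|w _]; last by rewrite mulr_ge0 // normr_ge0.
  by rewrite mem_index_enum mulf_eq0 gt_eqF //= => /(_ isT)/eqP.
by move/eqP; rewrite normr_eq0 (negPf fz).
Qed.

End FiniteKernels.

(** * The Green kernel *)

Section Green.
Variables (R : realType) (T : finType) (K : T -> T -> R).
Hypothesis K_sub : sub_markovian K.
Hypothesis K_kills : forall C : T -> Prop, (exists x, C x) ->
  (forall x y, C x -> 0 < K x y -> C y) ->
  exists2 x, C x & total_mass (K x) < 1.

Let K0 : forall x y, 0 <= K x y. Proof. by case: K_sub. Qed.
Let K1 x : total_mass (K x) <= 1. Proof. by case: K_sub => _ /(_ x)/andP[]. Qed.

(* A negative minimum would propagate along the kernel up to a killed state. *)
Lemma min_principle f : (forall x, app K f x <= f x) -> forall x, 0 <= f x.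
Proof.
move=> fK x1; pose x0 := [arg min_(x < x1) f x]%O.
have fmin y : f x0 <= f y by rewrite /x0; case: arg_minP => // i _; apply.
apply: le_trans (fmin x1); rewrite leNgt; apply/negP => fx0.
have key x : f x = f x0 ->
    (forall y, K x y * (f y - f x0) = 0) /\ total_mass (K x) = 1.
  move=> fx; have t0 y : 0 <= K x y * (f y - f x0).
    by rewrite mulr_ge0 // subr_ge0 fmin.
  have : \sum_y K x y * (f y - f x0) <= f x0 * (1 - total_mass (K x)).
    under eq_bigr => y _ do rewrite mulrBr.
    rewrite sumrB -mulr_suml -/(total_mass (K x)) mulrBr mulr1 lerB //.
      by rewrite -fx fK.
    by rewrite mulrC.
  have Kx := K1 x; move=> le1.
  have h0 : f x0 * (1 - total_mass (K x)) <= 0.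
    by rewrite nmulr_rle0 // subr_ge0.
  have s0 : \sum_y K x y * (f y - f x0) = 0.
    by apply/eqP; rewrite eq_le (le_trans le1) //= sumr_ge0.
  split.
    move=> y; apply/eqP; move/eqP: s0; rewrite psumr_eq0 //.
    by move/allP/(_ y); rewrite mem_index_enum => /(_ isT).
  apply/eqP; rewrite eq_le Kx /= -subr_le0 -(nmulr_rge0 _ fx0).
  by rewrite -s0.
have [] := @K_kills (fun x => f x = f x0); first by exists x0.
  move=> x y /key[+ _] Kxy => /(_ y)/eqP.
  by rewrite mulf_eq0 gt_eqF //= subr_eq0 => /eqP.
by move=> x /key[_ ->]; rewrite ltxx.
Qed.

Definition is_green (A : T -> T -> R) :=
  [/\ forall x z, \sum_y K x y * A y z = A x z - (x == z)%:R,
      forall x z, \sum_y A x y * K y z = A x z - (x == z)%:R,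
      forall x y, 0 <= A x y
    & forall x, 1 <= total_mass (A x)].

(** Injectivity of I - K is the minimum principle applied to f and - f. Nonnegativity of a column of
    A is the same principle, since K A(., y) <= A(., y). *)
Lemma green_exists : exists A, is_green A.
Proof.
have [|A [KA AK]] := @inverse_exists R T (fun x y => (x == y)%:R - K x y).
  move=> f fK.
  have Kf x : app K f x = f x.
    apply/eqP; rewrite eq_sym -subr_eq0 -(fK x) /app.
    under [X in _ == X]eq_bigr => y _ do rewrite mulrBl.
    by rewrite sumrB sum_delta_l.
  move=> x; apply/eqP; rewrite eq_le (min_principle (f := f)) ?andbT; last first.
    by move=> y; rewrite Kf.
  rewrite -oppr_ge0; apply: (min_principle (f := fun x => - f x)) => y.
  by rewrite -Kf /app -sumrN ler_sum // => z _; rewrite mulrN.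
have G1 x z : \sum_y K x y * A y z = A x z - (x == z)%:R.
  rewrite -KA; under [in RHS]eq_bigr => y _ do rewrite mulrBl.
  by rewrite sumrB sum_delta_l opprB addrC subrK.
have G2 x z : \sum_y A x y * K y z = A x z - (x == z)%:R.
  rewrite -AK; under [in RHS]eq_bigr => y _ do rewrite mulrBr.
  by rewrite sumrB sum_delta_r opprB addrC subrK.
have G3 x y : 0 <= A x y.
  apply: (min_principle (f := A^~ y)) => {}x.
  by rewrite /app G1 gerBl ler0n.
exists A; split=> // x.
have -> : total_mass (A x) = 1 + \sum_y K x y * total_mass (A y).
  rewrite /total_mass; under [in RHS]eq_bigr => y _ do rewrite mulr_sumr.
  rewrite exchange_big /=; under [in RHS]eq_bigr => z _ do rewrite G1.
  by rewrite sumrB sum_delta addrC subrK.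
by rewrite lerDl sumr_ge0 // => y _; rewrite mulr_ge0 // sumr_ge0.
Qed.

Variable A : T -> T -> R.
Hypothesis A_green : is_green A.

(** When K f = Th f, the function f - K f is (1 - Th) f, so this identity makes f an eigenvector of
    A for 1 / (1 - Th). *)
Lemma green_app f x : app A (fun y => f y - app K f y) x = f x.
Proof.
case: A_green => _ G2 _ _; rewrite /app.
under eq_bigr => y _ do rewrite mulrBr mulr_sumr.
rewrite sumrB exchange_big /=.
under [X in _ - X]eq_bigr => z _.
  under eq_bigr => y _ do rewrite mulrA.
  rewrite -mulr_suml G2 mulrBl; over.
by rewrite sumrB opprB addrC subrK sum_delta_l.
Qed.

Lemma green_mul nu y : mu_mul (fun x => nu x - mu_mul nu K x) A y = nu y.
Proof.
case: A_green => G1 _ _ _; rewrite /mu_mul.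
under eq_bigr => x _ do rewrite mulrBl mulr_suml.
rewrite sumrB exchange_big /=.
under [X in _ - X]eq_bigr => z _.
  under eq_bigr => x _ do rewrite -mulrA.
  rewrite -mulr_sumr G1 mulrBr; over.
by rewrite sumrB opprB addrC subrK sum_delta_r.
Qed.

(** A zero of the column A(., y) propagates to successors, hence to y itself, where the Green
    equation would make K A equal to - 1, against nonnegativity. *)
Lemma green_gt0 (S : {set T}) x y : irreducible_on S K -> x \in S -> y \in S -> 0 < A x y.
Proof.
case: A_green => G1 _ A0 _ irr xS yS.
rewrite lt_neqAle A0 andbT; apply/eqP => /esym Axy.
have : A y y = 0.
  apply: (irr (fun z => A z y = 0) _ x) => // {x xS Axy} x z _ _ Axy Kxz.
  have : \sum_t K x t * A t y <= 0 by rewrite G1 Axy sub0r oppr_le0 ler0n.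
  move=> s0; have /eqP : \sum_t K x t * A t y = 0.
    by apply/eqP; rewrite eq_le s0 sumr_ge0 // => t _; rewrite mulr_ge0.
  rewrite psumr_eq0 => [/allP/(_ z)|t _]; last by rewrite mulr_ge0.
  by rewrite mem_index_enum mulf_eq0 gt_eqF //= => /(_ isT)/eqP.
move=> Ayy; have := G1 y y; rewrite Ayy eqxx sub0r => s1.
have : 0 <= \sum_t K y t * A t y by rewrite sumr_ge0 // => t _; rewrite mulr_ge0.
by rewrite s1 oppr_ge0 ler10.
Qed.

(** The function equal to - A(., y) on [S] and to 0 outside is superharmonic because [S] is closed;
    the minimum principle then gives A(x, y) <= 0. *)
Lemma green_block (S : {set T}) x y : (forall x y, x \in S -> y \notin S -> K x y = 0) ->
  x \in S -> y \notin S -> A x y = 0.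
Proof.
case: A_green => G1 _ A0 _ Kcl xS yS.
pose f x : R := if x \in S then - A x y else 0.
have : 0 <= f x.
  apply: min_principle => {xS} {}x; rewrite /app {2}/f; case: ifPn => xS.
    have -> : - A x y = - \sum_z K x z * A z y.
      rewrite G1; have [xy|_] := eqVneq x y; last by rewrite subr0.
      by rewrite xy (negPf yS) in xS.
    rewrite -sumrN ler_sum // => z _; rewrite /f; case: ifPn => zS; first by rewrite mulrN.
    by rewrite (Kcl x z xS zS) !mul0r oppr0.
  apply: sumr_le0 => z _; rewrite /f; case: ifP => _; rewrite ?mulr0 //.
  by rewrite mulrN oppr_le0 mulr_ge0.
rewrite /f xS oppr_ge0 => A1; apply/eqP; by rewrite eq_le A1 A0.
Qed.

End Green.

(* Dobrushin's contraction argument, for the h-transform of A on S. *)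
Section Contraction.
Variables (R : realType) (T : finType) (A : T -> T -> R).

Lemma dobrushin (S : {set T}) (h m : T -> R) (al : R) :
  (exists x, x \in S) ->
  (forall x y, x \in S -> y \in S -> 0 < A x y) ->
  (forall x, x \in S -> 0 < h x) -> (forall x, x \in S -> 0 < m x) ->
  (forall x, x \in S -> \sum_(y in S) A x y * h y = al * h x) -> 0 < al ->
  exists2 k, 0 <= k < 1 & forall nu : T -> R,
    \sum_(x in S) nu x * h x = 0 ->
    \sum_(y in S) `|\sum_(x in S) nu x * A x y| * h y <=
      k * al * \sum_(x in S) `|nu x| * h x.
Proof.
move=> [x0 x0S] Apos hpos mpos Ah al0.
pose r (p : T * T) := A p.1 p.2 / (h p.1 * m p.2).
pose SS := finset.setX S S.
have [p pSS rmin] : exists2 p, p \in SS & forall q, q \in SS -> r p <= r q.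
  pose p := [arg min_(p < (x0, x0) in SS) r p]%O.
  exists p; rewrite /p; case: arg_minP => //; rewrite inE /= x0S //.
have [pS1 pS2] : p.1 \in S /\ p.2 \in S by move: pSS; rewrite inE => /andP.
(* The largest constant with A(x, y) >= be h(x) m(y) on [S]. Subtracting this rank-one kernel does
   not change nu A when nu h = 0, and lowers the h-weighted row sums from al h to (al - be mh) h. *)
pose be := r p.
have be0 : 0 < be.
  by rewrite /be /r divr_gt0 ?Apos // mulr_gt0 ?hpos ?mpos.
have Abe x y : x \in S -> y \in S -> be * (h x * m y) <= A x y.
  move=> xS yS; rewrite -ler_pdivlMr; last by rewrite mulr_gt0 ?hpos ?mpos.
  by apply: (rmin (x, y)); rewrite inE /= xS.
pose mh := \sum_(y in S) m y * h y.
have mh0 : 0 < mh.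
  rewrite /mh (bigD1 x0) //= ltr_pwDl ?mulr_gt0 ?hpos ?mpos //.
  by rewrite sumr_ge0 // => x /andP[xS _]; rewrite mulr_ge0 // ltW ?hpos ?mpos.
have row x : x \in S ->
    \sum_(y in S) (A x y - be * (h x * m y)) * h y = (al - be * mh) * h x.
  move=> xS; under eq_bigr => y _ do rewrite mulrBl.
  rewrite sumrB Ah // mulrBl; congr (_ - _).
  rewrite /mh mulr_sumr mulr_suml; apply: eq_bigr => y _; ring.
have albe : 0 <= al - be * mh.
  rewrite -(pmulr_lge0 _ (hpos _ x0S)) -row // sumr_ge0 // => y yS.
  by rewrite mulr_ge0 ?subr_ge0 ?Abe // ltW ?hpos.
exists ((al - be * mh) / al).
  by rewrite divr_ge0 ?(ltW al0) //= ltr_pdivrMr // mul1r gtrBl mulr_gt0.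
move=> nu nuh; rewrite divfK ?gt_eqF //.
have nuA y : \sum_(x in S) nu x * A x y =
             \sum_(x in S) nu x * (A x y - be * (h x * m y)).
  under [RHS]eq_bigr => x _ do rewrite mulrBr.
  rewrite sumrB; apply/eqP; rewrite -subr_eq0 opprB addrC subrK.
  have -> : \sum_(x in S) nu x * (be * (h x * m y)) =
            be * m y * \sum_(x in S) nu x * h x.
    by rewrite mulr_sumr; apply: eq_bigr => x _; ring.
  by rewrite nuh mulr0.
apply: (@le_trans _ _ (\sum_(y in S) \sum_(x in S)
     `|nu x| * ((A x y - be * (h x * m y)) * h y))).
  apply: ler_sum => y yS; rewrite nuA.
  under [leRHS]eq_bigr => x _ do rewrite [_ * (_ * h y)]mulrA.
  rewrite -[leRHS]mulr_suml ler_wpM2r ?(ltW (hpos _ yS)) //.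
  apply: le_trans (ler_norm_sum _ _ _) _; apply: ler_sum => x xS.
  by rewrite normrM (ger0_norm (x := _ - _)) // subr_ge0 Abe.
rewrite exchange_big /= mulr_sumr; apply: ler_sum => x xS.
by rewrite -mulr_sumr row // mulrCA.
Qed.

End Contraction.

(** * Real recursions *)

Section RealSequences.
Variable R : realType.
Implicit Types (u v g e s D b : nat -> R).

Definition vanishes u := forall eps : R, 0 < eps ->
  exists N, forall n, (N <= n)%N -> `|u n| <= eps.

Definition diverges g := forall B : R, exists n, B <= \sum_(k < n) g k.

Lemma vanishes_le u v : vanishes v -> (forall n, `|u n| <= v n) -> vanishes u.
Proof.
move=> vv uv eps eps0; have [N HN] := vv _ eps0; exists N => n Nn.
by rewrite (le_trans (uv n)) // (le_trans (ler_norm _)) // HN.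
Qed.

Lemma vanishesD u v : vanishes u -> vanishes v -> vanishes (fun n => u n + v n).
Proof.
move=> vu vv eps eps0; have e2 : 0 < eps / 2 by rewrite divr_gt0.
have [N HN] := vu _ e2; have [M HM] := vv _ e2.
exists (maxn N M) => n; rewrite geq_max => /andP[Nn Mn].
by rewrite [eps]splitr (le_trans (ler_normD _ _)) // lerD ?HN ?HM.
Qed.

Lemma vanishesM c u : vanishes u -> vanishes (fun n => c * u n).
Proof.
move=> vu eps eps0; have c0 : 0 < `|c| + 1 by rewrite ltr_wpDl.
have [N HN] := vu _ (divr_gt0 eps0 c0); exists N => n /HN H.
rewrite normrM (le_trans (ler_wpM2l (normr_ge0 c) H)) //.
by rewrite mulrCA ger_pMr // ler_pdivrMr // mul1r lerDl.
Qed.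

Lemma vanishes_sum (T : finType) (u : T -> nat -> R) :
  (forall x, vanishes (u x)) -> vanishes (fun n => \sum_x u x n).
Proof.
move=> vu; suff H : forall r : seq T, vanishes (fun n => \sum_(x <- r) u x n) by exact: H.
elim=> [|x r IH].
  by move=> eps eps0; exists 0%N => n _; rewrite big_nil normr0 ltW.
move=> eps /(vanishesD (vu x) IH)[N HN]; exists N => n /HN.
by rewrite big_cons.
Qed.

Lemma vanishes_shift u m : vanishes u -> vanishes (fun n => u (m + n)%N).
Proof.
move=> vu eps /vu[N HN]; exists N => n Nn.
by apply: HN; rewrite (leq_trans Nn) // leq_addl.
Qed.

Lemma vanishes_unshift u m : vanishes (fun n => u (m + n)%N) -> vanishes u.
Proof.
move=> vu eps /vu[N HN]; exists (m + N)%N => n mNn.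
by rewrite -(subnKC (leq_trans (leq_addr N m) mNn)) HN // leq_subRL // (leq_trans _ mNn) // leq_addr.
Qed.

Lemma sum_ord_split g m n : (m <= n)%N ->
  \sum_(k < n) g k = \sum_(k < m) g k + \sum_(k < n - m) g (m + k)%N.
Proof. by move=> /subnKC <-; rewrite addKn big_split_ord. Qed.

Lemma diverges_shift g m : diverges g -> diverges (fun n => g (m + n)%N).
Proof.
move=> dg B; have [n Hn] := dg (B + \sum_(k < m) `|g k| + \sum_(k < m) g k + \sum_(k < m) `|g k|).
have [nm|mn] := leqP n m.
  exists 0%N; rewrite big_ord0.
  have : \sum_(k < n) g k <= \sum_(k < m) `|g k|.
    rewrite (@sum_ord_split (fun k => `|g k|) n m nm) ler_wpDr ?sumr_ge0 //.
    by apply: ler_sum => i _; exact: ler_norm.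
  have : - \sum_(k < m) `|g k| <= \sum_(k < m) g k.
    by rewrite -sumrN; apply: ler_sum => i _; rewrite lerNnormlW.
  have : 0 <= \sum_(k < m) `|g k| by rewrite sumr_ge0.
  lra.
exists (n - m)%N; move: Hn; rewrite (sum_ord_split _ (ltnW mn)).
have : 0 <= \sum_(k < m) `|g k| by rewrite sumr_ge0.
lra.
Qed.

(** An elementary substitute for prod (1 - g) <= exp (- sum g): the bound 1 / (1 + sum g) tends to 0
    as soon as the sum diverges. *)
Lemma prod_contract_le g n : (forall k, 0 <= g k <= 1) ->
  0 <= \prod_(k < n) (1 - g k) /\
  (\prod_(k < n) (1 - g k)) * (1 + \sum_(k < n) g k) <= 1.
Proof.
move=> g01; elim: n => [|n [IH0 IH]]; first by rewrite !big_ord0; split; lra.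
rewrite !big_ord_recr /=; have := g01 n; set p := \prod_(k < n) _ in IH0 IH *.
set s := \sum_(k < n) _ in IH *; have s0 : 0 <= s.
  by rewrite sumr_ge0 // => i _; have /andP[] := g01 i.
move=> /andP[a0 a1]; split; first by rewrite mulr_ge0 // subr_ge0.
apply: le_trans IH; rewrite -mulrA ler_wpM2l //.
have : 0 <= g n * s by rewrite mulr_ge0.
have : 0 <= g n * g n by rewrite mulr_ge0.
rewrite mulrBl mul1r; nra.
Qed.

Lemma prod_contract_vanishes g : (forall k, 0 <= g k <= 1) -> diverges g ->
  vanishes (fun n => \prod_(k < n) (1 - g k)).
Proof.
move=> g01 dg eps eps0; have [N HN] := dg (eps^-1); exists N => n Nn.
have [p0 p1] := prod_contract_le n g01; rewrite ger0_norm //.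
have Sn : eps^-1 <= \sum_(k < n) g k.
  rewrite (sum_ord_split _ Nn) ler_wpDr // sumr_ge0 // => i _.
  by have /andP[] := g01 (N + i)%N.
rewrite -[leRHS]invrK -[leRHS]mul1r ler_pdivlMr ?invr_gt0 //.
by apply: le_trans p1; rewrite ler_wpM2l // ler_wpDl.
Qed.

Lemma averaging_bound u g e B : (forall k, 0 <= g k <= 1) ->
  (forall n, u n.+1 <= (1 - g n) * u n + g n * e n) ->
  u 0%N <= B -> (forall n, e n <= B) -> forall n, u n <= B.
Proof.
move=> g01 ug u0 eB; elim=> // n IH; apply: le_trans (ug n) _.
have /andP[? ?] := g01 n; have -> : B = (1 - g n) * B + g n * B by ring.
by rewrite lerD // ler_wpM2l // subr_ge0.
Qed.

(** Once e <= eps / 2, the excess of u over eps / 2 is damped by 1 - g at each step, and the product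
    of these factors tends to 0. *)
Lemma averaging_vanishes u g e : (forall k, 0 <= g k <= 1) -> diverges g ->
  (forall n, 0 <= u n) ->
  (forall n, u n.+1 <= (1 - g n) * u n + g n * e n) ->
  vanishes e -> vanishes u.
Proof.
move=> g01 dg u0 ug ve eps eps0; have e2 : 0 < eps / 2 by rewrite divr_gt0.
have [N HN] := ve _ e2.
have up k : u (N + k)%N <= eps / 2 + (\prod_(j < k) (1 - g (N + j)%N)) * u N.
  elim: k => [|k IH]; first by rewrite addn0 big_ord0 mul1r ler_wpDl // ltW.
  rewrite addnS big_ord_recr /=; apply: le_trans (ug _) _.
  have /andP[g0 g1] := g01 (N + k)%N.
  have /(_ (leq_addr _ _)) := HN (N + k)%N; rewrite ler_norml => /andP[_ eN].
  apply: (@le_trans _ _ ((1 - g (N + k)%N) *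
      (eps / 2 + (\prod_(j < k) (1 - g (N + j)%N)) * u N) + g (N + k)%N * (eps / 2))).
    by rewrite lerD // ler_wpM2l // subr_ge0.
  by rewrite le_eqVlt; apply/orP; left; apply/eqP; ring.
have [||M HM] := @prod_contract_vanishes (fun j => g (N + j)%N) _ (diverges_shift N dg)
  (eps / 2 / (u N + 1)).
- by move=> k; exact: g01.
- by rewrite divr_gt0 // ltr_wpDl.
exists (N + M)%N => n NMn.
have Nn : (N <= n)%N by rewrite (leq_trans _ NMn) // leq_addr.
rewrite ger0_norm // -(subnKC Nn) (le_trans (up _)) // [leRHS]splitr lerD2l.
have := HM (n - N)%N; rewrite leq_subRL // => /(_ NMn) H.
apply: le_trans (ler_wpM2r (u0 N) (le_trans (ler_norm _) H)) _.
by rewrite mulrAC ler_pdivrMr ?ltr_wpDl // ler_wpM2l ?(ltW e2) // lerDl.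
Qed.

(** * Ratio of a distance [D] to a coordinate [b] along a perturbed linear recursion *)

Section Ratio.
Variables (g s D b e : nat -> R) (al k slo c0 C : R).
Hypothesis g01 : forall n, 0 <= g n <= 1.
Hypothesis slo0 : 0 < slo.
Hypothesis s01 : forall n, slo <= s n <= 1.
Hypothesis al0 : 0 < al.
Hypothesis k01 : 0 <= k < 1.
Hypothesis b0 : forall n, 0 <= b n.
Hypothesis e0 : forall n, 0 <= e n.
Hypothesis c00 : 0 < c0.
Hypothesis C0 : 0 <= C.
Hypothesis DbC : forall n, c0 <= D n + C * b n.
Hypothesis Dstep : forall n,
  D n.+1 <= (1 - g n + g n * s n * (k * al)) * D n + g n * e n.
Hypothesis bstep : forall n,
  (1 - g n + g n * s n * al) * b n - g n * e n <= b n.+1.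

(** In one step [b] grows at rate s al and [D] at rate s k al; [c] is half of the smallest gap
    between these rates. [la] is a speed at which the ratio may decrease using only this half. *)
Let c := slo * al * (1 - k) / 2.
Let la := c / (1 + al).

Let c_gt0 : 0 < c.
Proof. by case/andP: k01 => _ k1; rewrite divr_gt0 // !mulr_gt0 // subr_gt0. Qed.

(* The bound D <= rho * b is propagated with a slowly decreasing rho, which
   avoids dividing by b. *)
Let ratio_step n rho rho' : 0 <= rho' <= rho -> (1 - la * g n) * rho <= rho' ->
  D n <= rho * b n -> e n * (1 + rho) <= rho * b n * c -> D n.+1 <= rho' * b n.+1.
Proof.
move=> /andP[rho'0 rr] lar Drho ee.
have /andP[g0 g1] := g01 n; have /andP[sl s1] := s01 n; have /andP[k0 k1] := k01.
have s0 : 0 <= s n by rewrite (le_trans (ltW slo0)).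
have r0 : 0 <= rho by rewrite (le_trans rho'0).
have [sa saE] : {sa | sa = s n * al} by exists (s n * al).
have sa0 : 0 <= sa by rewrite saE mulr_ge0 // ltW.
have saal : sa <= al by rewrite saE ler_piMl // ltW.
have u0 : 0 <= 1 - g n + g n * sa by rewrite addr_ge0 ?subr_ge0 ?mulr_ge0.
have u1 : 1 - g n + g n * sa <= 1 + al.
  have : g n * sa <= sa by rewrite ler_piMl.
  lra.
have rb : 0 <= rho * b n by rewrite mulr_ge0.
apply: le_trans (Dstep n) _.
apply: (@le_trans _ _ ((1 - g n + g n * sa * k) * (rho * b n) + g n * e n)).
  rewrite lerD2r.
  have -> : g n * s n * (k * al) = g n * sa * k by rewrite saE; ring.
  by rewrite ler_wpM2l // addr_ge0 ?subr_ge0 // !mulr_ge0.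
apply: (@le_trans _ _ (rho' * ((1 - g n + g n * sa) * b n - g n * e n))); last first.
  by rewrite ler_wpM2l //; have := bstep n; rewrite saE mulrA.
rewrite mulrBr; apply: (@le_trans _ _
    ((1 - la * g n) * rho * ((1 - g n + g n * sa) * b n) - rho * (g n * e n))); last first.
  apply: lerB; first by rewrite ler_wpM2r // mulr_ge0.
  by rewrite ler_wpM2r // mulr_ge0.
(* The gap is at least 2 c: one [c] pays for the decrease of [rho] (this inequality), the other for
   the errors. *)
have key : la * (1 - g n + g n * sa) <= c.
  rewrite /la mulrAC ler_pdivrMr ?ler_wpM2l ?(ltW c_gt0) //.
  by rewrite ltr_wpDr // ltW.
have key2 : 2 * c <= sa * (1 - k).
  have -> : 2 * c = slo * al * (1 - k) by rewrite /c; field.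
  by rewrite saE ler_wpM2r ?subr_ge0 ?(ltW k1) // ler_wpM2r // ltW.
rewrite -subr_ge0.
have -> : (1 - la * g n) * rho * ((1 - g n + g n * sa) * b n) - rho * (g n * e n) -
  ((1 - g n + g n * sa * k) * (rho * b n) + g n * e n) =
  g n * ((sa * (1 - k) - la * (1 - g n + g n * sa)) * (rho * b n) - e n * (1 + rho)) by ring.
rewrite mulr_ge0 // subr_ge0 (le_trans ee) // mulrC ler_wpM2r //.
lra.
Qed.

(** [D] and [b] are never small together, so a bounded ratio keeps [b] away from 0, and absolute
    bounds on the errors become relative ones. The + 1 keeps the denominator positive. *)
Let b_low n rho : 0 <= rho -> D n <= rho * b n -> c0 / (rho + C + 1) <= b n.
Proof.
move=> r0 Drb; rewrite ler_pdivrMr; last by rewrite ltr_wpDl // addr_ge0.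
by have := DbC n; have := b0 n; nra.
Qed.

(** The size allowed for the errors is computed from the lower bound on [b] that the ratio
    inequality itself provides, so the induction closes. *)
Lemma ratio_persist rho : 0 < rho -> D 0%N <= rho * b 0%N ->
  (forall n, e n * (1 + rho) <= rho * (c0 / (rho + C + 1)) * c) ->
  forall n, D n <= rho * b n.
Proof.
move=> r0 D00 ee; elim=> // n IH; apply: (@ratio_step n rho rho) => //.
- by rewrite lexx ltW.
- have /andP[g0 g1] := g01 n.
  rewrite ler_piMl ?(ltW r0) // gerBl mulr_ge0 // divr_ge0 ?(ltW c_gt0) //.
  by rewrite addr_ge0 // ltW.
- apply: le_trans (ee n) _; rewrite ler_wpM2r ?(ltW c_gt0) // ler_wpM2l ?(ltW r0) //.
  by apply: b_low => //; exact: ltW.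
Qed.

Lemma ratio_lower rho n : 0 < rho -> D n <= rho * b n -> c0 / (rho + C + 1) <= b n.
Proof. by move=> r0; apply: b_low; exact: ltW. Qed.

Lemma ratio_vanishes rho1 rho : diverges g -> 0 < rho <= rho1 ->
  D 0%N <= rho1 * b 0%N ->
  (forall n, e n * (1 + rho1) <= rho * (c0 / (rho1 + C + 1)) * c) ->
  exists N, forall n, (N <= n)%N -> D n <= rho * b n.
Proof.
move=> dg /andP[r0 rr1] D00 ee.
have r10 : 0 < rho1 by rewrite (lt_le_trans r0).
have al1 : 0 < 1 + al by rewrite ltr_wpDr // ltW.
have la0 : 0 < la by rewrite divr_gt0.
have la1 : la <= 1.
  rewrite ler_pdivrMr // mul1r /c; have /andP[k0 k1] := k01.
  have slo1 : slo <= 1 by have /andP[a1 a2] := s01 0; rewrite (le_trans a1).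
  have : slo * al * (1 - k) <= al.
    have a1 : slo * al <= al by rewrite ler_piMl // ltW.
    rewrite -[leRHS]mulr1 ler_pM ?mulr_ge0 ?subr_ge0 ?(ltW k1) ?(ltW al0) ?(ltW slo0) //.
    by rewrite gerBl.
  have := al0; lra.
have lg01 n : 0 <= la * g n <= 1.
  have /andP[g0 g1] := g01 n.
  by rewrite mulr_ge0 ?(ltW la0) //= (le_trans _ la1) // ler_piMr // ltW.
pose p n := \prod_(j < n) (1 - la * g j).
(* The ratio decreases like the product of 1 - la g and is stopped at the target [rho]; stopping it
   keeps the allowed errors bounded away from 0. *)
pose r n := Num.max rho (p n * rho1).
have p01 n : 0 <= p n <= 1.
  rewrite prodr_ge0 /=; last by move=> i _; have /andP[] := lg01 i; rewrite subr_ge0.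
  elim: n => [|n IH]; first by rewrite /p big_ord0.
  have /andP[? ?] := lg01 n.
  rewrite /p big_ord_recr /= (le_trans _ IH) // ler_piMr ?gerBl //.
  by rewrite prodr_ge0 // => i _; have /andP[] := lg01 i; rewrite subr_ge0.
have Dr n : D n <= r n * b n.
  elim: n => [|n IH].
    by rewrite /r /p big_ord0 mul1r (max_idPr rr1).
  have rn : rho <= r n by rewrite le_max lexx.
  have rn1 : r n <= rho1.
    by rewrite ge_max rr1 ler_piMl ?(ltW r10) //; case/andP: (p01 n).
  have r_ge0 : 0 <= r n by rewrite (le_trans (ltW r0)).
  have /andP[l0 l1] := lg01 n.
  apply: (@ratio_step n (r n)) => //.
  - apply/andP; split; first by rewrite le_max (ltW r0).
    rewrite ge_max rn /= /r le_max; apply/orP; right.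
    rewrite ler_wpM2r ?(ltW r10) // /p big_ord_recr /= ler_piMr ?gerBl //.
    by case/andP: (p01 n).
  - rewrite {1}/r maxr_pMr ?subr_ge0 // ge_max; apply/andP; split.
      by rewrite le_max ler_piMl ?gerBl // ltW.
    rewrite /r le_max; apply/orP; right; rewrite [p n.+1]/p big_ord_recr /= -/(p n).
    by rewrite mulrA [_ * p n]mulrC.
  - apply: (@le_trans _ _ (e n * (1 + rho1))); first by rewrite ler_wpM2l ?lerD2l.
    apply: le_trans (ee n) _; rewrite ler_wpM2r ?(ltW c_gt0) //.
    apply: ler_pM => //; first exact: ltW.
      by rewrite divr_ge0 ?(ltW c00) // ?addr_ge0 // ltW.
    apply: le_trans (b_low r_ge0 IH).
    rewrite ler_pM2l // lef_pV2 ?posrE ?ltr_wpDl ?addr_ge0 ?(ltW r10) //.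
    by rewrite !lerD2r.
have [|N HN] := prod_contract_vanishes lg01 _ (divr_gt0 r0 r10).
  move=> B; have [n Hn] := dg (B / la); exists n.
  by rewrite -mulr_sumr mulrC -ler_pdivrMr.
exists N => n Nn; apply: le_trans (Dr n) _; rewrite ler_wpM2r // /r.
rewrite ge_max lexx /= -ler_pdivlMr //.
by rewrite (le_trans (ler_norm _)) // HN.
Qed.

End Ratio.
End RealSequences.

(** * Perturbed projective dynamics *)

Section LinearContraction.
Variables (R : realType) (T : finType) (A : T -> T -> R) (S : {set T}).
Variables (h pi w : T -> R) (al k : R).
Hypothesis al0 : 0 < al.
Hypothesis k01 : 0 <= k < 1.
Hypothesis h0 : forall x, 0 <= h x.
Hypothesis w0 : forall x, x \in S -> 0 < w x.
Hypothesis Ah : forall x, x \in S -> \sum_(y in S) A x y * h y = al * h x.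
Hypothesis piA : forall y, y \in S -> \sum_(x in S) pi x * A x y = al * pi y.
Hypothesis pih : \sum_(x in S) pi x * h x = 1.
Hypothesis contr : forall nu : T -> R, \sum_(x in S) nu x * h x = 0 ->
  \sum_(y in S) `|\sum_(x in S) nu x * A x y| * w y <=
  k * al * \sum_(x in S) `|nu x| * w x.

(* coefS is the coordinate along pi of the splitting R pi + {nu h = 0}; distS
   is the size of the complementary part. *)
Definition coefS (Z : T -> R) : R := \sum_(x in S) Z x * h x.
Definition distS (Z : T -> R) : R := \sum_(x in S) `|Z x - coefS Z * pi x| * w x.
Definition normS (Z : T -> R) : R := \sum_(x in S) `|Z x|.

(** For occupation measures [s] is the normalisation 1 / mu(A), and [e] gathers the
    perturbations. *)
Definition linear_step (g s : R) (e Z Z1 : T -> R) := forall y, y \in S ->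
  Z1 y = (1 - g) * Z y + g * (s * (\sum_(x in S) Z x * A x y) + e y).

(** As [h] is a right eigenvector on [S], its coordinate obeys a scalar recursion that is not
    coupled to the complementary part. *)
Lemma coefS_step g s e Z Z1 : linear_step g s e Z Z1 ->
  coefS Z1 = (1 - g + g * s * al) * coefS Z + g * coefS e.
Proof.
move=> st; rewrite /coefS.
transitivity (\sum_(y in S) ((1 - g) * Z y * h y +
    (g * (s * (\sum_(x in S) Z x * A x y) * h y) + g * (e y * h y)))).
  by apply: eq_bigr => y yS; rewrite st //; ring.
rewrite !big_split /=.
have -> : \sum_(y in S) (1 - g) * Z y * h y = (1 - g) * \sum_(y in S) Z y * h y.
  by rewrite mulr_sumr; apply: eq_bigr => y _; rewrite mulrA.
have -> : \sum_(i in S) g * (s * (\sum_(x in S) Z x * A x i) * h i) =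
          g * s * al * \sum_(y in S) Z y * h y.
  under eq_bigr => y yS.
    rewrite mulr_sumr mulr_suml mulr_sumr; over.
  rewrite exchange_big /= mulr_sumr; apply: eq_bigr => x xS.
  rewrite -[RHS]mulrA [al * _]mulrCA -Ah // !mulr_sumr; apply: eq_bigr => y _; ring.
by rewrite -[X in _ + (_ + X)]mulr_sumr; ring.
Qed.

Lemma distS_step g s e Z Z1 : 0 <= g <= 1 -> 0 <= s -> linear_step g s e Z Z1 ->
  distS Z1 <= (1 - g + g * s * (k * al)) * distS Z + g * distS e.
Proof.
move=> /andP[g0 g1] s0 st.
pose nu x := Z x - coefS Z * pi x.
have nuh : \sum_(x in S) nu x * h x = 0.
  under eq_bigr => x _ do rewrite mulrBl -mulrA.
  by rewrite sumrB -mulr_sumr pih mulr1 subrr.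
have E y : y \in S -> Z1 y - coefS Z1 * pi y =
    (1 - g) * nu y + g * s * (\sum_(x in S) nu x * A x y) + g * (e y - coefS e * pi y).
  move=> yS; rewrite st // (coefS_step st).
  have -> : \sum_(x in S) nu x * A x y =
      (\sum_(x in S) Z x * A x y) - coefS Z * (al * pi y).
    rewrite -piA // mulr_sumr -sumrB; apply: eq_bigr => x _.
    by rewrite mulrBl mulrA.
  rewrite /nu; ring.
rewrite /distS.
apply: (@le_trans _ _ (\sum_(x in S) ((1 - g) * (`|nu x| * w x) +
   g * s * (`|\sum_(z in S) nu z * A z x| * w x) +
   g * (`|e x - coefS e * pi x| * w x)))).
  apply: ler_sum => y yS; rewrite E // !mulrA -!mulrDl ler_wpM2r ?(ltW (w0 yS)) //.
  rewrite (le_trans (ler_normD _ _)) //.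
  rewrite [X in _ + X]normrM (ger0_norm g0) lerD2r.
  rewrite (le_trans (ler_normD _ _)) // !normrM (ger0_norm g0) (ger0_norm s0).
  by rewrite ger0_norm // subr_ge0.
rewrite !big_split /= -!mulr_sumr lerD2r [leRHS]mulrDl lerD2l -!mulrA.
by rewrite ler_wpM2l // ler_wpM2l // mulrA contr.
Qed.

Lemma coefS_distS_bound : exists2 C, 0 < C & forall Z : T -> R,
  `|coefS Z| <= C * normS Z /\ distS Z <= C * normS Z.
Proof.
pose H := \sum_(x in S) h x; pose W := \sum_(x in S) w x.
pose P := \sum_(x in S) `|pi x| * w x.
have H0 : 0 <= H by rewrite sumr_ge0.
have W0 : 0 <= W by rewrite sumr_ge0 // => x xS; rewrite ltW // w0.
have P0 : 0 <= P by rewrite sumr_ge0 // => x xS; rewrite mulr_ge0 // ltW // w0.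
have N0 Z : 0 <= normS Z by rewrite sumr_ge0.
have hH x : x \in S -> h x <= H.
  by move=> xS; rewrite /H (bigD1 x) //= lerDl sumr_ge0.
have wW x : x \in S -> w x <= W.
  move=> xS; rewrite /W (bigD1 x) //= lerDl sumr_ge0 // => y /andP[yS _].
  by rewrite ltW // w0.
have cH Z : `|coefS Z| <= H * normS Z.
  rewrite (le_trans (ler_norm_sum _ _ _)) // mulr_sumr ler_sum // => x xS.
  by rewrite normrM mulrC (ger0_norm (h0 x)) ler_wpM2r // hH.
exists (H + W + H * P + 1); first by rewrite ltr_wpDl // !addr_ge0 // mulr_ge0.
move=> Z; split.
  rewrite (le_trans (cH Z)) // ler_wpM2r //.
  have : 0 <= H * P by rewrite mulr_ge0.
  lra.
apply: (@le_trans _ _ (W * normS Z + `|coefS Z| * P)).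
  rewrite /distS /normS /P !mulr_sumr -big_split /= ler_sum // => x xS.
  rewrite mulrA [W * _]mulrC.
  apply: (@le_trans _ _ ((`|Z x| + `|coefS Z| * `|pi x|) * w x)).
    rewrite ler_wpM2r ?(ltW (w0 xS)) // (le_trans (ler_normB _ _)) //.
    by rewrite normrM.
  by rewrite mulrDl lerD2r ler_wpM2l // wW.
apply: (@le_trans _ _ (W * normS Z + H * normS Z * P)).
  by rewrite lerD2l ler_wpM2r.
have := N0 Z; have : 0 <= H * P by rewrite mulr_ge0.
move=> HP N; rewrite -[H * _ * P]mulrAC -mulrDl ler_wpM2r //; lra.
Qed.

(** Supplies the hypothesis of the ratio lemmas that distance and coordinate are not both small: Z
    is the sum of coefS Z times pi and of the complementary part, and its mass is at least 1/2. *)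
Lemma mass_le_distS : exists2 c, 0 < c & exists2 C, 0 <= C & forall Z : T -> R,
  0 <= coefS Z -> 1 / 2 <= \sum_(x in S) Z x -> c <= distS Z + C * coefS Z.
Proof.
have [wm wm0 wmin] : exists2 c, 0 < c & forall x, x \in S -> c <= w x.
  have [->|] := eqVneq S finset.set0.
    by exists 1 => // x; rewrite inE.
  move=> /finset.set0Pn[x1 x1S]; pose x := [arg min_(x < x1 in S) w x]%O.
  exists (w x); rewrite /x; case: arg_minP => //; first by move=> i iS _; exact: w0.
exists (wm / 2); first by rewrite divr_gt0.
exists (wm * \sum_(x in S) `|pi x|); first by rewrite mulr_ge0 ?(ltW wm0) // sumr_ge0.
move=> Z b0 mZ.
apply: (@le_trans _ _ (\sum_(x in S) wm * Z x)).
  by rewrite -mulr_sumr ler_wpM2l ?(ltW wm0) // -[_^-1]mul1r.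
rewrite [wm * _]mulr_sumr mulr_suml /distS -big_split /= ler_sum // => x xS.
apply: (@le_trans _ _ (wm * `|Z x - coefS Z * pi x| + wm * `|pi x| * coefS Z)).
  rewrite -mulrA -mulrDr ler_wpM2l ?(ltW wm0) //.
  have := ler_norm (Z x - coefS Z * pi x).
  have : coefS Z * pi x <= `|pi x| * coefS Z by rewrite mulrC ler_wpM2r // ler_norm.
  lra.
by rewrite lerD2r mulrC ler_wpM2l // wmin.
Qed.

Section Trajectory.
Variable slo : R.
Hypothesis slo0 : 0 < slo.

(** The mass on [S] is only asked to lie in [1/2, 1]: on the absorbing class, the part outside
    disappears only in the limit. *)
Definition trajectory (g s : nat -> R) (e Z : nat -> T -> R) :=
  [/\ forall n, 0 <= g n <= 1, forall n, slo <= s n <= 1,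
      forall n x, 0 <= Z n x, forall n, 1 / 2 <= \sum_(x in S) Z n x <= 1
    & forall n, linear_step (g n) (s n) (e n) (Z n) (Z n.+1)].

Lemma trajectory_shift g s e Z m : trajectory g s e Z ->
  trajectory (fun n => g (m + n)%N) (fun n => s (m + n)%N)
    (fun n => e (m + n)%N) (fun n => Z (m + n)%N).
Proof.
by case=> H1 H2 H3 H4 H5; split=> // n; rewrite addnS; exact: H5.
Qed.

Lemma coefS_ge0 (Z : T -> R) : (forall x, 0 <= Z x) -> 0 <= coefS Z.
Proof. by move=> Z0; rewrite sumr_ge0 // => x _; rewrite mulr_ge0. Qed.

Lemma normS_ge0 (Z : T -> R) : 0 <= normS Z. Proof. exact: sumr_ge0. Qed.

Lemma distS_ge0 (Z : T -> R) : 0 <= distS Z.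
Proof. by rewrite sumr_ge0 // => x xS; rewrite mulr_ge0 // ltW // w0. Qed.

Lemma trajectory_normS g s e Z n : trajectory g s e Z -> normS (Z n) <= 1.
Proof.
case=> _ _ Z0 /(_ n)/andP[_ m1] _; rewrite /normS.
by under eq_bigr => x _ do rewrite ger0_norm //.
Qed.

(** The constants depend on [beta] but not on the trajectory, so that the starting time can be
    chosen after them. *)
Lemma trajectory_persist beta : 0 < beta ->
  exists2 eps, 0 < eps & exists2 c, 0 < c & forall g s e Z,
    trajectory g s e Z -> beta <= coefS (Z 0%N) ->
    (forall n, normS (e n) <= eps) -> forall n, c <= coefS (Z n).
Proof.
move=> beta0; have [C C0 CH] := coefS_distS_bound.
have [c0 c00 [C1 C10 CM]] := mass_le_distS.
have /andP[k0 k1] := k01.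
pose rho := C / beta; have rho0 : 0 < rho by rewrite divr_gt0.
have den0 : 0 < rho + C1 + 1 by rewrite ltr_wpDl // addr_ge0 // ltW.
pose B := rho * (c0 / (rho + C1 + 1)) * (slo * al * (1 - k) / 2).
have B0 : 0 < B by rewrite /B !(divr_gt0, mulr_gt0) // subr_gt0.
have r1 : 0 < 1 + rho by rewrite ltr_wpDl.
exists (B / (1 + rho) / C); first by rewrite !divr_gt0.
exists (c0 / (rho + C1 + 1)); first by rewrite divr_gt0.
move=> g s e Z tr bZ0 es n; have [g01 s01 Z0 mZ st] := tr.
have D0 : distS (Z 0%N) <= rho * coefS (Z 0%N).
  apply: (@le_trans _ _ C).
    apply: le_trans (CH (Z 0%N)).2 _.
    by rewrite ler_piMr ?(ltW C0) // (trajectory_normS _ tr).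
  by rewrite /rho mulrAC ler_pdivlMr // ler_wpM2l // ltW.
apply: (@ratio_lower _ (fun n => distS (Z n)) (fun n => coefS (Z n)) c0 C1) => //.
- by move=> i; apply: coefS_ge0.
- by move=> i; apply: CM; [exact: coefS_ge0|case/andP: (mZ i)].
apply: (@ratio_persist _ g s (fun n => distS (Z n)) (fun n => coefS (Z n))
  (fun n => C * normS (e n)) al k slo c0 C1) => //.
- by move=> i; apply: coefS_ge0.
- by move=> i; rewrite mulr_ge0 ?normS_ge0 // ltW.
- by move=> i; apply: CM; [exact: coefS_ge0|case/andP: (mZ i)].
- move=> i; have /andP[g0 g1] := g01 i; have /andP[s0 s1] := s01 i.
  apply: le_trans (distS_step (g01 i) _ (st i)) _.
    by rewrite (le_trans (ltW slo0)).
  by rewrite lerD2l ler_wpM2l //; case: (CH (e i)).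
- move=> i; have /andP[g0 g1] := g01 i; rewrite (coefS_step (st i)) lerD2l.
  have [+ _] := CH (e i); rewrite ler_norml => /andP[+ _] => H.
  by rewrite -mulrN ler_wpM2l.
move=> i; rewrite -ler_pdivlMr // mulrC -ler_pdivlMr //.
Qed.

(** A lower bound on the coordinate at infinitely many times suffices: the recursion is restarted at
    such a time, late enough for the errors to be small. *)
Lemma trajectory_vanishes g s e Z beta : trajectory g s e Z -> diverges g ->
  vanishes (fun n => normS (e n)) -> 0 < beta ->
  (forall N, exists2 n, (N <= n)%N & beta <= coefS (Z n)) ->
  vanishes (fun n => distS (Z n)).
Proof.
move=> tr dg ve beta0 io eps eps0.
have [C C0 CH] := coefS_distS_bound.
have [c0 c00 [C1 C10 CM]] := mass_le_distS.
have /andP[k0 k1] := k01.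
pose rho1 := C / beta; have rho10 : 0 < rho1 by rewrite divr_gt0.
(* The coordinate is at most [C], so a ratio eps / C makes the distance at most eps. *)
pose rho := Num.min rho1 (eps / C).
have rho0 : 0 < rho by rewrite lt_min rho10 divr_gt0.
have den0 : 0 < rho1 + C1 + 1 by rewrite ltr_wpDl // addr_ge0 // ltW.
pose B := rho * (c0 / (rho1 + C1 + 1)) * (slo * al * (1 - k) / 2).
have B0 : 0 < B by rewrite /B !(divr_gt0, mulr_gt0) // subr_gt0.
have r1 : 0 < 1 + rho1 by rewrite ltr_wpDl.
have [N HN] : exists N, forall n, (N <= n)%N -> normS (e n) <= B / (1 + rho1) / C.
  have [|N HN] := ve (B / (1 + rho1) / C); first by rewrite !divr_gt0.
  by exists N => n /HN; rewrite ger0_norm // normS_ge0.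
have [m Nm bm] := io N.
have [g01 s01 Z0 mZ st] := trajectory_shift m tr.
have [||||||||M HM] := @ratio_vanishes _ (fun n => g (m + n)%N) (fun n => s (m + n)%N)
  (fun n => distS (Z (m + n)%N)) (fun n => coefS (Z (m + n)%N))
  (fun n => C * normS (e (m + n)%N)) al k slo c0 C1 g01 slo0 s01 al0 k01
  _ _ c00 C10 _ _ _ rho1 rho (diverges_shift m dg).
- by move=> i; apply: coefS_ge0.
- by move=> i; rewrite mulr_ge0 ?normS_ge0 // ltW.
- by move=> i; apply: CM; [exact: coefS_ge0|case/andP: (mZ i)].
- move=> i; have /andP[g0 g1] := g01 i; have /andP[s0 s1] := s01 i.
  apply: le_trans (distS_step (g01 i) _ (st i)) _.
    by rewrite (le_trans (ltW slo0)).
  by rewrite lerD2l ler_wpM2l //; case: (CH (e (m + i)%N)).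
- move=> i; have /andP[g0 g1] := g01 i; rewrite (coefS_step (st i)) lerD2l.
  have [+ _] := CH (e (m + i)%N); rewrite ler_norml => /andP[+ _] => H.
  by rewrite -mulrN ler_wpM2l.
- by rewrite rho0 ge_min lexx.
- rewrite addn0; apply: (@le_trans _ _ C).
    apply: le_trans (CH (Z m)).2 _.
    by rewrite ler_piMr ?(ltW C0) // (trajectory_normS _ tr).
  by rewrite /rho1 mulrAC ler_pdivlMr // ler_wpM2l // ltW.
- move=> i; rewrite -ler_pdivlMr // mulrC -ler_pdivlMr //.
  by apply: HN; rewrite (leq_trans Nm) // leq_addr.
exists (m + M)%N => n mMn; rewrite ger0_norm ?distS_ge0 //.
have mn : (m <= n)%N by rewrite (leq_trans _ mMn) // leq_addr.
have := HM (n - m)%N; rewrite leq_subRL // subnKC // => /(_ mMn) Dn.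
apply: le_trans Dn _.
have bC : coefS (Z n) <= C.
  apply: le_trans (ler_norm _) _; apply: le_trans (CH (Z n)).1 _.
  by rewrite ler_piMr ?(ltW C0) // (trajectory_normS _ tr).
apply: le_trans (ler_wpM2l (ltW rho0) bC) _.
by rewrite -ler_pdivlMr // ge_min lexx orbT.
Qed.

End Trajectory.
End LinearContraction.

(** * Occupation measures and the Poisson equation *)

Section Occupation.
Variables (R : realType) (T : finType).
Variables (K A : T -> T -> R).
Hypothesis K_sub : sub_markovian K.
Hypothesis A_green : is_green K A.
Variable gam : nat -> R.
Hypothesis gam_0 : gam 0%N = 1.
Hypothesis gam01 : forall n, 0 <= gam n <= 1.

Definition Amass x := total_mass (A x).

Definition Pi (mu : T -> R) (y : T) : R := mu_mul mu A y / dotp mu Amass.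

Definition poisson mu x z := A x z - Amass x * Pi mu z.

(** The mean of [poisson mu] after one step of the resurrected kernel, in the closed form given by
    Poisson's equation. *)
Definition poisson_next mu x z := poisson mu x z - (x == z)%:R + Pi mu z.

(* Histories are lists with the latest state first, so that the history at time
   n has size n + 1 and the step leading to y :: s has index size s. Because
   gam 0 = 1, the value of occ on the empty history is irrelevant. *)
Fixpoint occ (s : seq T) (z : T) : R :=
  if s is y :: s' then
    (1 - gam (size s')) * occ s' z + gam (size s') * (y == z)%:R
  else 0.

Definition noise (s : seq T) (y z : T) : R :=
  if s is x :: _ then poisson (occ s) y z - poisson_next (occ s) x z else 0.

(* The average restarted from 0 at time m. *)
Fixpoint avg_noise m (s : seq T) (z : T) : R :=
  if s is y :: s' then
    if (size s' <= m)%N then 0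
    else (1 - gam (size s')) * avg_noise m s' z + gam (size s') * noise s' y z
  else 0.

Fixpoint hist (X : nat -> T) n : seq T :=
  if n is m.+1 then X n :: hist X m else [:: X 0%N].

Lemma size_hist X n : size (hist X n) = n.+1.
Proof. by elim: n => //= n ->. Qed.

Let A0 x y : 0 <= A x y. Proof. by case: A_green. Qed.
Let Amass1 x : 1 <= Amass x. Proof. by case: A_green => _ _ _; apply. Qed.

Lemma occ_prob s : s != [::] -> is_prob (occ s).
Proof.
have H : (forall x, 0 <= occ s x) /\ (s != [::] -> total_mass (occ s) = 1).
  elim: s => [|y s [IH0 IH1]]; first by split.
  have /andP[g0 g1] := gam01 (size s).
  split=> [x|_] /=.
    by rewrite addr_ge0 ?mulr_ge0 ?subr_ge0 ?ler0n.
  rewrite /total_mass big_split /= -!mulr_sumr sum_delta mulr1.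
  have [->|/IH1] := eqVneq s [::]; first by rewrite /= gam_0 subrr mul0r add0r.
  by rewrite -/(total_mass (occ s)) => ->; rewrite mulr1 subrK.
by case: H => H0 H1 s0; split=> //; exact: H1.
Qed.

Lemma hist_prob X n : is_prob (occ (hist X n)).
Proof. by apply: occ_prob; case: n. Qed.

Lemma dotp_Amass_ge1 mu : is_prob mu -> 1 <= dotp mu Amass.
Proof.
case=> m0 m1; rewrite -m1 /dotp ler_sum // => x _.
by rewrite ler_peMr.
Qed.

Lemma Amass_bound : exists2 C, 1 <= C & forall x, Amass x <= C.
Proof.
exists (1 + \sum_x Amass x).
  by rewrite lerDl sumr_ge0 // => x _; rewrite (le_trans ler01).
move=> x; rewrite (bigD1 x) //= addrCA lerDl addr_ge0 // sumr_ge0 // => y _.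
by rewrite (le_trans ler01).
Qed.

Lemma total_mul_A mu : \sum_y mu_mul mu A y = dotp mu Amass.
Proof.
rewrite /dotp /mu_mul exchange_big /=; apply: eq_bigr => x _.
by rewrite -mulr_sumr.
Qed.

Lemma Pi_prob mu : is_prob mu -> is_prob (Pi mu).
Proof.
move=> pm; have a1 := dotp_Amass_ge1 pm; have a0 := lt_le_trans ltr01 a1.
split=> [x|]; first by rewrite divr_ge0 ?(ltW a0) // sumr_ge0 // => y _; rewrite mulr_ge0 // pm.1.
by rewrite /total_mass -mulr_suml total_mul_A divff // gt_eqF.
Qed.

Lemma prob_le1 (mu : T -> R) x : is_prob mu -> mu x <= 1.
Proof.
case=> m0 m1; rewrite -m1 /total_mass (bigD1 x) //= lerDl sumr_ge0 //.
Qed.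

Lemma killing_ge0 x : 0 <= killing K x.
Proof. by rewrite subr_ge0; case: K_sub => _ /(_ x)/andP[]. Qed.

(* Poisson's equation: the killing plays no role because mu(poisson mu) = 0. *)
Lemma poisson_eq mu x z : is_prob mu ->
  \sum_y resurrected K mu x [set y]%SET * poisson mu y z = poisson_next mu x z.
Proof.
move=> pm; have a0 := lt_le_trans ltr01 (dotp_Amass_ge1 pm).
have E y : resurrected K mu x [set y]%SET = K x y + killing K x * mu y.
  by rewrite /resurrected /mass !big_set1.
under eq_bigr => y _ do rewrite E mulrDl -mulrA.
rewrite big_split /= -mulr_sumr.
have -> : \sum_y mu y * poisson mu y z = 0.
  under eq_bigr => y _ do rewrite mulrBr mulrA.
  rewrite sumrB -mulr_suml -/(dotp mu Amass) -/(mu_mul mu A z) /Pi.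
  by rewrite mulrC divfK ?gt_eqF // subrr.
rewrite mulr0 addr0 /poisson_next /poisson.
under eq_bigr => y _ do rewrite mulrBr mulrA.
have [G1 _ _ _] := A_green.
rewrite sumrB -mulr_suml G1.
have -> : \sum_y K x y * Amass y = Amass x - 1.
  rewrite /Amass /total_mass; under eq_bigr => y _ do rewrite mulr_sumr.
  rewrite exchange_big /=; under eq_bigr => y _ do rewrite G1.
  by rewrite sumrB sum_delta.
by ring.
Qed.

Lemma resurrected_sum mu x : is_prob mu ->
  \sum_y resurrected K mu x [set y]%SET = 1.
Proof.
move=> [_ m1]; under eq_bigr => y _ do rewrite /resurrected /mass !big_set1.
by rewrite big_split /= -mulr_sumr -/(total_mass mu) m1 mulr1 /killing addrC subrK.
Qed.

Lemma noise_mean s x z : s != [::] ->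
  \sum_y resurrected K (occ s) (head x s) [set y]%SET * noise s y z = 0.
Proof.
case: s => // a s _; have pm := @occ_prob (a :: s) isT; rewrite /noise /head.
under eq_bigr => y _ do rewrite mulrBr.
by rewrite sumrB poisson_eq // -mulr_suml resurrected_sum // mul1r subrr.
Qed.

Variable C : R.
Hypothesis C1 : 1 <= C.
Hypothesis AC : forall x, Amass x <= C.

Let A_le x z : A x z <= Amass x.
Proof. by rewrite /Amass /total_mass (bigD1 z) //= lerDl sumr_ge0. Qed.

Lemma poisson_bound mu x z : is_prob mu -> `|poisson mu x z| <= C.
Proof.
move=> pm; have [P0 _] := Pi_prob pm; have P1 := prob_le1 z (Pi_prob pm).
have := A0 x z; have := A_le x z; have := AC x; have := P0 z.
have Am0 : 0 <= Amass x by rewrite (le_trans ler01).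
have : Amass x * Pi mu z <= Amass x by rewrite ler_piMr.
have : 0 <= Amass x * Pi mu z by rewrite mulr_ge0.
move=> ? ? ? ? ? ?; rewrite ler_norml /poisson; apply/andP; split; lra.
Qed.

Lemma poisson_next_bound mu x z : is_prob mu -> `|poisson_next mu x z| <= C + 1.
Proof.
move=> pm; rewrite /poisson_next -addrA (le_trans (ler_normD _ _)) //.
rewrite lerD ?poisson_bound //.
have [P0 _] := Pi_prob pm; have P1 := prob_le1 z (Pi_prob pm).
have := P0 z; case: (x == z) => /=; rewrite ler_norml => ?; apply/andP; split; lra.
Qed.

Lemma noise_bound s y z : `|noise s y z| <= 2 * C + 1.
Proof.
case: s => [|x s]; first by rewrite normr0; have := C1; lra.
have pm := @occ_prob (x :: s) isT; rewrite /noise.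
rewrite (le_trans (ler_normB _ _)) // mulr2n mulrDl mul1r -addrA.
by rewrite lerD ?poisson_bound ?poisson_next_bound.
Qed.

(** [Pi] is a quotient of two linear functionals of the measure; adding the state y changes it by
    exactly gam times [poisson (occ s) y z] over the new denominator, which is at least 1. *)
Lemma Pi_lipschitz s y z : s != [::] ->
  `|Pi (occ (y :: s)) z - Pi (occ s) z| <= C * gam (size s).
Proof.
move=> s0; have pm := occ_prob s0; have pm' := @occ_prob (y :: s) isT.
set g := gam (size s); have /andP[g0 g1] : 0 <= g <= 1 by exact: gam01.
have a0 := lt_le_trans ltr01 (dotp_Amass_ge1 pm).
have a1' := dotp_Amass_ge1 pm'; have a0' := lt_le_trans ltr01 a1'.
have Em f : dotp (occ (y :: s)) f = (1 - g) * dotp (occ s) f + g * f y.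
  rewrite -[f y](sum_delta_l f); rewrite /dotp !mulr_sumr -big_split /=.
  by apply: eq_bigr => x _; rewrite mulrDl !mulrA.
have -> : Pi (occ (y :: s)) z - Pi (occ s) z =
    g * poisson (occ s) y z / dotp (occ (y :: s)) Amass.
  apply: (mulIf (lt0r_neq0 a0')); rewrite divfK ?gt_eqF //.
  rewrite mulrBl {1}/Pi divfK ?gt_eqF //.
  rewrite -[mu_mul _ A z]/(dotp (occ (y :: s)) (A^~ z)) !Em /poisson.
  have -> : dotp (occ s) (A^~ z) = Pi (occ s) z * dotp (occ s) Amass.
    by rewrite /Pi divfK // gt_eqF.
  ring.
rewrite normrM normfV (gtr0_norm a0') ler_pdivrMr //.
rewrite normrM (ger0_norm g0) mulrC.
apply: (@le_trans _ _ (C * g)); first by rewrite ler_wpM2r ?poisson_bound.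
by rewrite ler_peMr // mulr_ge0 // (le_trans ler01).
Qed.

Section Path.
Variables (X : nat -> T) (m : nat).
Hypothesis gam_ni : forall i j, (i <= j)%N -> gam j <= gam i.

Let mu n := occ (hist X n).

(* The occupation measures with the state at each step replaced by Pi of the
   current occupation measure. *)
Fixpoint smooth k : T -> R :=
  if k is j.+1 then fun z =>
    (1 - gam (m + k)) * smooth j z + gam (m + k) * Pi (mu (m + j)) z
  else mu m.

Lemma smooth_prob k : is_prob (smooth k).
Proof.
elim: k => [|k [IH0 IH1]]; first exact: hist_prob.
have /andP[g0 g1] := gam01 (m + k.+1).
have [P0 P1] := Pi_prob (hist_prob X (m + k)).
split=> [z|] /=; first by rewrite addr_ge0 ?(mulr_ge0 g0 (P0 z)) // mulr_ge0 ?subr_ge0.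
rewrite /total_mass big_split /= -!mulr_sumr -/(total_mass _) IH1.
by rewrite -/(total_mass (Pi _)) P1 !mulr1 subrK.
Qed.

Let G n z := poisson_next (mu n) (X n) z.

(* What remains of mu - smooth once the martingale part is removed and the
   telescoping part of the noise is summed by parts. *)
Let W k z := mu (m + k) z - smooth k z - avg_noise m (hist X (m + k)) z
             + gam (m + k) * G (m + k) z.

Let head_hist n : hist X n = X n :: behead (hist X n).
Proof. by case: n. Qed.

(** The increments telescope up to the variation of the step sizes multiplying [G] and the change of
    the measure inside [poisson_next]. *)
Let W_step k z : W k.+1 z = (1 - gam (m + k.+1)) * W k z
  + (gam (m + k.+1) - gam (m + k) + gam (m + k.+1) * gam (m + k)) * G (m + k) z
  + gam (m + k.+1) * (G (m + k.+1) z - poisson_next (mu (m + k)) (X (m + k.+1)) z).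
Proof.
rewrite /W /mu addnS /= size_hist ltnNge leq_addr /=.
have -> : noise (hist X (m + k)) (X (m + k).+1) z =
    poisson (mu (m + k)) (X (m + k).+1) z - G (m + k) z.
  by rewrite /noise head_hist -head_hist.
rewrite -/(mu (m + k)) !addnS.
have -> : ((X (m + k).+1 == z)%:R : R) =
    poisson (mu (m + k)) (X (m + k).+1) z
    - poisson_next (mu (m + k)) (X (m + k).+1) z + Pi (mu (m + k)) z.
  by rewrite /poisson_next; ring.
by ring.
Qed.

Let G_bound n z : `|G n z| <= C + 1.
Proof. exact/poisson_next_bound/hist_prob. Qed.

Let jump_bound k z :
  `|G (m + k.+1) z - poisson_next (mu (m + k)) (X (m + k.+1)) z| <=
  C * C * gam (m + k.+1).
Proof.
have -> : G (m + k.+1) z - poisson_next (mu (m + k)) (X (m + k.+1)) z =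
    (1 - Amass (X (m + k.+1))) * (Pi (mu (m + k.+1)) z - Pi (mu (m + k)) z).
  by rewrite /G /poisson_next /poisson; ring.
rewrite normrM -mulrA ler_pM //.
  by rewrite ler0_norm ?subr_le0 // opprB; have := AC (X (m + k.+1)); lra.
have -> : gam (m + k.+1) = gam (size (hist X (m + k))) by rewrite size_hist addnS.
rewrite addnS; apply: (@Pi_lipschitz (hist X (m + k)) (X (m + k).+1) z).
by case: (m + k)%N.
Qed.

Let C' := 2 * (C + 1) + C * C.

(** The variation of the step sizes need not be small compared with the next step size. Adding (C +
    1) gam turns it into a telescoping quantity, by monotonicity, so that [U] satisfies an averaging
    inequality with error C' gam. In [C'], one C + 1 compensates the damping of this added term, the
    other bounds the product of two step sizes times [G], and C * C is the Lipschitz error. *)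
Let U k z := `|W k z| + (C + 1) * gam (m + k).

Let U_step k z :
  U k.+1 z <= (1 - gam (m + k.+1)) * U k z + gam (m + k.+1) * (C' * gam (m + k)).
Proof.
have /andP[g0 g1] := gam01 (m + k.+1); have /andP[g0' g1'] := gam01 (m + k).
have gg : gam (m + k.+1) <= gam (m + k) by rewrite gam_ni // addnS.
rewrite /U W_step; set g := gam (m + k.+1) in g0 g1 gg *.
set g' := gam (m + k) in g0' g1' gg *.
have H1 : `|(g - g' + g * g') * G (m + k) z| <= (g' - g + g * g') * (C + 1).
  rewrite normrM ler_pM //.
  rewrite (le_trans (ler_normD _ _)) // lerD //.
    by rewrite ler0_norm ?subr_le0 // opprB.
  by rewrite ger0_norm // mulr_ge0.
have H2 := jump_bound k z.
apply: (@le_trans _ _ ((1 - g) * `|W k z| + (g' - g + g * g') * (C + 1) +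
   g * (C * C * g) + (C + 1) * g)).
  rewrite lerD2r (le_trans (ler_normD _ _)) // lerD //.
    rewrite (le_trans (ler_normD _ _)) // lerD //.
    by rewrite normrM ger0_norm // subr_ge0.
  by rewrite normrM (ger0_norm g0) ler_wpM2l.
have H3 : g * (C * C * g) <= g * (C * C * g').
  by rewrite ler_wpM2l // ler_wpM2l // mulr_ge0 // (le_trans ler01).
have -> : (1 - g) * (`|W k z| + (C + 1) * g') + g * (C' * g') =
   (1 - g) * `|W k z| + (g' - g + g * g') * (C + 1) + g * (C * C * g') + (C + 1) * g.
  by rewrite /C'; ring.
by rewrite lerD2r lerD2l.
Qed.

Let C'0 : 0 <= C'.
Proof. by have := C1; rewrite /C' => ?; rewrite addr_ge0 ?mulr_ge0 //; lra. Qed.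

Let U_0 z : U 0 z <= C' * gam m.
Proof.
have /andP[g0 g1] := gam01 m.
rewrite /U /W addn0 /= subrr add0r.
have -> : avg_noise m (hist X m) z = 0.
  by case: m => //= n; rewrite size_hist leqnn.
rewrite oppr0 add0r normrM (ger0_norm g0) mulrC -mulrDl ler_wpM2r //.
have := G_bound m z; have : 0 <= C * C by rewrite mulr_ge0 // (le_trans ler01).
rewrite /C'; lra.
Qed.

Let dist_U k z : `|mu (m + k) z - smooth k z| <=
  `|avg_noise m (hist X (m + k)) z| + U k z.
Proof.
have -> : mu (m + k) z - smooth k z = avg_noise m (hist X (m + k)) z +
    (W k z - gam (m + k) * G (m + k) z) by rewrite /W; ring.
rewrite (le_trans (ler_normD _ _)) // lerD2l (le_trans (ler_normB _ _)) //.
have /andP[g0 g1] := gam01 (m + k).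
by rewrite lerD2l normrM (ger0_norm g0) mulrC ler_wpM2r.
Qed.

Lemma smooth_close k z : `|mu (m + k) z - smooth k z| <=
  `|avg_noise m (hist X (m + k)) z| + (2 * (C + 1) + C * C) * gam m.
Proof.
apply: le_trans (dist_U k z) _; rewrite lerD2l -/C'.
apply: (@averaging_bound _ (U^~ z) (fun k => gam (m + k.+1))
  (fun k => C' * gam (m + k)) (C' * gam m)) => //.
by move=> n; rewrite ler_wpM2l // gam_ni // leq_addr.
Qed.

Lemma smooth_close_vanishes z : diverges gam -> vanishes gam ->
  vanishes (fun k => avg_noise m (hist X (m + k)) z) ->
  vanishes (fun k => mu (m + k) z - smooth k z).
Proof.
move=> dg vg vR.
apply: (@vanishes_le _ _ (fun k => `|avg_noise m (hist X (m + k)) z| + U k z)).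
  apply: vanishesD.
    by move=> eps /vR[N HN]; exists N => n /HN; rewrite normr_id.
  apply: (@averaging_vanishes _ (U^~ z) (fun k => gam (m + k.+1))
    (fun k => C' * gam (m + k))) => //.
  - have /= := diverges_shift m.+1 dg.
    by under eq_fun do rewrite addSnnS.
  - move=> k; rewrite /U addr_ge0 // mulr_ge0 //; last by case/andP: (gam01 (m + k)).
    by have := C1; lra.
  - apply: vanishesM; exact: vanishes_shift.
exact: (dist_U ^~ z).
Qed.

Lemma avg_noise_restart k z : avg_noise 0 (hist X (m + k)) z =
  avg_noise m (hist X (m + k)) z +
  (\prod_(j < k) (1 - gam (m + j.+1))) * avg_noise 0 (hist X m) z.
Proof.
elim: k => [|k IH].
  rewrite big_ord0 mul1r addn0 [X in X + _](_ : _ = 0) ?add0r //.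
  by case: m => //= n; rewrite size_hist leqnn.
rewrite addnS /= size_hist /= ltnNge leq_addr /= IH big_ord_recr /= addnS.
by ring.
Qed.

End Path.

(** What was accumulated before the restart at m is multiplied by a product tending to 0, so it is
    enough to control restarted averages. *)
Lemma avg_noise_vanishes X z : diverges gam ->
  (forall eps, 0 < eps -> exists m, forall k,
     `|avg_noise m (hist X (m + k)) z| <= eps) ->
  vanishes (fun n => avg_noise 0 (hist X n) z).
Proof.
move=> dg H eps eps0; have e2 : 0 < eps / 2 by rewrite divr_gt0.
have [m Hm] := H _ e2; set c := avg_noise 0 (hist X m) z.
have dgm : diverges (fun j => gam (m + j.+1)).
  by have /= := diverges_shift m.+1 dg; under eq_fun do rewrite addSnnS.
have [N HN] := prod_contract_vanishes (fun j => gam01 (m + j.+1)) dgm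
  (divr_gt0 e2 (ltr_wpDl (normr_ge0 c) ltr01)).
exists (m + N)%N => n mNn.
have mn : (m <= n)%N by rewrite (leq_trans _ mNn) // leq_addr.
rewrite -(subnKC mn) avg_noise_restart (le_trans (ler_normD _ _)) //.
rewrite [eps]splitr lerD // normrM -/c.
have {}HN := HN (n - m)%N _; have cc : 0 < `|c| + 1 by rewrite ltr_wpDl.
apply: (@le_trans _ _ (eps / 2 / (`|c| + 1) * `|c|)).
  by rewrite ler_wpM2r // HN // leq_subRL.
by rewrite mulrAC ler_pdivrMr // ler_wpM2l ?(ltW e2) // lerDl.
Qed.

End Occupation.

(** * Exponential bounds for the averaged noise *)

Section ExponentialBound.
Variable R : realType.

(** From exp(- x) >= 1 - x one gets exp(x) <= 1 / (1 - x), and (1 - x)(1 + x + 2 x^2) = 1 + x^2 (1 -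
    2 x) is at least 1 for x <= 1/2. *)
Lemma expR_le_quad (x : R) : x <= 1 / 2 -> expR x <= 1 + x + 2 * x ^+ 2.
Proof.
move=> x2; have x1 : 0 < 1 - x by lra.
have e1 : 1 - x <= expR (- x) by have := expR_ge1Dx (- x).
have e2 : expR x * (1 - x) <= 1.
  rewrite -[leRHS](expRxMexpNx_1 x) ler_wpM2l ?expR_ge0 //.
rewrite -(ler_pM2r x1); apply: le_trans e2 _; rewrite expr2; nra.
Qed.

Lemma expR_mean_le (T : finType) (p f : T -> R) (c : R) :
  (forall y, 0 <= p y) -> \sum_y p y = 1 -> \sum_y p y * f y = 0 ->
  (forall y, `|f y| <= c) -> c <= 1 / 2 ->
  \sum_y p y * expR (f y) <= expR (2 * c ^+ 2).
Proof.
move=> p0 p1 pf fc c2; apply: le_trans (expR_ge1Dx _).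
apply: (@le_trans _ _ (\sum_y (p y + p y * f y + p y * (2 * c ^+ 2)))).
  apply: ler_sum => y _; rewrite -[X in X + _ + _]mulr1 -!mulrDr ler_wpM2l //.
  have /ler_normlP[f1 f2] := fc y.
  apply: le_trans (expR_le_quad (le_trans f2 c2)) _.
  rewrite lerD2l ler_pM2l // -[X in X <= _]ger0_norm ?sqr_ge0 // normrX.
  by rewrite lerXn2r ?nnegrE // (le_trans _ (fc y)).
by rewrite !big_split /= p1 pf addr0 -mulr_suml p1 mul1r.
Qed.

End ExponentialBound.

(* The function V bounds the probability that the averaged noise av ever
   exceeds eps: the exponential with parameter of order 1/gam decreases in mean
   while av lies in [eps/2, eps], and below eps/2 one step cannot bring av
   above 3eps/4, which costs at most 1/N - 1/(N+1). *)
Section NoisePotential.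
Variables (R : realType) (T : finType).
Variables (gam : nat -> R) (tr ns : seq T -> T -> R) (av : seq T -> R).
Variables (m : nat) (c eps : R).
Hypothesis gam01 : forall n, 0 < gam n <= 1.
Hypothesis gam_ni : forall i j, (i <= j)%N -> gam j <= gam i.
Hypothesis tr0 : forall s y, 0 <= tr s y.
Hypothesis tr1 : forall s, s != [::] -> \sum_y tr s y = 1.
Hypothesis ns_mean : forall s, s != [::] -> \sum_y tr s y * ns s y = 0.
Hypothesis ns_bound : forall s y, `|ns s y| <= c.
Hypothesis eps0 : 0 < eps.
Hypothesis eps_c : eps <= c.
Hypothesis av_cons : forall s y, av (y :: s) =
  if (size s <= m)%N then 0
  else (1 - gam (size s)) * av s + gam (size s) * ns s y.
Hypothesis gam_small : forall n, (m < n)%N ->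
  gam n * c <= eps / 4 /\
  expR (- (eps ^+ 2 / (16 * c ^+ 2) / gam n)) <= (n%:R * n.+1%:R)^-1.

(** This parameter makes the one-step balance exact: for av >= eps / 2 the drift gains at least
    eps^2 / (8 c^2) in the exponent, and the quadratic bound on the noise costs 2 (eps / (4 c))^2,
    the same number. *)
Let th n := eps / (4 * c ^+ 2 * gam n).

Definition noise_potential (s : seq T) : R :=
  if (size s <= m)%N then 2 / m.+1%:R
  else Num.min 1 (expR (th (size s) * (av s - eps))) + (size s)%:R^-1.

Let c0 : 0 < c. Proof. exact: lt_le_trans eps0 eps_c. Qed.

Let gam0 n : 0 < gam n. Proof. by case/andP: (gam01 n). Qed.

Let th0 n : 0 < th n.
Proof. by rewrite divr_gt0 // !mulr_gt0 // exprn_gt0. Qed.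

Let th_incr n : th n <= th n.+1.
Proof.
rewrite ler_pM2l // lef_pV2 ?posrE ?mulr_gt0 ?exprn_gt0 //.
by rewrite ler_pM2l ?mulr_gt0 ?exprn_gt0 // gam_ni.
Qed.

Let th_gam n : th n * gam n = eps / (4 * c ^+ 2).
Proof. by rewrite /th invfM mulrA divfK // gt_eqF. Qed.

(** Origin of eps^2 / (16 c^2): the parameter eps / (4 c^2 gam) times the distance eps / 4 to the
    threshold. *)
Let th_small n : (m < n)%N -> expR (th n * (- (eps / 4))) <= (n%:R * n.+1%:R)^-1.
Proof.
move=> /gam_small[_]; apply: le_trans; rewrite ler_expR mulrN lerN2.
have g0 := gam0 n; rewrite le_eqVlt; apply/orP; left; apply/eqP.
by rewrite /th; field; rewrite !gt_eqF.
Qed.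

Lemma noise_potential_ge0 s : 0 <= noise_potential s.
Proof.
rewrite /noise_potential; case: ifP => _; first by rewrite divr_ge0.
by rewrite addr_ge0 ?invr_ge0 // le_min ler01 expR_ge0.
Qed.

Lemma noise_potential_ge1 s : (m < size s)%N -> eps <= av s -> 1 <= noise_potential s.
Proof.
move=> ms avs; rewrite /noise_potential leqNgt ms /= ler_wpDr ?invr_ge0 //.
by rewrite le_min lexx /= -[leLHS]expR0 ler_expR mulr_ge0 ?subr_ge0 // ltW.
Qed.

(** The parameter grows with time; the truncation at 1 makes this harmless even above the
    threshold. *)
Let min_expR_incr (t t' a : R) : 0 <= t <= t' ->
  Num.min 1 (expR (t' * a)) <= Num.min 1 (expR (t * a)).
Proof.
move=> /andP[t0 tt]; have [a0|a0] := leP 0 a.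
  rewrite le_min ge_min lexx /=.
  rewrite ge_min; apply/orP; left; rewrite -[leLHS]expR0 ler_expR mulr_ge0 //.
rewrite le_min !ge_min lexx /= ler_expR.
by rewrite (ler_wnM2r (ltW a0)) ?orbT.
Qed.

(** A history reaching size m + 1 has av = 0; the exponential and the second term then contribute at
    most 1 / (m + 1) each. *)
Lemma noise_potential_init s y : (size s <= m)%N ->
  noise_potential (y :: s) <= 2 / m.+1%:R.
Proof.
move=> sm; rewrite /noise_potential /= av_cons sm; case: ltnP => // ms.
have -> : size s = m by apply/eqP; rewrite eqn_leq sm.
have -> : 2 / m.+1%:R = m.+1%:R^-1 + m.+1%:R^-1 :> R by ring.
rewrite sub0r lerD2r ge_min; apply/orP; right.
apply: (@le_trans _ _ (expR (th m.+1 * (- (eps / 4))))).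
  rewrite ler_expR ler_pM2l // lerN2; have := eps0; lra.
apply: le_trans (th_small (ltnSn m)) _.
rewrite lef_pV2 ?posrE ?mulr_gt0 // ler_peMr //.
by rewrite ler1n.
Qed.

Lemma noise_potential_super s : s != [::] -> (m < size s)%N ==> (av s < eps) ->
  \sum_y tr s y * noise_potential (y :: s) <= noise_potential s.
Proof.
move=> s0 avs.
have mean_le F B : (forall y, F y <= B) -> \sum_y tr s y * F y <= B.
  move=> FB; rewrite -[leRHS]mul1r -(tr1 s0) mulr_suml ler_sum // => y _.
  by rewrite ler_wpM2l.
have [sm|ms] := leqP (size s) m.
  rewrite {2}/noise_potential sm; apply: mean_le => y.
  exact: noise_potential_init.
have sm : (size s <= m)%N = false by rewrite leqNgt ms.
have sm1 : (size s < m)%N = false by rewrite ltnNge (ltnW ms).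
rewrite /noise_potential /= sm sm1 /=.
under eq_bigr => y _ do rewrite mulrDr.
rewrite big_split /= -mulr_suml tr1 // mul1r.
set N := size s in ms *; set a := av s in avs *.
rewrite ms /= in avs.
have N0 : (0 < N)%N by rewrite (leq_ltn_trans _ ms).
have g0 := gam0 N; have /andP[_ g1] := gam01 N.
pose a' y := (1 - gam N) * a + gam N * ns s y.
have aE y : av (y :: s) = a' y by rewrite av_cons sm.
have tauE : N%:R^-1 = N.+1%:R^-1 + (N%:R * N.+1%:R)^-1 :> R.
  have n1 : (N%:R : R) != 0 by rewrite pnatr_eq0 -lt0n.
  have n2 : (N%:R + 1 : R) != 0 by rewrite natr1 pnatr_eq0.
  by rewrite -natr1; field; rewrite n1 n2.
have [lo|hi] := leP a (eps / 2).
  rewrite tauE [leRHS]addrCA [leLHS]addrC lerD2l.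
  rewrite ler_wpDl ?le_min ?ler01 ?expR_ge0 //.
  apply: mean_le => y; rewrite ge_min; apply/orP; right.
  apply: le_trans (th_small ms).
  apply: (@le_trans _ _ (expR (th N.+1 * (- (eps / 4))))); last first.
    by rewrite ler_expR ler_nM2r ?th_incr // oppr_lt0 divr_gt0.
  rewrite ler_expR ler_pM2l // aE /a'.
  have : gam N * ns s y <= eps / 4.
    have [gc _] := gam_small ms; apply: le_trans gc.
    by rewrite ler_pM2l // (le_trans (ler_norm _)).
  have : (1 - gam N) * a <= eps / 2.
    have [a0|a0] := leP 0 a; first by rewrite (le_trans _ lo) // ler_piMl // gerBl ltW.
    apply: (@le_trans _ _ 0); last by rewrite divr_ge0 // ltW.
    by rewrite mulr_ge0_le0 ?subr_ge0 // ltW.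
  lra.
rewrite tauE lerD //; last by rewrite lerDl invr_ge0 mulr_ge0.
rewrite [leRHS](min_idPr _); last first.
  by rewrite -[leRHS]expR0 ler_expR pmulr_rle0 // subr_le0 ltW.
pose f y := th N * gam N * ns s y.
apply: (@le_trans _ _ (\sum_y tr s y * (expR (th N * (a - eps) - th N * gam N * a) * expR (f y)))).
  apply: ler_sum => y _; rewrite ler_wpM2l // aE.
  apply: le_trans (min_expR_incr _ _) _; first by rewrite ltW ?th0 //=; exact: th_incr.
  rewrite ge_min -expRD; apply/orP; right; rewrite ler_expR.
  by rewrite /a' /f le_eqVlt; apply/orP; left; apply/eqP; ring.
under eq_bigr => y _ do rewrite mulrCA.
rewrite -mulr_sumr expRD -mulrA ger_pMr ?expR_gt0 //.
pose e := eps / (4 * c).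
have c0' := c0.
have fe y : `|f y| <= e.
  have q0 : 0 <= eps / (4 * c ^+ 2).
    by rewrite ltW // divr_gt0 // mulr_gt0 // exprn_gt0.
  rewrite /f normrM th_gam ger0_norm //.
  apply: (@le_trans _ _ (eps / (4 * c ^+ 2) * c)).
    by rewrite ler_wpM2l.
  by rewrite le_eqVlt; apply/orP; left; apply/eqP; rewrite /e; field; rewrite gt_eqF.
have e12 : e <= 1 / 2 by rewrite /e ler_pdivrMr ?mulr_gt0 //; have := eps_c; lra.
have fmean : \sum_y tr s y * f y = 0.
  under eq_bigr => y _ do rewrite mulrCA.
  by rewrite -mulr_sumr ns_mean // mulr0.
apply: (@le_trans _ _ (expR (- (th N * gam N * a)) * expR (2 * e ^+ 2))).
  rewrite ler_wpM2l ?expR_ge0 //.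
  exact: (expR_mean_le (tr0 s) (tr1 s0) fmean fe e12).
rewrite -expRD -[leRHS]expR0 ler_expR th_gam.
have -> : 2 * e ^+ 2 = eps / (4 * c ^+ 2) * (eps / 2).
  by rewrite /e; field; rewrite gt_eqF.
rewrite addrC subr_le0 ler_pM2l ?ltW //.
by rewrite divr_gt0 // mulr_gt0 // exprn_gt0.
Qed.

End NoisePotential.

(** From gam_n ln n <= kap / 3 follows exp(- kap / gam_n) <= n^-3, which is at most 1 / (n (n + 1))
    for n >= 2. *)
Lemma gam_exp_small (R : realType) (gam : nat -> R) (kap : R) :
  (forall n, 0 < gam n) -> 0 < kap ->
  vanishes (fun n => gam n * ln n%:R) ->
  exists N, forall n, (N <= n)%N ->
    expR (- (kap / gam n)) <= (n%:R * n.+1%:R)^-1.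
Proof.
move=> g0 k0 /(_ (kap / 3))[|N HN]; first by rewrite divr_gt0.
exists (maxn N 2) => n; rewrite geq_max => /andP[/HN + n2].
rewrite ler_norml => /andP[_ gl].
have n0 : 0 < n%:R :> R by rewrite ltr0n (leq_trans _ n2).
have n2' : 2 <= n%:R :> R by rewrite ler_nat.
apply: (@le_trans _ _ (expR (- (3 * ln n%:R)))).
  rewrite ler_expR lerN2 ler_pdivlMr //.
  rewrite -mulrA mulrC -ler_pdivlMr // mulrC.
  by rewrite mulrC [ln _ * _]mulrC.
have -> : 3 * ln n%:R = ln (n%:R ^+ 3) :> R by rewrite lnXn // mulr_natl.
rewrite expRN lnK ?posrE ?exprn_gt0 // lef_pV2 ?posrE ?exprn_gt0 ?mulr_gt0 //.
rewrite -natr1 exprS ler_pM2l // expr2; nra.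
Qed.

(** * Probabilities of histories *)

Section RealProbability.
Variables (R : realType) (d : measure_display) (Omega : measurableType d).
Variable P : probability Omega R.
Implicit Types A B : set Omega.

Definition pr A : R := fine (P A).

Lemma prE A : measurable A -> P A = (pr A)%:E.
Proof. by move=> mA; rewrite /pr fineK // fin_num_measure. Qed.

Lemma pr_ge0 A : 0 <= pr A. Proof. exact: fine_ge0. Qed.

Lemma pr_le A B : measurable A -> measurable B -> A `<=` B -> pr A <= pr B.
Proof.
by move=> mA mB AB; rewrite -lee_fin -!prE // le_measure // inE.
Qed.

Lemma pr_setU A B : measurable A -> measurable B -> pr (A `|` B) <= pr A + pr B.
Proof.
move=> mA mB; rewrite -lee_fin EFinD -!prE //; last exact: measurableU.
exact: measureU2.
Qed.

Lemma measurable_ex (T : finType) (B : T -> set Omega) :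
  (forall y, measurable (B y)) -> measurable [set w | exists y, B y w].
Proof.
move=> mB; rewrite (_ : [set w | _] = \bigcup_(y in [set: T]) B y).
  by apply: fin_bigcup_measurable => //; exact: finite_finset.
by apply/seteqP; split=> w /= [y]; [exists y|move=> _ ?; exists y].
Qed.

Lemma pr_ex_le (T : finType) (B : T -> set Omega) :
  (forall y, measurable (B y)) ->
  pr [set w | exists y, B y w] <= \sum_y pr (B y).
Proof.
move=> mB; suff H (r : seq T) : measurable [set w | exists2 y, y \in r & B y w] /\
    pr [set w | exists2 y, y \in r & B y w] <= \sum_(y <- r) pr (B y).
  apply: le_trans (H (index_enum T)).2; apply: pr_le.
  - exact: measurable_ex.
  - exact: (H _).1.
  - by move=> w /= [y By]; exists y; rewrite ?mem_index_enum.
elim: r => [|y r [IH1 IH2]].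
  rewrite (_ : [set w | _] = set0); last by apply/seteqP; split=> w //= [].
  by split=> //; rewrite /pr measure0 big_nil.
rewrite (_ : [set w | _] = B y `|` [set w | exists2 y, y \in r & B y w]).
  split; first exact: measurableU.
  by rewrite big_cons (le_trans (pr_setU _ _)) // lerD2l.
apply/seteqP; split=> w /=.
  by move=> [z]; rewrite inE => /orP[/eqP->|zr Bz]; [left|right; exists z].
by move=> [By|[z zr Bz]]; [exists y; rewrite ?mem_head|exists z; rewrite // inE zr orbT].
Qed.

Lemma pr_bigcup_le (F : nat -> set Omega) (c : R) :
  (forall n, measurable (F n)) -> (forall n m, (n <= m)%N -> F n `<=` F m) ->
  (forall n, pr (F n) <= c) -> pr (\bigcup_n F n) <= c.
Proof.
move=> mF Fm Fc; have mU : measurable (\bigcup_n F n) by exact: bigcupT_measurable.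
have cv : (P \o F) x @[x --> \oo] --> P (\bigcup_n F n).
  by apply: nondecreasing_cvg_mu => // n m nm; apply/subsetPset; exact: Fm.
rewrite -lee_fin -prE // -(cvg_lim _ cv) //.
apply: lime_le; first by apply: (cvgP _ cv).
by apply: nearW => n /=; rewrite prE // lee_fin.
Qed.

End RealProbability.

(** * A maximal inequality on finite histories *)

Section HistoryChain.
Variables (R : realType) (d : measure_display) (Omega : measurableType d).
Variable P : probability Omega R.
Variables (T : finType) (X : nat -> Omega -> T) (tr : seq T -> T -> R).
Hypothesis X_meas : forall n y, measurable [set w | X n w = y].

Local Notation H n w := (hist (X ^~ w) n).
Local Notation pr := (pr P).

Hypothesis tr0 : forall s y, 0 <= tr s y.
Hypothesis X_chain : forall n s y,
  pr [set w | H n.+1 w = y :: s] = pr [set w | H n w = s] * tr s y.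

(** At a fixed time the history takes finitely many values, so every predicate on lists gives a
    measurable event. *)
Lemma measurable_hist n (Q : seq T -> Prop) : measurable [set w | Q (H n w)].
Proof.
elim: n Q => [|n IH] Q /=.
  rewrite (_ : [set w | _] = [set w | exists y, ([set w | X 0 w = y] `&` [set w | Q [:: y]]) w]).
    apply: measurable_ex => y; apply: measurableI => //.
    have [q|q] := pselect (Q [:: y]).
      by rewrite (_ : [set w | _] = setT) //; apply/seteqP; split.
    by rewrite (_ : [set w | _] = set0) //; apply/seteqP; split.
  by apply/seteqP; split=> w /= => [q|[y [-> //]]]; exists (X 0%N w).
rewrite (_ : [set w | _] = [set w | exists y, ([set w | X n.+1 w = y] `&`
    [set w | Q (y :: H n w)]) w]).
  by apply: measurable_ex => y; apply: measurableI => //; exact: (IH (fun s => Q (y :: s))).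
by apply/seteqP; split=> w /= => [q|[y [-> //]]]; exists (X n.+1 w).
Qed.

(** The maximal inequality for nonnegative supermartingales, by induction on the horizon and
    conditioning on the next state; the horizon then tends to infinity by monotone continuity. The
    supermartingale inequality is asked only at histories that are not bad and at least as long as
    [s]. *)
Lemma hitting_bound (V : seq T -> R) (bad : seq T -> Prop) k s :
  (forall s, 0 <= V s) -> (forall s, bad s -> 1 <= V s) ->
  (forall s', (size s <= size s')%N -> s' != [::] -> ~ bad s' ->
     \sum_y tr s' y * V (y :: s') <= V s') ->
  pr [set w | H k w = s /\ exists j, bad (H (k + j) w)] <=
  pr [set w | H k w = s] * V s.
Proof.
move=> V0 V1 VU.
have mE k' s' (n : nat) : measurable
    [set w | H k' w = s' /\ exists2 j, (j <= n)%N & bad (H (k' + j) w)].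
  rewrite (_ : [set w | _] = [set w | H k' w = s'] `&`
      \bigcup_(j in [set j | (j <= n)%N]) [set w | bad (H (k' + j) w)]).
    apply: measurableI; first exact: (measurable_hist k' (fun h => h = s')).
    by apply: bigcup_measurable => j _; exact: measurable_hist.
  by apply/seteqP; split=> w /= [Hs [j jn bj]]; split=> //; exists j.
have main n : forall k' s', (size s <= size s')%N ->
    pr [set w | H k' w = s' /\ exists2 j, (j <= n)%N & bad (H (k' + j) w)] <=
    pr [set w | H k' w = s'] * V s'.
  have triv k' s' n' : bad s' ->
      pr [set w | H k' w = s' /\ exists2 j, (j <= n')%N & bad (H (k' + j) w)] <=
      pr [set w | H k' w = s'] * V s'.
    move=> bs; apply: (@le_trans _ _ (pr [set w | H k' w = s'])).
      by apply: pr_le => //; [exact: (measurable_hist k' (fun h => h = s'))|move=> w []].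
    by rewrite ler_peMr ?pr_ge0 // V1.
  elim: n => [|n IH] k' s' ss.
    have [bs|nbs] := pselect (bad s'); first exact: triv.
    rewrite (_ : [set w | _] = set0); last first.
      apply/seteqP; split=> w //= [Hs [j]]; rewrite leqn0 => /eqP->.
      by rewrite addn0 Hs.
    by rewrite /pr measure0 /= mulr_ge0 // fine_ge0.
  have [bs|nbs] := pselect (bad s'); first exact: triv.
  have [s0|s0] := eqVneq s' [::].
    rewrite (_ : [set w | _] = set0); last first.
      apply/seteqP; split=> w //= [Hs _]; have := size_hist (X ^~ w) k'.
      by rewrite Hs s0.
    by rewrite /pr measure0 /= mulr_ge0 // fine_ge0.
  pose B y := [set w | H k'.+1 w = y :: s' /\
    exists2 j, (j <= n)%N & bad (H (k'.+1 + j) w)].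
  apply: (@le_trans _ _ (pr [set w | exists y, B y w])).
    apply: pr_le => //; first by apply: measurable_ex => y; exact: mE.
    move=> w /= [Hs [[|j] jn bj]]; first by move: bj; rewrite addn0 Hs.
    by exists (X k'.+1 w); split; [rewrite /= Hs|exists j; rewrite // addSnnS].
  apply: (le_trans (@pr_ex_le _ _ _ P _ B _)); first by move=> y; exact: mE.
  apply: (@le_trans _ _ (\sum_y pr [set w | H k' w = s'] * (tr s' y * V (y :: s')))).
    apply: ler_sum => y _; rewrite mulrA -X_chain; apply: IH => /=.
    by rewrite (leq_trans ss).
  by rewrite -mulr_sumr ler_wpM2l ?pr_ge0 // VU.
rewrite (_ : [set w | _] = \bigcup_n
    [set w | H k w = s /\ exists2 j, (j <= n)%N & bad (H (k + j) w)]).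
  apply: pr_bigcup_le => // [n m nm w /= [Hs [j jn bj]]|n].
    by split=> //; exists j => //; exact: leq_trans nm.
  exact: main.
apply/seteqP; split=> w /=.
  by move=> [Hs [j bj]]; exists j => //; split=> //; exists j.
by move=> [n _ [Hs [j _ bj]]]; split=> //; exists j.
Qed.

Lemma pr_hist_pos n s y : 0 < pr [set w | H n w = s] -> 0 < tr s y ->
  0 < pr [set w | H n.+1 w = y :: s].
Proof. by move=> p0 t0; rewrite X_chain mulr_gt0. Qed.

End HistoryChain.

Lemma sigma_algebra_setI (Omega : Type) (G : set (set Omega)) A B :
  sigma_algebra setT G -> G A -> G B -> G (A `&` B).
Proof.
move=> [G0 GC GU] GA GB.
have GCC C : G C -> G (~` C) by move=> /GC; rewrite setTD.
rewrite -[A `&` B]setCK setCI -bigcup2E; apply/(GCC _)/GU => -[|[|n]] //=.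
- exact: GCC.
- exact: GCC.
Qed.

(** * The reinforced process as a chain on histories *)

Section ReinforcedChain.
Variables (R : realType) (d : measure_display) (Omega : measurableType d).
Variable P : probability Omega R.
Variables (T : finType) (K : T -> T -> R) (eta : nat -> R).
Variables (F : nat -> set (set Omega)) (x0 : T) (X : nat -> Omega -> T).
Hypothesis eta0 : forall n, 0 < eta n.
Hypothesis X_reinforced : reinforced P K eta F x0 X.

Local Notation gam := (gamma_ eta).
Local Notation H n w := (hist (X ^~ w) n).

Definition transition (gam : nat -> R) (s : seq T) (y : T) : R :=
  if s is x :: _ then resurrected K (occ gam s) x [set y]%SET else 0.

Lemma sum_eta_gt0 n : 0 < \sum_(k < n.+1) eta k.
Proof. by rewrite big_ord_recl ltr_pwDl // sumr_ge0 // => i _; exact: ltW. Qed.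

Lemma gamma_0 : gam 0%N = 1.
Proof. by rewrite /gamma_ big_ord_recl big_ord0 addr0 divff // gt_eqF. Qed.

Lemma gamma_gt0 n : 0 < gam n.
Proof. by rewrite divr_gt0 // sum_eta_gt0. Qed.

Lemma gamma_le1 n : gam n <= 1.
Proof.
rewrite ler_pdivrMr ?sum_eta_gt0 // mul1r big_ord_recr /= lerDr.
by rewrite sumr_ge0 // => i _; exact: ltW.
Qed.

Lemma gamma_lt1 n : gam n.+1 < 1.
Proof.
by rewrite ltr_pdivrMr ?sum_eta_gt0 // mul1r big_ord_recr /= ltrDr sum_eta_gt0.
Qed.

Lemma occupation_occ n w x : occupation eta X n w x = occ gam (H n w) x.
Proof.
elim: n => [|n IH].
  rewrite /occupation !big_ord_recl !big_ord0 !addr0 /= gamma_0.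
  by rewrite subrr mul0r add0r mulrAC divff ?gt_eqF.
rewrite /= -IH size_hist /occupation /gamma_ big_ord_recr /=.
have s1 := sum_eta_gt0 n; have := sum_eta_gt0 n.+1; rewrite big_ord_recr /= => s2.
by field; rewrite !gt_eqF.
Qed.

Lemma F_hist n s : F n [set w | H n w = s].
Proof.
case: X_reinforced => -[Fs Fm Fle] Xa _ _.
have Fx m y : F m [set w | X m w = y].
  rewrite (_ : [set w | _] = X m @^-1` (fun z => z \in [set y]%SET)); last first.
    by apply/seteqP; split=> w /=; rewrite inE => /eqP.
  exact: Xa.
elim: n s => [|n IH] s /=.
  case: s => [|y [|? ?]].
  - rewrite (_ : [set w | _] = set0); first by case: (Fs 0%N).
    by apply/seteqP; split.
  - rewrite (_ : [set w | _] = [set w | X 0 w = y]); first exact: Fx.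
    by apply/seteqP; split=> w /= => [[]|->].
  - rewrite (_ : [set w | _] = set0); first by case: (Fs 0%N).
    by apply/seteqP; split.
case: s => [|y s].
  rewrite (_ : [set w | _] = set0); first by case: (Fs n.+1).
  by apply/seteqP; split.
rewrite (_ : [set w | _] = [set w | X n.+1 w = y] `&` [set w | H n w = s]).
  by apply: sigma_algebra_setI => //; apply: (Fle n n.+1).
by apply/seteqP; split=> w /= => [[-> ->]|[-> ->]].
Qed.

Lemma X_measurable n y : measurable [set w | X n w = y].
Proof.
case: X_reinforced => -[Fs Fm Fle] Xa _ _; apply: (Fm n).
rewrite (_ : [set w | _] = X n @^-1` (fun z => z \in [set y]%SET)); first exact: Xa.
by apply/seteqP; split=> w /=; rewrite inE => /eqP.
Qed.

(** The only use of the conditional law: the event that the history equals [s] belongs to [F n], and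
    the conditional probability is constant on it. *)
Lemma reinforced_chain n s y :
  pr P [set w | H n.+1 w = y :: s] = pr P [set w | H n w = s] * transition gam s y.
Proof.
case: X_reinforced => -[Fs Fm Fle] Xa _ /(_ n [set y]%SET)[_ _].
move=> /(_ _ (F_hist n s)); set B := [set w | H n w = s].
have mB : measurable B by apply: (Fm n); exact: F_hist.
have -> : [set w | X n.+1 w \in [set y]%SET] `&` B = [set w | H n.+1 w = y :: s].
  apply/seteqP; split=> w /= [].
    by rewrite inE => /eqP Xy Hs; rewrite Xy Hs.
  by move=> Xy Hs; rewrite inE Xy.
rewrite (@eq_integral _ _ _ _ _ (cst (transition gam s y)%:E)); last first.
  move=> w /set_mem; rewrite /B /= => Hs.
  have Xw : X n w = head (X n w) s by rewrite -Hs; case: (n).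
  case: s Hs Xw {B mB} => [|x s] Hs /= Xw.
    by have := size_hist (X ^~ w) n; rewrite Hs.
  rewrite /transition Xw; congr (_ %:E).
  by rewrite /resurrected /mass !big_set1 occupation_occ Hs.
by rewrite integral_cst // /pr => ->; rewrite fineM ?fin_num_measure // mulrC.
Qed.

Lemma pr_hist0 : pr P [set w | H 0 w = [:: x0]] = 1.
Proof.
case: X_reinforced => _ _ X0 _.
rewrite (_ : [set w | _] = setT); first by rewrite /pr probability_setT.
by apply/seteqP; split=> w //= _; rewrite X0.
Qed.

End ReinforcedChain.

(** * Almost sure smallness of the restarted noise *)

Section NoiseEvent.
Variables (R : realType) (d : measure_display) (Omega : measurableType d).
Variable P : probability Omega R.
Variables (T : finType) (K A : T -> T -> R) (eta : nat -> R).
Variables (F : nat -> set (set Omega)) (x0 : T) (X : nat -> Omega -> T).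
Hypothesis K_sub : sub_markovian K.
Hypothesis A_green : is_green K A.
Hypothesis eta0 : forall n, 0 < eta n.
Hypothesis X_reinforced : reinforced P K eta F x0 X.

Local Notation gam := (gamma_ eta).
Local Notation H n w := (hist (X ^~ w) n).

Hypothesis gam_ni : forall i j, (i <= j)%N -> gam j <= gam i.
Hypothesis gam_ln : vanishes (fun n => gam n * ln n%:R).

Let gam01 n : 0 < gam n <= 1.
Proof. by rewrite gamma_gt0 // gamma_le1. Qed.

Let gam01' n : 0 <= gam n <= 1.
Proof. by rewrite ltW ?gamma_gt0 // gamma_le1. Qed.

Lemma gamma_vanishes : vanishes gam.
Proof.
have ln2 : 0 < ln 2 :> R by rewrite ln_gt0 // ltr1n.
move=> eps eps0; have [N HN] := gam_ln (mulr_gt0 eps0 ln2).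
exists (maxn N 2) => n; rewrite geq_max => /andP[/HN + n2].
have g0 := gamma_gt0 eta0 n; rewrite (gtr0_norm g0).
move=> /(le_trans (ler_norm _)) gl; rewrite -(ler_pM2r ln2); apply: le_trans gl.
rewrite ler_pM2l // ler_ln ?posrE ?ltr0n //; last by rewrite (leq_trans _ n2).
by rewrite ler_nat.
Qed.

Lemma transition_ge0 s y : 0 <= transition K gam s y.
Proof.
case: s => [|x s] //; rewrite /transition /resurrected /mass !big_set1.
have [K0 _] := K_sub; have [q0 _] := @occ_prob _ _ _ (gamma_0 eta0) gam01' (x :: s) isT.
by rewrite addr_ge0 // mulr_ge0 // (killing_ge0 K_sub).
Qed.

Lemma transition_sum s : s != [::] -> \sum_y transition K gam s y = 1.
Proof.
case: s => // x s _; apply: resurrected_sum; exact: (occ_prob (gamma_0 eta0) gam01').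
Qed.

Definition bad_noise m (eps : R) (s : seq T) : Prop :=
  (m < size s)%N /\ exists z, eps <= `|avg_noise A gam m s z|.

(** A union bound over the coordinate and the sign of the noise, encoded in [T * bool]. It is
    conditional on a history of at most m + 1 states: the initial one for almost sure convergence, a
    path in E1 for the positive probability of the limit [mstar]. *)
Lemma noise_tail (eps : R) : 0 < eps -> exists M, forall m, (M <= m)%N ->
  forall k s, (k <= m)%N ->
  pr P [set w | H k w = s /\ exists j, bad_noise m eps (H (k + j) w)] <=
  pr P [set w | H k w = s] * (#|{: T * bool}|%:R * (2 / m.+1%:R)).
Proof.
move=> eps0; have [C C1 AC] := Amass_bound A_green.
(* 2 C + 1 bounds the noise; eps is added so that eps <= c, as the potential requires. *)
pose c := 2 * C + 1 + eps.
have c0 : 0 < c by rewrite /c; lra.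
have [N1 HN1] := gamma_vanishes (divr_gt0 eps0 (mulr_gt0 (ltr0n R 4) c0)).
have kap0 : 0 < eps ^+ 2 / (16 * c ^+ 2) by rewrite divr_gt0 ?mulr_gt0 ?exprn_gt0.
have [N2 HN2] := gam_exp_small (gamma_gt0 eta0) kap0 gam_ln.
exists (maxn N1 N2) => m; rewrite geq_max => /andP[m1 m2] k s km.
have small n : (m < n)%N -> gam n * c <= eps / 4 /\
    expR (- (eps ^+ 2 / (16 * c ^+ 2) / gam n)) <= (n%:R * n.+1%:R)^-1.
  move=> mn; split; last by apply: HN2; rewrite (leq_trans m2) // ltnW.
  have := HN1 n; rewrite (leq_trans m1) 1?ltnW // => /(_ isT).
  rewrite gtr0_norm ?gamma_gt0 // => gn.
  apply: le_trans (ler_wpM2r (ltW c0) gn) _.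
  by rewrite le_eqVlt; apply/orP; left; apply/eqP; field; rewrite gt_eqF.
have [sk|sk] := eqVneq (size s) k.+1; last first.
  rewrite (_ : [set w | _ /\ _] = set0); last first.
    apply/seteqP; split=> w //= [Hs _]; have := size_hist (X ^~ w) k.
    by move: sk => /[swap]; rewrite Hs => -> /eqP.
  by rewrite /pr measure0 /= !mulr_ge0 ?fine_ge0 ?divr_ge0.
pose sg (b : bool) : R := (-1) ^+ b.
pose av (p : T * bool) s' := sg p.2 * avg_noise A gam m s' p.1.
pose ns (p : T * bool) s' y := sg p.2 * noise A gam s' y p.1.
pose V p := noise_potential gam (av p) m c eps.
pose bad (p : T * bool) s' := (m < size s')%N /\ eps <= av p s'.
have sg1 b : `|sg b| = 1 by rewrite /sg normrX normrN1 expr1n.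
have ns_c p s' y : `|ns p s' y| <= c.
  rewrite normrM sg1 mul1r /c.
  have := noise_bound A_green (gamma_0 eta0) gam01' C1 AC s' y p.1; lra.
have ns0 p s' : s' != [::] -> \sum_y transition K gam s' y * ns p s' y = 0.
  move=> s'0; have := @noise_mean _ _ _ _ A_green _ (gamma_0 eta0) gam01' s' x0 p.1 s'0.
  case: s' s'0 => // x s' _ /= E; under eq_bigr => y _ do rewrite mulrCA.
  by rewrite -mulr_sumr E mulr0.
have avc p s' y : av p (y :: s') = if (size s' <= m)%N then 0
    else (1 - gam (size s')) * av p s' + gam (size s') * ns p s' y.
  by rewrite /av /=; case: ifP => _; rewrite ?mulr0 // /ns; ring.
have eps_c : eps <= c by rewrite /c; lra.
have mX := X_measurable X_reinforced.
have HB p : pr P [set w | H k w = s /\ exists j, bad p (H (k + j) w)] <=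
    pr P [set w | H k w = s] * V p s.
  apply: (@hitting_bound _ _ _ _ _ _ (transition K gam)) => //.
  - exact: (reinforced_chain eta0 X_reinforced).
  - by move=> s'; exact: noise_potential_ge0.
  - by move=> s' [ms es]; exact: (noise_potential_ge1 gam01 eps0 eps_c ms es).
  move=> s' _ s'0 nb.
  apply: (noise_potential_super (gam01 : forall n, 0 < gam n <= 1) gam_ni transition_ge0
    transition_sum (ns0 p) (ns_c p) eps0 eps_c (avc p) small s'0).
  by apply/implyP => ms; rewrite ltNge; apply/negP => es; apply: nb.
have mB p : measurable [set w | H k w = s /\ exists j, bad p (H (k + j) w)].
  rewrite (_ : [set w | _] = [set w | H k w = s] `&` \bigcup_j [set w | bad p (H (k + j) w)]).
    apply: measurableI; first exact: (measurable_hist mX k (fun h => h = s)).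
    by apply: bigcupT_measurable => j; exact: measurable_hist.
  by apply/seteqP; split=> w /= [Hs [j]]; split=> //; exists j.
apply: (@le_trans _ _ (\sum_p pr P [set w | H k w = s] * V p s)).
  apply: le_trans (ler_sum _ (fun p _ => HB p)).
  apply: (le_trans _ (pr_ex_le P mB)); apply: pr_le.
  - rewrite (_ : [set w | _] = [set w | H k w = s] `&` \bigcup_j [set w | bad_noise m eps (H (k + j) w)]).
      apply: measurableI; first exact: (measurable_hist mX k (fun h => h = s)).
      by apply: bigcupT_measurable => j; exact: measurable_hist.
    by apply/seteqP; split=> w /= [Hs [j]]; split=> //; exists j.
  - exact: measurable_ex.
  move=> w /= [Hs [j [ms [z ez]]]].
  have [n0|n0] := leP 0 (avg_noise A gam m (H (k + j) w) z).
    exists (z, false); split=> //; exists j; split=> //.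
    by rewrite /av /sg /= expr0 mul1r -(ger0_norm n0).
  exists (z, true); split=> //; exists j; split=> //.
  by rewrite /av /sg /= expr1 mulN1r -(ltr0_norm n0).
rewrite -mulr_sumr ler_wpM2l ?fine_ge0 //.
apply: (@le_trans _ _ (\sum_(p : T * bool) 2 / m.+1%:R)).
  apply: ler_sum => p _; case: s sk {HB mB} => [|y s] //= [sk].
  by apply: (noise_potential_init gam01 eps0 eps_c (avc p) small); rewrite sk.
by rewrite sumr_const [leRHS]mulr_natl.
Qed.

Definition good_noise w := forall eps : R, 0 < eps -> exists m, forall k z,
  `|avg_noise A gam m (H (m + k) w) z| <= eps.

(** On the complement, for some threshold 1 / (i + 1) and every m, the noise restarted at m is large
    at some time. For each m this has probability O(1/m), so the intersection over m is null. *)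
Lemma good_noise_ae : P.-negligible [set w | ~ good_noise w].
Proof.
have mX := X_measurable X_reinforced.
pose E i m := \bigcup_j [set w | bad_noise m (i.+1%:R^-1) (H j w)].
have mE i m : measurable (E i m).
  by apply: bigcupT_measurable => j; exact: measurable_hist.
pose N i := \bigcap_m E i m.
have mN i : measurable (N i) by exact: bigcapT_measurable.
have prN i : P.-negligible (N i).
  apply/negligibleP => //; transitivity (pr P (N i))%:E; first exact: prE.
  congr (_%:E); apply/eqP.
  rewrite eq_le fine_ge0 // andbT; apply/ler_addgt0Pl => e e0; rewrite addr0.
  have i0 : 0 < i.+1%:R^-1 :> R by rewrite invr_gt0.
  have [M HM] := noise_tail i0.
  pose c : R := #|{: T * bool}|%:R * 2.
  have c0 : 0 <= c by rewrite mulr_ge0.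
  pose m := maxn M (Num.trunc (c / e)).
  apply: (@le_trans _ _ (pr P (E i m))).
    by apply: pr_le => //; exact: bigcap_inf.
  have := HM m (leq_maxl _ _) 0%N [:: x0] (leq0n _).
  rewrite (pr_hist0 X_reinforced) mul1r.
  rewrite (_ : [set w | _ /\ _] = E i m); last first.
    apply/seteqP; split=> w /=; first by move=> [_ [j bj]]; exists j.
    move=> [j _ bj]; split; last by exists j.
    by case: X_reinforced => _ _ -> _.
  move=> H0; apply: le_trans H0 _; rewrite mulrA -/c ler_pdivrMr // mulrC -ler_pdivrMr //.
  apply: le_trans (ltW (truncnS_gt _)) _.
  by rewrite ler_nat ltnS leq_maxr.
apply: negligibleS (negligible_bigcup prN) => w /= ng.
apply: contrapT => nN; apply: ng => eps eps0.
pose i := Num.trunc (eps^-1).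
have i_eps : i.+1%:R^-1 <= eps.
  rewrite invf_ple ?posrE ?ltr0n //; exact/ltW/truncnS_gt.
have : ~ N i w by move=> Ni; apply: nN; exists i.
move=> /existsNP[m /not_implyP[_ nE]]; exists m => -[|k] z.
  case: m nE => [|m] nE; first by rewrite /= normr0 ltW.
  by rewrite addn0 /= size_hist leqnn normr0 ltW.
apply: le_trans i_eps; rewrite leNgt; apply/negP => ei; apply: nE.
exists (m + k.+1)%N => //; split; first by rewrite size_hist ltnS leq_addr.
by exists z; exact: ltW.
Qed.

End NoiseEvent.

(** * Quasi-stationary distributions of the two-class kernel *)

Section QSDExtension.
Variables (R : realType) (T : finType) (S : {set T}) (K : T -> T -> R).
Variable mu : {x : T | x \in S} -> R.
Hypothesis K0 : forall x y, 0 <= K x y.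
Hypothesis mu_qsd : is_qsd (restrict_kernel S K) mu.

Local Notation m := (extend_by0 mu).
Local Notation Th := (extinction_rate (restrict_kernel S K) mu).

Lemma extend_val u : m (val u) = mu u.
Proof. by rewrite /extend_by0 valK. Qed.

Lemma extend_out x : x \notin S -> m x = 0.
Proof. by move=> xS; rewrite /extend_by0 insubF //; exact/negbTE. Qed.

Lemma extend_ge0 x : 0 <= m x.
Proof.
by case: mu_qsd => -[mu0 _] _; rewrite /extend_by0; case: insub.
Qed.

Lemma extend_sum : \sum_x m x = 1.
Proof.
case: mu_qsd => -[_ mu1] _; rewrite (sum_supp (S := S)); last exact: extend_out.
by rewrite -[RHS]mu1 big_sub; apply: eq_bigr => u _; rewrite extend_val.
Qed.

Lemma extend_mul_val (v : {x : T | x \in S}) :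
  mu_mul mu (restrict_kernel S K) v = \sum_(x in S) m x * K x (val v).
Proof.
by rewrite [RHS]big_sub; apply: eq_bigr => u _; rewrite extend_val.
Qed.

Lemma extend_rate_gt0 : 0 < Th.
Proof.
rewrite lt_neqAle; apply/andP; split.
  apply/eqP => Th0; case: mu_qsd => -[_ mu1] muQ; move/eqP: mu1.
  rewrite /total_mass big1 ?(eq_sym 0) ?oner_eq0 // => u _.
  by rewrite muQ -Th0 invr0 mulr0.
rewrite sumr_ge0 // => v _; rewrite extend_mul_val sumr_ge0 // => x _.
by rewrite mulr_ge0 // extend_ge0.
Qed.

Lemma extend_eigen y : y \in S -> \sum_(x in S) m x * K x y = Th * m y.
Proof.
move=> yS; rewrite -[y]/(val (Sub y yS : {x | x \in S})) -extend_mul_val extend_val.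
case: mu_qsd => _ /(_ (Sub y yS)) ->.
by rewrite mulrC divfK // gt_eqF // extend_rate_gt0.
Qed.

Lemma extend_pos : exists2 x, x \in S & 0 < m x.
Proof.
have [x mx] : exists x, 0 < m x by apply: sum_gt0_ex; rewrite extend_sum.
by exists x => //; apply: contraTT mx => /extend_out->; rewrite ltxx.
Qed.

End QSDExtension.

Lemma big_setT (R : realType) (T : finType) (F : T -> R) :
  \sum_(x in [set: T]%SET) F x = \sum_x F x.
Proof. by apply: eq_bigl => x; rewrite inE. Qed.

(** Data of the contraction argument, used with S = E2 and w = h for the limit on E2, and with S the
    whole space for the limit of full support; in the latter case [h] vanishes on E2, so the weight
    [w] has to differ from it. *)
Record dominant_class (R : realType) (T : finType) (A : T -> T -> R) (S : {set T})
    (h pi w : T -> R) (al k : R) : Prop := {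
  dc_al : 0 < al;
  dc_k : 0 <= k < 1;
  dc_h0 : forall x, 0 <= h x;
  dc_w0 : forall x, x \in S -> 0 < w x;
  dc_Ah : forall x, x \in S -> \sum_(y in S) A x y * h y = al * h x;
  dc_piA : forall y, y \in S -> \sum_(x in S) pi x * A x y = al * pi y;
  dc_pih : \sum_(x in S) pi x * h x = 1;
  dc_contr : forall nu : T -> R, \sum_(x in S) nu x * h x = 0 ->
    \sum_(y in S) `|\sum_(x in S) nu x * A x y| * w y <=
    k * al * \sum_(x in S) `|nu x| * w x }.

(** * Eigenvectors of the kernel and of its Green kernel *)

Section TwoClasses.
Variables (R : realType) (E : finType) (E1 E2 : {set E}) (K : E -> E -> R).
Hypothesis E12_disjoint : (E1 :&: E2)%SET = finset.set0.
Hypothesis E12_cover : (E1 :|: E2)%SET = [set: E]%SET.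
Hypothesis K_sub : sub_markovian K.
Hypothesis E1_irr : forall x y, x \in E1 -> y \in E1 -> leads K x y.
Hypothesis E2_irr : forall x y, x \in E2 -> y \in E2 -> leads K x y.
Hypothesis E1_to_E2 : leads_set K E1 E2.
Hypothesis E2_not_to_E1 : ~ leads_set K E2 E1.
Hypothesis E2_killed : exists2 x, x \in E2 & total_mass (K x) < 1.

Let K0 : forall x y, 0 <= K x y. Proof. by case: K_sub. Qed.

Lemma notin_E1 x : (x \notin E1) = (x \in E2).
Proof.
have : x \in (E1 :|: E2)%SET by rewrite E12_cover inE.
have : x \notin (E1 :&: E2)%SET by rewrite E12_disjoint inE.
by rewrite !inE; case: (x \in E1); case: (x \in E2).
Qed.

Lemma notin_E2 x : (x \notin E2) = (x \in E1).
Proof. by rewrite -notin_E1 negbK. Qed.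

Lemma K_E2_E1 x y : x \in E2 -> y \notin E2 -> K x y = 0.
Proof.
rewrite notin_E2 => xE2 yE1; apply/eqP; rewrite eq_le K0 andbT leNgt.
by apply/negP => Kxy; apply: E2_not_to_E1; exists x, y; split=> //; exact: leads1.
Qed.

Lemma K_E2 x y : x \in E2 -> 0 < K x y -> y \in E2.
Proof.
by move=> xE2 Kxy; apply: contraTT Kxy => /(K_E2_E1 xE2)->; rewrite ltxx.
Qed.

(** A path between states of E1 never enters E2, from which there is no return; the invariant
    records the states of E2 as dead ends. *)
Lemma E1_irreducible : irreducible_on E1 K.
Proof.
move=> C Ccl x y xE1 yE1 Cx.
have : y \in E2 \/ y \in E1 /\ C y.
  apply: (@leads_closed _ _ K (fun y => y \in E2 \/ y \in E1 /\ C y) x y K0 _ (E1_irr xE1 yE1)).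
    move=> u v [uE2 Kuv|[uE1 Cu] Kuv]; first by left; exact: K_E2 Kuv.
    have [vE2|] := boolP (v \in E2); first by left.
    by rewrite notin_E2 => vE1; right; split=> //; exact: Ccl Kuv.
  by right.
by case=> [|[]//]; rewrite -notin_E1 yE1.
Qed.

Lemma E2_irreducible : irreducible_on E2 K.
Proof.
move=> C Ccl x y xE2 yE2 Cx.
have [] // : y \in E2 /\ C y.
apply: (@leads_closed _ _ K (fun y => y \in E2 /\ C y) x y K0 _ (E2_irr xE2 yE2)) => //.
by move=> u v [uE2 Cu] Kuv; have vE2 := K_E2 uE2 Kuv; split=> //; exact: Ccl Kuv.
Qed.

(** A closed set meeting E1 follows a path to E2, then spreads over it by irreducibility. This
    yields the killing condition, the positivity of the left eigenvector on E2 and the accessibility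
    of E2. *)
Lemma closed_E2 (C : E -> Prop) : (exists x, C x) ->
  (forall x y, C x -> 0 < K x y -> C y) -> forall y, y \in E2 -> C y.
Proof.
move=> [x Cx] Ccl y yE2.
have [a [b [aE1 bE2 ab]]] := E1_to_E2.
have Cb : exists2 b, b \in E2 & C b.
  have [xE2|] := boolP (x \in E2); first by exists x.
  rewrite notin_E2 => xE1; exists b => //.
  apply: (leads_closed K0 Ccl ab); exact: (leads_closed K0 Ccl (E1_irr xE1 aE1)).
have [c cE2 Cc] := Cb; exact: (leads_closed K0 Ccl (E2_irr cE2 yE2)).
Qed.

Lemma K_kills (C : E -> Prop) : (exists x, C x) ->
  (forall x y, C x -> 0 < K x y -> C y) -> exists2 x, C x & total_mass (K x) < 1.
Proof.
move=> C0 Ccl; have [x xE2 Kx] := E2_killed.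
by exists x => //; exact: (closed_E2 C0 Ccl xE2).
Qed.

Variables (m1 m2 : E -> R) (Th1 Th2 : R).
Hypothesis m1_ge0 : forall x, 0 <= m1 x.
Hypothesis m1_out : forall x, x \notin E1 -> m1 x = 0.
Hypothesis m1_sum : \sum_x m1 x = 1.
Hypothesis m1_pos : exists2 x, x \in E1 & 0 < m1 x.
Hypothesis m1_eigen : forall y, y \in E1 -> \sum_(x in E1) m1 x * K x y = Th1 * m1 y.
Hypothesis m2_ge0 : forall x, 0 <= m2 x.
Hypothesis m2_out : forall x, x \notin E2 -> m2 x = 0.
Hypothesis m2_sum : \sum_x m2 x = 1.
Hypothesis m2_pos : exists2 x, x \in E2 & 0 < m2 x.
Hypothesis m2_eigen : forall y, y \in E2 -> \sum_(x in E2) m2 x * K x y = Th2 * m2 y.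
Hypothesis Th2_gt0 : 0 < Th2.
Hypothesis Th12 : Th2 < Th1.

Let Th1_gt0 : 0 < Th1. Proof. exact: lt_trans Th12. Qed.

Let eigen_pos_supp (S : {set E}) (m : E -> R) Th : irreducible_on S K ->
  (forall x, x \in S -> 0 <= m x) -> (exists2 x, x \in S & 0 < m x) ->
  (forall y, y \in S -> \sum_(x in S) m x * K x y = Th * m y) ->
  forall x, x \in S -> 0 < m x.
Proof.
move=> irr m0 [x xS mx] mK y yS.
pose f z : R := if z \in S then m z else 0.
have := @eigen_pos _ _ S K f Th K0 irr _ _ _ y yS; rewrite /f yS; apply.
- by move=> z; case: ifP => // /m0.
- by exists x; rewrite ?xS.
move=> z zS; rewrite zS -mK // /mu_mul (sum_supp (S := S)).
  by apply: eq_bigr => u ->.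
by move=> u /negPf->; rewrite mul0r.
Qed.

Lemma m1_gt0 x : x \in E1 -> 0 < m1 x.
Proof.
by apply: (eigen_pos_supp E1_irreducible) m1_eigen x.
Qed.

Lemma m2_gt0 x : x \in E2 -> 0 < m2 x.
Proof.
by apply: (eigen_pos_supp E2_irreducible) m2_eigen x.
Qed.

Lemma m2_left y : mu_mul m2 K y = Th2 * m2 y.
Proof.
rewrite /mu_mul (sum_supp (S := E2)); last by move=> x /m2_out->; rewrite mul0r.
have [yE2|yE2] := boolP (y \in E2); first exact: m2_eigen.
by rewrite m2_out // mulr0 big1 // => x xE2; rewrite K_E2_E1 // mulr0.
Qed.

(** Th1 is the m1-average of K(z, E1), which is below 1 because [m1] is positive on E1 and some
    state of E1 sends mass to E2. *)
Lemma Th1_lt1 : Th1 < 1.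
Proof.
have [x xE1 Kx] : exists2 x, x \in E1 & \sum_(y in E1) K x y < 1.
  have [x xE1 [y yE2 Kxy]] : exists2 x, x \in E1 & exists2 y, y \in E2 & 0 < K x y.
    apply: contrapT => nex; have [a [b [aE1 bE2 ab]]] := E1_to_E2.
    have : b \in E1.
      apply: (@leads_closed _ _ K (fun z => z \in E1) a b K0 _ ab aE1).
      move=> u v uE1 Kuv; rewrite -notin_E2; apply/negP => vE2.
      by apply: nex; exists u => //; exists v.
    by move/negPn; rewrite notin_E1 bE2.
  exists x => //; case: K_sub => _ /(_ x)/andP[_]; apply: lt_le_trans.
  rewrite /total_mass [ltRHS](bigID (fun z => z \in E1)) /= ltrDl (bigD1 y) /=.
    by rewrite ltr_pwDl // sumr_ge0.
  by rewrite notin_E1.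
have le1 z : \sum_(y in E1) K z y <= 1.
  case: K_sub => _ /(_ z)/andP[_]; apply: le_trans.
  by rewrite /total_mass [leRHS](bigID (fun u => u \in E1)) /= lerDl sumr_ge0.
have -> : Th1 = \sum_(z in E1) m1 z * \sum_(y in E1) K z y.
  under eq_bigr => z _ do rewrite mulr_sumr.
  rewrite exchange_big /=; under eq_bigr => y yE1 do rewrite m1_eigen //.
  by rewrite -mulr_sumr -(sum_supp m1_out) m1_sum mulr1.
rewrite -[ltRHS]m1_sum (sum_supp m1_out) (bigD1 x) //= [ltRHS](bigD1 x) //=.
rewrite ltr_leD //; first by rewrite gtr_pMr // m1_gt0.
by apply: ler_sum => z _; rewrite ler_piMr.
Qed.

Let Th2_lt1 : Th2 < 1. Proof. exact: lt_trans Th1_lt1. Qed.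

Lemma right_eigen1 : exists h, [/\ forall x, x \in E1 -> 0 < h x,
  forall x, x \notin E1 -> h x = 0 & forall x, app K h x = Th1 * h x].
Proof.
have [|h [h0 h1 Kh]] := perron_right K0 E1_irreducible Th1_gt0 m1_gt0 _ m1_eigen.
  by case: m1_pos => x xE1 _; exists x.
exists h; split=> // x; have [xE1|xE1] := boolP (x \in E1); first exact: Kh.
rewrite (h1 _ xE1) mulr0 /app big1 // => y _; rewrite notin_E1 in xE1.
have [yE1|/h1->] := boolP (y \in E1); last by rewrite mulr0.
by rewrite K_E2_E1 ?mul0r // notin_E2.
Qed.

Lemma right_eigen2 : exists h, [/\ forall x, x \in E2 -> 0 < h x,
  forall x, x \notin E2 -> h x = 0 & forall x, x \in E2 -> app K h x = Th2 * h x].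
Proof.
have [|h H] := perron_right K0 E2_irreducible Th2_gt0 m2_gt0 _ m2_eigen.
  by case: m2_pos => x xE2 _; exists x.
by exists h.
Qed.

(** Pairing with the positive right eigenvector h of K on E2 gives Th1 (n h) <= Th2 (n h), hence n h
    = 0 since Th2 < Th1. *)
Lemma no_growth2 (n : E -> R) : (forall x, 0 <= n x) ->
  (forall x, x \notin E2 -> n x = 0) ->
  (forall y, y \in E2 -> Th1 * n y <= mu_mul n K y) -> forall x, n x = 0.
Proof.
move=> n0 nout nK x.
have [h [hpos hout Kh]] := right_eigen2.
have h0 y : 0 <= h y.
  by have [/hpos/ltW//|/hout->] := boolP (y \in E2).
have le1 : Th1 * dotp n h <= Th2 * dotp n h.
  rewrite /dotp !mulr_sumr.
  apply: (@le_trans _ _ (dotp (mu_mul n K) h)).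
    apply: ler_sum => y _; rewrite mulrA.
    have [yE2|/hout->] := boolP (y \in E2); last by rewrite !mulr0.
    by rewrite ler_wpM2r // nK.
  rewrite dotp_mul; apply: ler_sum => y _.
  have [yE2|/nout->] := boolP (y \in E2); last by rewrite !mul0r mulr0.
  by rewrite Kh // mulrCA.
have d0 : 0 <= dotp n h by rewrite sumr_ge0 // => y _; rewrite mulr_ge0.
have {le1 d0} d0 : dotp n h == 0.
  rewrite eq_le d0 andbT leNgt; apply/negP => d1.
  by move: le1; rewrite ler_pM2r // leNgt Th12.
have [xE2|/nout//] := boolP (x \in E2).
move: d0; rewrite psumr_eq0 => [/allP/(_ x)|y _]; last by rewrite mulr_ge0.
by rewrite mem_index_enum mulf_eq0 (gt_eqF (hpos x xE2)) orbF => /(_ isT)/eqP.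
Qed.

(** The left null vector dual to the right eigenvector has unknown signs. By [no_growth2] it is not
    zero on all of E1; it has one sign on E1, and [no_growth2] again excludes the opposite sign on
    E2. *)
Lemma full_left_eigen : exists m : E -> R,
  [/\ forall x, 0 < m x, \sum_x m x = 1 & forall y, mu_mul m K y = Th1 * m y].
Proof.
have [h [hpos hout Kh]] := right_eigen1.
have h0 y : 0 <= h y.
  by have [/hpos/ltW//|/hout->] := boolP (y \in E1).
have [x1 x1E1 _] := m1_pos.
have [||nu [z0 nuz0] nuM] := @singular_left R E (fun x y => K x y - Th1 * (x == y)%:R) h x1.
- by rewrite gt_eqF // hpos.
- move=> x; rewrite /app; under eq_bigr => y _ do rewrite mulrBl -mulrA.
  by rewrite sumrB -mulr_sumr sum_delta_l -/(app K h x) Kh subrr.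
have nuK y : mu_mul nu K y = Th1 * nu y.
  apply/eqP; rewrite -subr_eq0 -(nuM y) /mu_mul.
  under [X in _ == X]eq_bigr => x _ do rewrite mulrBr mulrCA.
  by rewrite sumrB -mulr_sumr sum_delta_r.
have absK y : Th1 * `|nu y| <= mu_mul (fun x => `|nu x|) K y.
  rewrite -{1}(gtr0_norm Th1_gt0) -normrM -nuK (le_trans (ler_norm_sum _ _ _)) //.
  by apply: ler_sum => x _; rewrite normrM (ger0_norm (K0 x y)).
(* Both sides have the same pairing with [h]; as [h] vanishes outside E1, equality is obtained on E1
   only. *)
have absE1 y : y \in E1 -> mu_mul (fun x => `|nu x|) K y = Th1 * `|nu y|.
  move=> yE1; apply/esym/(mulIf (lt0r_neq0 (hpos y yE1))).
  apply: (@sum_le_eq _ _ xpredT (fun y => Th1 * `|nu y| * h y)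
    (fun y => mu_mul (fun x => `|nu x|) K y * h y)) => //.
    by move=> x _; rewrite ler_wpM2r.
  rewrite -/(dotp _ h) -[RHS]/(dotp _ h) dotp_mul /dotp; apply: eq_bigr => x _.
  by rewrite Kh mulrCA mulrA.
have mulE1 (f : E -> R) y : y \in E1 -> mu_mul f K y = \sum_(x in E1) f x * K x y.
  move=> yE1; rewrite /mu_mul (sum_supp (S := E1)) // => x; rewrite notin_E1 => xE2.
  by rewrite K_E2_E1 ?mulr0 // notin_E2.
have [z zE1 nuz] : exists2 z, z \in E1 & nu z != 0.
  apply: contrapT => H.
  have nu1 x : x \notin E2 -> `|nu x| = 0.
    rewrite notin_E2 => xE1; apply/eqP; rewrite normr_eq0; apply/negPn/negP => nux.
    by apply: H; exists x.
  have := no_growth2 (fun x => normr_ge0 (nu x)) nu1 (fun y _ => absK y) z0.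
  by move/eqP; rewrite normr_eq0 (negPf nuz0).
have sgn (f : E -> R) : (forall y, mu_mul f K y = Th1 * f y) ->
    (forall y, `|f y| = `|nu y|) -> 0 < f z ->
    exists m : E -> R, [/\ forall x, 0 < m x, \sum_x m x = 1 & forall y, mu_mul m K y = Th1 * m y].
  move=> fK fnu fz.
  have f1 x : x \in E1 -> 0 < f x.
    (* |f| + f is a nonnegative left eigenvector on E1, positive at z, hence positive on E1; it
       would vanish wherever f <= 0. *)
    have pl := @eigen_pos_supp E1 (fun x => `|f x| + f x) Th1 E1_irreducible.
    have {pl} pl y : y \in E1 -> 0 < `|f y| + f y.
      apply: pl => //.
      - by move=> u _; have := ler_normlW (lexx `|f u|); have := lerNnormlW (lexx `|f u|); lra.
      - by exists z => //; rewrite ltr_wpDl.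
      move=> u uE1; under eq_bigr => v _ do rewrite mulrDl fnu.
      by rewrite big_split /= -!mulE1 // absE1 // fK -fnu mulrDr.
    by move=> /pl; have [//|f0] := ltP 0 (f x); rewrite (ler0_norm f0) addNr ltxx.
  (* The negative part of [f] lives on E2 and satisfies Th1 n <= n K there, so it is 0. *)
  pose n x : R := if x \in E2 then (if f x < 0 then - f x else 0) else 0.
  have n0 x : 0 <= n x.
    by rewrite /n; case: ifP => // _; case: ifP => // f0; rewrite oppr_ge0 ltW.
  have fn x : - f x <= n x.
    rewrite /n; have [xE2|] := boolP (x \in E2).
      by case: ifP => // /negbT; rewrite -leNgt oppr_le0.
    by rewrite notin_E2 => /f1/ltW; rewrite oppr_le0.
  have n00 : forall x, n x = 0.
    apply: no_growth2 => //; first by move=> x /negPf xE2; rewrite /n xE2.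
    move=> y yE2; rewrite {1}/n yE2; case: ifP => fy; last first.
      by rewrite mulr0 sumr_ge0 // => x _; rewrite mulr_ge0.
    rewrite mulrN -fK /mu_mul -sumrN; apply: ler_sum => x _.
    by rewrite -mulNr ler_wpM2r.
  have f0 x : 0 <= f x by rewrite -oppr_le0 -(n00 x).
  have fcl x y : 0 < f x -> 0 < K x y -> 0 < f y.
    move=> fx Kxy; rewrite lt_neqAle f0 andbT; apply/eqP => fy.
    have : 0 < mu_mul f K y.
      rewrite /mu_mul (bigD1 x) //= ltr_pwDl ?mulr_gt0 // sumr_ge0 // => u _.
      by rewrite mulr_ge0.
    by rewrite fK -fy mulr0 ltxx.
  have fpos x : 0 < f x.
    have [/f1//|] := boolP (x \in E1); rewrite notin_E1 => xE2.
    by apply: (closed_E2 (C := fun x => 0 < f x)) => //; exists z.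
  have s0 : 0 < \sum_x f x by rewrite (bigD1 z) //= ltr_pwDl // sumr_ge0.
  exists (fun x => f x / \sum_x f x); split.
  - by move=> x; rewrite divr_gt0.
  - by rewrite -mulr_suml divff // gt_eqF.
  move=> y; rewrite /mu_mul; under eq_bigr => x _ do rewrite mulrAC.
  by rewrite -mulr_suml -/(mu_mul f K y) fK mulrA.
move: nuz; rewrite neq_lt => /orP[nuz|nuz]; last exact: (sgn nu).
apply: (sgn (fun x => - nu x)); last by rewrite oppr_gt0.
- move=> y; rewrite mulrN -nuK /mu_mul -sumrN; apply: eq_bigr => x _.
  by rewrite mulNr.
- by move=> y; rewrite normrN.
Qed.

Variable A : E -> E -> R.
Hypothesis A_green : is_green K A.

Let A0 x y : 0 <= A x y. Proof. by case: A_green. Qed.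

Lemma green_E2 x y : x \in E2 -> y \notin E2 -> A x y = 0.
Proof. exact: (green_block K_sub K_kills A_green K_E2_E1). Qed.

Let left_green (m : E -> R) Th y : Th < 1 -> (forall y, mu_mul m K y = Th * m y) ->
  mu_mul m A y = (1 - Th)^-1 * m y.
Proof.
move=> ThL mK; have Th0 : 1 - Th != 0 by rewrite gt_eqF // subr_gt0.
apply: (mulfI Th0); rewrite mulVKf // -[RHS](green_mul A_green).
rewrite [in LHS]/mu_mul mulr_sumr; apply: eq_bigr => x _; rewrite mK; ring.
Qed.

Lemma class2 : exists h2 k2, [/\ dominant_class A E2 h2 m2 h2 (1 - Th2)^-1 k2
  & forall x, x \notin E2 -> h2 x = 0].
Proof.
have [h [hpos hout Kh]] := right_eigen2.
have al0 : 0 < (1 - Th2)^-1 by rewrite invr_gt0 subr_gt0.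
have [z zE2 mz] := m2_pos.
have m2supp (f : E -> R) : \sum_(x in E2) m2 x * f x = dotp m2 f.
  by rewrite /dotp [RHS](sum_supp (S := E2)) // => x /m2_out->; rewrite mul0r.
have s0 : 0 < dotp m2 h.
  rewrite -m2supp (bigD1 z) //= ltr_pwDl ?mulr_gt0 ?hpos // sumr_ge0 // => x /andP[xE2 _].
  by rewrite mulr_ge0 // ltW // hpos.
pose h2 x := h x / dotp m2 h.
have h2pos x : x \in E2 -> 0 < h2 x by move=> /hpos ?; rewrite divr_gt0.
have h2out x : x \notin E2 -> h2 x = 0 by move=> /hout hx; rewrite /h2 hx mul0r.
have Ah2 x : x \in E2 -> \sum_(y in E2) A x y * h2 y = (1 - Th2)^-1 * h2 x.
  move=> xE2; have Th0 : 1 - Th2 != 0 by rewrite gt_eqF // subr_gt0.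
  apply: (mulfI Th0); rewrite mulVKf //.
  transitivity (app A (fun y => h y - app K h y) x / dotp m2 h); last by rewrite (green_app A_green).
  rewrite /app (sum_supp (S := E2)); last by move=> y /(green_E2 xE2)->; rewrite mul0r.
  rewrite mulr_sumr mulr_suml; apply: eq_bigr => y yE2.
  by rewrite -/(app K h y) Kh // /h2; ring.
have [||k2 k2_01 contr] := dobrushin _ _ h2pos m2_gt0 Ah2 al0.
- by exists z.
- by move=> x y xE2 yE2; apply: (green_gt0 K_sub A_green E2_irreducible).
exists h2, k2; split=> //; split=> //.
- by move=> x; have [/h2pos/ltW//|/h2out->] := boolP (x \in E2).
- by move=> y _; rewrite (m2supp (A^~ y)); exact: left_green m2_left.
rewrite m2supp /h2 /dotp; under eq_bigr => x _ do rewrite mulrA.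
by rewrite -mulr_suml divff // gt_eqF.
Qed.

Variable mstar : E -> R.
Hypothesis mstar_gt0 : forall x, 0 < mstar x.
Hypothesis mstar_left : forall y, mu_mul mstar K y = Th1 * mstar y.

(* The weight M h1 + h2 with M large absorbs the flow of mass from E1 to E2. *)
Lemma class1 : exists h1 w1 k1, [/\ dominant_class A [set: E]%SET h1 mstar w1 (1 - Th1)^-1 k1,
  forall x, x \in E1 -> 0 < h1 x & forall x, x \notin E1 -> h1 x = 0].
Proof.
have [h [hpos hout Kh]] := right_eigen1.
have al0 : 0 < (1 - Th1)^-1 by rewrite invr_gt0 subr_gt0 Th1_lt1.
have [z zE1 mz] := m1_pos.
have h0 x : 0 <= h x by have [/hpos/ltW//|/hout->] := boolP (x \in E1).
have s0 : 0 < dotp mstar h.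
  rewrite /dotp (bigD1 z) //= ltr_pwDl ?mulr_gt0 ?hpos // sumr_ge0 // => x _.
  by rewrite mulr_ge0 // ltW.
pose h1 x := h x / dotp mstar h.
have h1pos x : x \in E1 -> 0 < h1 x by move=> /hpos ?; rewrite divr_gt0.
have h1out x : x \notin E1 -> h1 x = 0 by move=> /hout hx; rewrite /h1 hx mul0r.
have h1ge0 x : 0 <= h1 x by rewrite divr_ge0 // ltW.
have Ah1 x : \sum_y A x y * h1 y = (1 - Th1)^-1 * h1 x.
  have Th0 : 1 - Th1 != 0 by rewrite gt_eqF // subr_gt0 Th1_lt1.
  apply: (mulfI Th0); rewrite mulVKf //.
  transitivity (app A (fun y => h y - app K h y) x / dotp mstar h).
    rewrite /app mulr_sumr mulr_suml; apply: eq_bigr => y _.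
    by rewrite -/(app K h y) Kh /h1; ring.
  by rewrite (green_app A_green).
have Ah1' x : x \in E1 -> \sum_(y in E1) A x y * h1 y = (1 - Th1)^-1 * h1 x.
  by rewrite -Ah1 [in RHS](sum_supp (S := E1)) // => y /h1out->; rewrite mulr0.
have [||k k01 contr] := dobrushin _ _ h1pos m1_gt0 Ah1' al0.
- by exists z.
- by move=> x y xE1 yE1; apply: (green_gt0 K_sub A_green E1_irreducible).
have [h2 [k2 [D2 h2out]]] := class2.
have [al20 _ h20 h2pos Ah2 _ _ _] := D2.
set al := (1 - Th1)^-1 in al0 Ah1 Ah1' contr *; set al2 := (1 - Th2)^-1 in al20 Ah2 D2.
have al21 : al2 < al.
  by rewrite ltf_pV2 ?posrE ?subr_gt0 ?Th1_lt1 // ltrD2l ltrN2.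
(* Bounds the mass that A sends from E1 to E2, measured by [h2], relative to [h1]. *)
pose c := \sum_(x in E1) (\sum_(y in E2) A x y * h2 y) / h1 x.
have q0 x : 0 <= \sum_(y in E2) A x y * h2 y by rewrite sumr_ge0 // => y _; rewrite mulr_ge0.
have c0 : 0 <= c.
  by rewrite sumr_ge0 // => x xE1; rewrite divr_ge0 // ltW // h1pos.
have cE1 x : x \in E1 -> \sum_(y in E2) A x y * h2 y <= c * h1 x.
  move=> xE1; rewrite -ler_pdivrMr ?h1pos // /c [leRHS](bigD1 x) //= lerDl sumr_ge0 // => y /andP[yE1 _].
  by rewrite divr_ge0.
have /andP[k0 k1] := k01.
pose M := 2 * c / (al * (1 - k)) + 1.
have M0 : 0 < M by rewrite ltr_wpDl // divr_ge0 ?mulr_ge0 ?(ltW al0) // subr_ge0 ltW.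
pose w x := M * h1 x + h2 x.
(* On E1 half of the margin 1 - k, multiplied by [M], pays for the flow [c], whence (1 + k) / 2; on
   E2 the factor is al2 / al, below 1 because Th2 < Th1. *)
pose kk := Num.max ((1 + k) / 2) (al2 / al).
have kk1 : kk < 1.
  rewrite gt_max; apply/andP; split; last by rewrite ltr_pdivrMr // mul1r.
  by rewrite ltr_pdivrMr //; lra.
have kk0 : 0 <= kk by rewrite le_max divr_ge0 // addr_ge0.
have cM : c + M * (k * al) <= kk * al * M.
  apply: (@le_trans _ _ ((1 + k) / 2 * al * M)); last first.
    by rewrite ler_wpM2r ?(ltW M0) // ler_wpM2r ?(ltW al0) // le_max lexx.
  have -> : (1 + k) / 2 * al * M = M * (k * al) + (al * (1 - k) / 2) * M by field.
  rewrite addrC lerD2l /M mulrDr mulr1.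
  have d0 : 0 < al * (1 - k) by rewrite mulr_gt0 // subr_gt0.
  have -> : al * (1 - k) / 2 * (2 * c / (al * (1 - k))) = c.
    by field; rewrite !gt_eqF // subr_gt0.
  by rewrite lerDl divr_ge0 // ltW.
exists h1, w, kk; split=> //; split=> //.
- by rewrite kk0.
- move=> x _; rewrite /w; have [xE1|] := boolP (x \in E1).
    exact: (ltr_pwDl (mulr_gt0 M0 (h1pos x xE1)) (h20 x)).
  rewrite notin_E1 => xE2.
  exact: (ltr_wpDl (mulr_ge0 (ltW M0) (h1ge0 x)) (h2pos x xE2)).
- by move=> x _; rewrite big_setT Ah1.
- by move=> y _; rewrite big_setT -(left_green y Th1_lt1 mstar_left).
- rewrite big_setT /h1 /dotp; under eq_bigr => x _ do rewrite mulrA.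
  by rewrite -mulr_suml divff // gt_eqF.
move=> nu; rewrite !big_setT => nuh; pose N y := `|\sum_x nu x * A x y|.
have -> : \sum_y `|\sum_(x in [set: E]%SET) nu x * A x y| * w y =
    M * (\sum_(y in E1) N y * h1 y) + \sum_(y in E2) N y * h2 y.
  rewrite -(sum_supp (S := E1) (F := fun y => N y * h1 y)); last first.
    by move=> y /h1out->; rewrite mulr0.
  rewrite -(sum_supp (S := E2) (F := fun y => N y * h2 y)); last first.
    by move=> y /h2out->; rewrite mulr0.
  rewrite mulr_sumr -big_split /=; apply: eq_bigr => y _.
  by rewrite big_setT /w -/(N y); ring.
pose a := \sum_x `|nu x| * h1 x; pose b := \sum_x `|nu x| * h2 x.
have -> : \sum_x `|nu x| * w x = M * a + b.
  by rewrite /a /b mulr_sumr -big_split /=; apply: eq_bigr => x _; rewrite /w; ring.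
have a0 : 0 <= a by rewrite sumr_ge0 // => x _; rewrite mulr_ge0.
have h2ge0 x : 0 <= h2 x by [].
have b0 : 0 <= b by rewrite sumr_ge0 // => x _; rewrite mulr_ge0.
have part1 : \sum_(y in E1) N y * h1 y <= k * al * a.
  have nuh1 : \sum_(x in E1) nu x * h1 x = 0.
    by rewrite -[RHS]nuh [RHS](sum_supp (S := E1)) // => x /h1out->; rewrite mulr0.
  have -> : a = \sum_(x in E1) `|nu x| * h1 x.
    by rewrite /a (sum_supp (S := E1)) // => x /h1out->; rewrite mulr0.
  apply: le_trans (contr _ nuh1); apply: ler_sum => y yE1.
  rewrite /N (sum_supp (S := E1)) // => x; rewrite notin_E1 => xE2.
  by rewrite green_E2 ?mulr0 // notin_E2.
have part2 : \sum_(y in E2) N y * h2 y <= c * a + al2 * b.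
  apply: (@le_trans _ _ (\sum_x `|nu x| * \sum_(y in E2) A x y * h2 y)).
    under [leRHS]eq_bigr => x _ do rewrite mulr_sumr.
    rewrite exchange_big /=; apply: ler_sum => y yE2.
    under [leRHS]eq_bigr => x _ do rewrite mulrA.
    rewrite -[leRHS]mulr_suml ler_wpM2r // (le_trans (ler_norm_sum _ _ _)) //.
    by apply: ler_sum => x _; rewrite normrM (ger0_norm (A0 x y)).
  rewrite /a /b !mulr_sumr -big_split /=; apply: ler_sum => x _.
  rewrite !(mulrCA _ `|nu x|) -mulrDr ler_wpM2l //.
  have [xE1|] := boolP (x \in E1).
    by apply: le_trans (cE1 x xE1) _; rewrite lerDl mulr_ge0 // ltW.
  rewrite notin_E1 => xE2; rewrite Ah2 // lerDr mulr_ge0 //.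
have kkb : al2 * b <= kk * al * b.
  rewrite ler_wpM2r // -ler_pdivrMr // /kk le_max lexx orbT //.
have := ler_wpM2l (ltW M0) part1; have := ler_wpM2r a0 cM; nra.
Qed.

End TwoClasses.

(** * Convergence along a path *)

Section PathwiseLimit.
Variables (R : realType) (T : finType) (K A : T -> T -> R).
Hypothesis A_green : is_green K A.
Variable gam : nat -> R.
Hypothesis gam_0 : gam 0%N = 1.
Hypothesis gam01 : forall n, 0 <= gam n <= 1.
Hypothesis gam_ni : forall i j, (i <= j)%N -> gam j <= gam i.
Variables (S : {set T}) (h pi w : T -> R) (al k : R).
Hypothesis dom : dominant_class A S h pi w al k.

Local Notation coef := (coefS S h).
Local Notation dist := (distS S h pi w).

Let A0 x y : 0 <= A x y. Proof. by case: A_green. Qed.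

Lemma coef_near (Z Z' : T -> R) :
  `|coef Z - coef Z'| <= (\sum_x h x) * \sum_x `|Z x - Z' x|.
Proof.
rewrite /coefS -sumrB mulr_sumr (le_trans (ler_norm_sum _ _ _)) //.
rewrite [leLHS]big_mkcond; apply: ler_sum => x _ /=.
have h0 := dc_h0 dom; have Hx : h x <= \sum_x h x.
  by rewrite (bigD1 x) //= lerDl sumr_ge0.
have H0 : 0 <= \sum_x h x by rewrite sumr_ge0.
case: ifP => _; last by rewrite mulr_ge0.
by rewrite -mulrBl normrM mulrC (ger0_norm (h0 x)) ler_wpM2r.
Qed.

Variable X : nat -> T.

Local Notation mu n := (occ gam (hist X n)).
Local Notation Z := (smooth A gam X).

Definition step_weight m j : R := (dotp (mu (m + j)) (Amass A))^-1.

(* The second sum is the mass entering S from outside. *)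
Definition step_error m j y : R := step_weight m j *
  ((\sum_x (mu (m + j) x - Z m j x) * A x y) +
   \sum_(x | x \notin S) Z m j x * A x y).

(** [Pi] of the occupation measure is [step_weight] times mu A; replacing mu by Z and keeping only
    the sources in [S] leaves [step_error]. *)
Lemma smooth_linear_step m j :
  linear_step A S (gam (m + j.+1)) (step_weight m j) (step_error m j)
    (Z m j) (Z m j.+1).
Proof.
move=> y yS /=; congr (_ + _ * _).
rewrite /Pi mulrC -/(step_weight m j) /step_error -mulrDr; congr (_ * _).
have E : \sum_x Z m j x * A x y = \sum_(x in S) Z m j x * A x y
    + \sum_(x | x \notin S) Z m j x * A x y by rewrite (bigID (fun x => x \in S)).
rewrite addrCA -E; under [X in _ = X + _]eq_bigr => x _ do rewrite mulrBl.
by rewrite sumrB subrK.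
Qed.

Variable C : R.
Hypothesis C1 : 1 <= C.
Hypothesis AC : forall x, Amass A x <= C.

Let A_le x z : A x z <= C.
Proof.
by apply: le_trans (AC x); rewrite /Amass /total_mass (bigD1 z) //= lerDl sumr_ge0.
Qed.

Let mu_prob n : is_prob (mu n). Proof. exact: hist_prob. Qed.

Let Z_prob m j : is_prob (Z m j). Proof. exact: (smooth_prob A_green). Qed.

Lemma step_weight_bounds m j : C^-1 <= step_weight m j <= 1.
Proof.
have a1 := dotp_Amass_ge1 A_green (mu_prob (m + j)).
have a0 := lt_le_trans ltr01 a1.
have C0 : 0 < C by rewrite (lt_le_trans ltr01).
rewrite /step_weight lef_pV2 ?posrE // invf_le1 // a1 andbT.
have [m0 m1] := mu_prob (m + j); rewrite -[leRHS]mulr1 -m1 /dotp /total_mass mulr_sumr.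
by apply: ler_sum => x _; rewrite mulrC ler_wpM2r.
Qed.

Definition error_size m j : R := \sum_x `|mu (m + j) x - Z m j x|
  + \sum_(x | x \notin S) Z m j x.

Lemma step_error_bound m j : normS S (step_error m j) <= #|T|%:R * (C * error_size m j).
Proof.
have C0 : 0 <= C by rewrite (le_trans ler01).
have [Z0 _] := Z_prob m j.
have er0 : 0 <= error_size m j by rewrite addr_ge0 // sumr_ge0.
have bnd y : `|step_error m j y| <= C * error_size m j.
  have /andP[w0 w1] := step_weight_bounds m j.
  rewrite /step_error normrM -[leRHS]mul1r ler_pM //.
    by rewrite ger0_norm // (le_trans _ w0) // invr_ge0.
  rewrite (le_trans (ler_normD _ _)) // mulrDr !mulr_sumr lerD //.
    rewrite (le_trans (ler_norm_sum _ _ _)) // ler_sum // => x _.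
    by rewrite normrM mulrC (ger0_norm (A0 x y)) ler_wpM2r.
  rewrite (le_trans (ler_norm_sum _ _ _)) // ler_sum // => x _.
  by rewrite normrM mulrC (ger0_norm (A0 x y)) (ger0_norm (Z0 x)) ler_wpM2r.
apply: (@le_trans _ _ (\sum_(x : T) C * error_size m j)); last first.
  by rewrite sumr_const [leRHS]mulr_natl.
rewrite /normS big_mkcond; apply: ler_sum => y _ /=.
by case: ifP => // _; rewrite mulr_ge0.
Qed.

Lemma smooth_trajectory m i : (forall j, 1 / 2 <= \sum_(x in S) Z m (i + j) x) ->
  trajectory A S C^-1 (fun j => gam (m + (i + j).+1))
    (fun j => step_weight m (i + j)) (fun j => step_error m (i + j))
    (fun j => Z m (i + j)).
Proof.
move=> half; split=> //.
- by move=> n; exact: step_weight_bounds.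
- by move=> n; case: (Z_prob m (i + n)).
- move=> n; rewrite half /=; have [Z0 Z1] := Z_prob m (i + n).
  by rewrite -Z1 /total_mass [leRHS](bigID (fun x => x \in S)) /= lerDl sumr_ge0.
by move=> n; rewrite (addnS i n); exact: smooth_linear_step.
Qed.

Hypothesis dg : diverges gam.
Hypothesis vg : vanishes gam.
Hypothesis good : forall eps : R, 0 < eps -> exists m, forall k z,
  `|avg_noise A gam m (hist X (m + k)) z| <= eps.

Lemma mu_smooth_vanishes x : vanishes (fun n => mu n x - Z 0 n x).
Proof.
apply: (smooth_close_vanishes A_green gam_0 gam01 C1 AC (m := 0) gam_ni) => //.
apply: (avg_noise_vanishes gam01 dg) => eps /good[m Hm].
by exists m => k'; exact: Hm.
Qed.

(** The distance to the line spanned by [pi] vanishes; as [pi] and Z both have total mass 1, the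
    coordinate is then forced to tend to 1. *)
Lemma occ_cvg beta : \sum_(x in S) pi x = 1 -> (forall x, x \notin S -> pi x = 0) ->
  (forall x, x \notin S -> vanishes (fun n => Z 0 n x)) ->
  0 < beta -> (forall N, exists2 n, (N <= n)%N & beta <= coef (Z 0 n)) ->
  forall x, vanishes (fun n => mu n x - pi x).
Proof.
move=> pi1 pi0 Zout beta0 io.
have vout : vanishes (fun n => \sum_(x | x \notin S) Z 0 n x).
  have := vanishes_sum (u := fun x n => if x \in S then 0 else Z 0 n x).
  have vz : vanishes (fun=> 0 : R).
    by move=> eps eps0; exists 0%N => n _; rewrite normr0 ltW.
  have H x : vanishes (fun n => if x \in S then 0 else Z 0 n x).
    by case: (boolP (x \in S)) => // /Zout.
  move=> /(_ H) {H} H eps /H[N HN]; exists N => n /HN.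
  by rewrite [X in _ -> `|X| <= _]big_mkcond /=; under [X in _ -> `|X| <= _]eq_bigr => x _ do rewrite if_neg.
have massE n : \sum_(x in S) Z 0 n x = 1 - \sum_(x | x \notin S) Z 0 n x.
  have [_ <-] := Z_prob 0 n.
  by rewrite /total_mass [X in X - _](bigID (fun x => x \in S)) /= addrK.
have [i Hi] : exists i, forall n, (i <= n)%N -> 1 / 2 <= \sum_(x in S) Z 0 n x.
  have [|i Hi] := vout (1 / 2); first by rewrite divr_gt0.
  exists i => n /Hi; rewrite massE => /(le_trans (ler_norm _)); lra.
have tr := smooth_trajectory (m := 0) (i := i) (fun j => Hi _ (leq_addr j i)).
have C0 : 0 < C by rewrite (lt_le_trans ltr01).
have verr : vanishes (fun j => normS S (step_error 0 (i + j))).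
  apply: (@vanishes_le _ _ (fun j => #|T|%:R * (C * error_size 0 (i + j)))).
    apply/vanishesM/vanishesM; rewrite /error_size; apply: vanishesD.
      have H x : vanishes (fun n => `|mu n x - Z 0 n x|).
        by move=> eps /(mu_smooth_vanishes x)[N HN]; exists N => n /HN; rewrite normr_id.
      exact: (vanishes_shift i (vanishes_sum H)).
    exact: (vanishes_shift i vout).
  by move=> j; rewrite ger0_norm ?normS_ge0 // step_error_bound.
have vdist : vanishes (fun n => dist (Z 0 n)).
  apply: (@vanishes_unshift _ _ i).
  case: dom => d1 d2 d3 d4 d5 d6 d7 d8.
  have Ci0 : 0 < C^-1 by rewrite invr_gt0.
  have dgi : diverges (fun j => gam (0 + (i + j).+1)).
    by have /= := diverges_shift i.+1 dg; under eq_fun do rewrite addSn.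
  apply: (trajectory_vanishes d1 d2 d3 d4 d5 d6 d7 d8 Ci0 tr dgi verr beta0).
  move=> N; have [n iNn bn] := io (i + N)%N.
  have ni : (i <= n)%N by rewrite (leq_trans _ iNn) // leq_addr.
  by exists (n - i)%N; rewrite ?leq_subRL // subnKC.
have w0 := dc_w0 dom.
have dist0 n : 0 <= dist (Z 0 n) by apply: distS_ge0 => x /w0.
have vx x : x \in S -> vanishes (fun n => Z 0 n x - coef (Z 0 n) * pi x).
  move=> xS; apply: (@vanishes_le _ _ (fun n => (w x)^-1 * dist (Z 0 n))).
    exact: vanishesM.
  move=> n; rewrite [leRHS]mulrC ler_pdivlMr ?w0 // /distS [leRHS](bigD1 x) //= lerDl.
  by rewrite sumr_ge0 // => y /andP[yS _]; rewrite mulr_ge0 // ltW // w0.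
have vcoef : vanishes (fun n => 1 - coef (Z 0 n)).
  have H x : vanishes (fun n => if x \in S then Z 0 n x - coef (Z 0 n) * pi x else Z 0 n x).
    by case: (boolP (x \in S)) => [/vx|/Zout].
  have := vanishes_sum H.
  move=> {}H eps /H[N HN]; exists N => n /HN.
  have [_ Z1] := Z_prob 0 n.
  rewrite (bigID (fun x => x \in S)) /=.
  under eq_bigr => x xS do rewrite xS.
  under [X in `|_ + X|]eq_bigr => x /negPf xS do rewrite xS.
  rewrite sumrB -mulr_sumr pi1 mulr1 massE.
  by rewrite addrAC subrK.
move=> x; have [xS|xS] := boolP (x \in S); last first.
  rewrite pi0 //; have := vanishesD (mu_smooth_vanishes x) (Zout x xS).
  by move=> H eps /H[N HN]; exists N => n /HN; rewrite subrK subr0.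
have := vanishesD (vanishesD (mu_smooth_vanishes x) (vx x xS)) (vanishesM (- pi x) vcoef).
move=> H eps /H[N HN]; exists N => n /HN.
by congr (`|_| <= _); ring.
Qed.

End PathwiseLimit.

(** * Uniform lower bound on the dominant coordinate *)

Section Persistence.
Variables (R : realType) (T : finType) (K A : T -> T -> R).
Hypothesis A_green : is_green K A.
Variable gam : nat -> R.
Hypothesis gam_0 : gam 0%N = 1.
Hypothesis gam01 : forall n, 0 <= gam n <= 1.
Hypothesis gam_ni : forall i j, (i <= j)%N -> gam j <= gam i.
Variables (h pi w : T -> R) (al k : R).
Hypothesis dom : dominant_class A [set: T]%SET h pi w al k.

Lemma coef_persist (beta : R) : 0 < beta ->
  exists2 eps, 0 < eps & exists2 c, 0 < c & forall X m,
    gam m <= eps -> beta <= dotp (occ gam (hist X m)) h ->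
    (forall j z, `|avg_noise A gam m (hist X (m + j)) z| <= eps) ->
    forall j, c <= dotp (occ gam (hist X (m + j))) h.
Proof.
move=> beta0; have [C C1 AC] := Amass_bound A_green.
have C0 : 0 < C by rewrite (lt_le_trans ltr01).
have dom' := dom; case: dom' => d1 d2 d3 d4 d5 d6 d7 d8.
have Ci0 : 0 < C^-1 by rewrite invr_gt0.
have [eps0 eps00 [c c0 persist]] := trajectory_persist d1 d2 d3 d4 d5 d6 d7 d8 Ci0 beta0.
pose Hs := \sum_x h x; have Hs0 : 0 <= Hs by rewrite sumr_ge0.
pose C' := 1 + (2 * (C + 1) + C * C).
have C'0 : 0 < C' by have := C0; rewrite /C' => ?; nra.
pose n := #|T|%:R + 1 : R; have n0 : 0 < n by rewrite /n ltr_wpDl.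
(* [e1] keeps the perturbation of the recursion below eps0; [e2] keeps the h-coordinates of the
   occupation measure and of the recursion within c / 2 of each other. *)
pose e1 := eps0 / (n * (C * (n * C'))).
pose e2 := c / 2 / ((Hs + 1) * (n * C')).
have e10 : 0 < e1 by rewrite divr_gt0 // !mulr_gt0.
have Hs1 : 0 < Hs + 1 by rewrite ltr_wpDl.
have e20 : 0 < e2 by rewrite !divr_gt0 // !mulr_gt0.
exists (Num.min e1 e2); first by rewrite lt_min e10.
exists (c / 2); first by rewrite divr_gt0.
move=> X m; rewrite le_min => /andP[g1 g2] bm noise_le.
have close e j : gam m <= e -> (forall j z, `|avg_noise A gam m (hist X (m + j)) z| <= e) ->
    \sum_x `|occ gam (hist X (m + j)) x - smooth A gam X m j x| <= n * C' * e.
  move=> ge ne; apply: (@le_trans _ _ (\sum_(x : T) C' * e)).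
    apply: ler_sum => x _.
    apply: le_trans (smooth_close A_green gam_0 gam01 C1 AC X m gam_ni j x) _.
    rewrite /C' [leRHS]mulrDl mul1r lerD // ler_wpM2l //.
    by rewrite addr_ge0 ?mulr_ge0 ?addr_ge0 // ltW.
  rewrite sumr_const -[_ *+ _]mulr_natl -mulrA ler_wpM2r //; last by rewrite /n lerDl.
  by rewrite mulr_ge0 ?(ltW C'0) // (le_trans _ (ne 0%N (X 0%N))).
have ne1 j z : `|avg_noise A gam m (hist X (m + j)) z| <= e1.
  by have := noise_le j z; rewrite le_min => /andP[].
have ne2 j z : `|avg_noise A gam m (hist X (m + j)) z| <= e2.
  by have := noise_le j z; rewrite le_min => /andP[].
have tr : trajectory A [set: T]%SET C^-1 (fun j => gam (m + (0 + j).+1))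
    (fun j => step_weight A gam X m (0 + j)) (fun j => step_error A gam [set: T]%SET X m (0 + j))
    (fun j => smooth A gam X m (0 + j)).
  apply: (smooth_trajectory A_green gam_0 gam01 C1 AC) => j.
  have [_ Z1] := smooth_prob A_green gam_0 gam01 X m (0 + j).
  by rewrite big_setT -/(total_mass _) Z1; lra.
have coefE (f : T -> R) : coefS [set: T]%SET h f = dotp f h by rewrite /coefS big_setT.
move=> j.
have cZ : c <= dotp (smooth A gam X m j) h.
  rewrite -coefE; apply: (persist _ _ _ _ tr); first by rewrite coefE.
  move=> i; apply: le_trans (@step_error_bound R T K A A_green gam gam_0 gam01 [set: T]%SET X C C1 AC m (0 + i)) _.
  rewrite /error_size [X in _ + X]big_pred0 ?addr0; last by move=> x; rewrite inE.
  apply: (@le_trans _ _ (n * (C * (n * C' * e1)))); last first.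
    rewrite /e1 le_eqVlt; apply/orP; left; apply/eqP; field.
    by rewrite !gt_eqF.
  apply: ler_pM => //; first by rewrite mulr_ge0 ?(ltW C0) // sumr_ge0.
    by rewrite /n lerDl.
  by rewrite ler_wpM2l ?(ltW C0) // close.
have := coef_near dom (occ gam (hist X (m + j))) (smooth A gam X m j).
rewrite !coefE ler_norml => /andP[+ _].
have : Hs * \sum_x `|occ gam (hist X (m + j)) x - smooth A gam X m j x| <= c / 2.
  apply: (@le_trans _ _ ((Hs + 1) * (n * C' * e2))).
    by apply: ler_pM => //; rewrite ?lerDl // ?sumr_ge0 // close.
  rewrite /e2 le_eqVlt; apply/orP; left; apply/eqP; field.
  by rewrite !gt_eqF.
rewrite -/Hs; lra.
Qed.

End Persistence.

(** * The random limit *)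

Section Endgame.
Variables (R : realType) (E : finType) (E1 E2 : {set E}) (K : E -> E -> R).
Hypothesis E12_disjoint : (E1 :&: E2)%SET = finset.set0.
Hypothesis E12_cover : (E1 :|: E2)%SET = [set: E]%SET.
Hypothesis K_sub : sub_markovian K.
Hypothesis E2_not_to_E1 : ~ leads_set K E2 E1.
Variable A : E -> E -> R.
Hypothesis A_green : is_green K A.
Variables (h1 w1 h2 m2 mstar : E -> R) (al1 k1 al2 k2 : R).
Hypothesis dom1 : dominant_class A [set: E]%SET h1 mstar w1 al1 k1.
Hypothesis dom2 : dominant_class A E2 h2 m2 h2 al2 k2.
Hypothesis h1_pos : forall x, x \in E1 -> 0 < h1 x.
Hypothesis h1_out : forall x, x \notin E1 -> h1 x = 0.
Hypothesis mstar_sum : \sum_x mstar x = 1.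
Hypothesis m2_sum : \sum_(x in E2) m2 x = 1.
Hypothesis m2_out : forall x, x \notin E2 -> m2 x = 0.
Hypothesis E1_step : forall x, x \in E1 -> exists2 y, y \in E1 & 0 < K x y.
Hypothesis E2_reached : forall C : E -> Prop, (exists x, C x) ->
  (forall x y, C x -> 0 < K x y -> C y) -> forall y, y \in E2 -> C y.
Hypothesis E2_neq0 : exists x, x \in E2.

Let K0 : forall x y, 0 <= K x y. Proof. by case: K_sub. Qed.
Let nE1 x : (x \notin E1) = (x \in E2). Proof. exact: notin_E1. Qed.
Let nE2 x : (x \notin E2) = (x \in E1). Proof. exact: notin_E2. Qed.
Let KE2 x y : x \in E2 -> y \notin E2 -> K x y = 0.
Proof. exact: (K_E2_E1 E12_disjoint E12_cover K_sub E2_not_to_E1). Qed.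

Lemma sum_E12 (F : E -> R) : \sum_x F x = \sum_(x in E1) F x + \sum_(x in E2) F x.
Proof. by rewrite (bigID (fun x => x \in E1)) /=; congr (_ + _); apply: eq_bigl. Qed.

Let pos_min (S : {set E}) (f : E -> R) : (forall x, x \in S -> 0 < f x) ->
  exists2 c, 0 < c & forall x, x \in S -> c <= f x.
Proof.
have [->|] := eqVneq S finset.set0; first by exists 1 => // x; rewrite inE.
move=> /finset.set0Pn[x1 x1S] f0; pose x := [arg min_(x < x1 in S) f x]%O.
exists (f x); rewrite /x; case: arg_minP => //; first by move=> i iS _; exact: f0.
Qed.

(** * Dichotomy according to the mass of E1 *)

Section Deterministic.
Variable gam : nat -> R.
Hypothesis gam_0 : gam 0%N = 1.
Hypothesis gam01 : forall n, 0 <= gam n <= 1.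
Hypothesis gam_ni : forall i j, (i <= j)%N -> gam j <= gam i.

Definition mass1 (s : seq E) : R := \sum_(x in E1) occ gam s x.

Definition escapes (X : nat -> E) := vanishes (fun n => mass1 (hist X n)).

Let mass1_ge0 X n : 0 <= mass1 (hist X n).
Proof. by rewrite sumr_ge0 // => x _; case: (hist_prob gam_0 gam01 X n). Qed.

Let mass1_h1 : exists2 c, 0 < c & forall Z : E -> R, (forall x, 0 <= Z x) ->
  c * (\sum_(x in E1) Z x) <= dotp Z h1.
Proof.
have [c c0 hc] := pos_min h1_pos; exists c => // Z Z0.
rewrite /dotp (sum_supp (S := E1)); last by move=> x /h1_out->; rewrite mulr0.
rewrite mulr_sumr; apply: ler_sum => x xE1.
by rewrite mulrC ler_wpM2l // hc.
Qed.

(** With all the mass in E1 at time m, the coordinate along [h1] starts above a fixed constant and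
    stays bounded below; as [h1] is bounded and zero outside E1, the mass of E1 cannot tend to 0. *)
Lemma persists : exists2 eps, 0 < eps & forall X m,
    gam m <= eps -> mass1 (hist X m) = 1 ->
    (forall j z, `|avg_noise A gam m (hist X (m + j)) z| <= eps) -> ~ escapes X.
Proof.
have [c0 c00 hc] := mass1_h1.
have [eps eps0 [c cpos H]] := coef_persist A_green gam_0 gam01 gam_ni dom1 c00.
exists eps => // X m ge m1 ne esc.
have {}H := H X m ge _ ne.
pose B := \sum_x h1 x + 1.
have B0 : 0 < B by rewrite /B ltr_wpDl // sumr_ge0 // => x _; exact: (dc_h0 dom1).
have [|N HN] := esc (c / (2 * B)); first by rewrite divr_gt0 // mulr_gt0.
have := HN (m + N)%N (leq_addl _ _); rewrite ger0_norm // => le1.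
have : c <= dotp (occ gam (hist X (m + N))) h1.
  apply: H; apply: le_trans (hc _ _); first by rewrite -/(mass1 _) m1 mulr1.
  by case: (hist_prob gam_0 gam01 X m).
have : dotp (occ gam (hist X (m + N))) h1 <= B * mass1 (hist X (m + N)).
  rewrite /dotp (sum_supp (S := E1)); last by move=> x /h1_out->; rewrite mulr0.
  rewrite mulr_sumr; apply: ler_sum => x xE1; rewrite mulrC ler_wpM2r //.
    by case: (hist_prob gam_0 gam01 X (m + N)).
  rewrite /B (bigD1 x) //= -addrA lerDl addr_ge0 // sumr_ge0 // => y _.
  exact: (dc_h0 dom1).
have : B * mass1 (hist X (m + N)) <= c / 2.
  apply: le_trans (ler_wpM2l (ltW B0) le1) _.
  by rewrite le_eqVlt; apply/orP; left; apply/eqP; field; rewrite gt_eqF.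
lra.
Qed.

Hypothesis dg : diverges gam.
Hypothesis vg : vanishes gam.
Variable X : nat -> E.
Hypothesis good : forall eps : R, 0 < eps -> exists m, forall k z,
  `|avg_noise A gam m (hist X (m + k)) z| <= eps.

Let Z := smooth A gam X 0.

(** E2 eventually carries at least half of the mass, and [h2] is bounded below by [c] there: hence
    the threshold c / 2 for the coordinate. *)
Lemma escapes_cvg : escapes X -> forall x, vanishes (fun n => occ gam (hist X n) x - m2 x).
Proof.
move=> esc; have [C C1 AC] := Amass_bound A_green.
have vmu := mu_smooth_vanishes A_green gam_0 gam01 gam_ni C1 AC dg vg good.
have Zp n : is_prob (Z n) by exact: (smooth_prob A_green).
have Zout x : x \notin E2 -> vanishes (fun n => Z n x).
  rewrite nE2 => xE1.
  have vx : vanishes (fun n => occ gam (hist X n) x).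
    move=> eps /esc[N HN]; exists N => n /HN.
    have [q0 _] := hist_prob gam_0 gam01 X n.
    rewrite !ger0_norm //; apply: le_trans.
    by rewrite /mass1 (bigD1 x) //= lerDl sumr_ge0.
  move=> eps /(vanishesD vx (vanishesM (-1) (vmu x)))[N HN]; exists N => n /HN.
  by congr (`|_| <= _); rewrite /Z; ring.
have [c c0 hc] := pos_min (dc_w0 dom2).
apply: (occ_cvg A_green gam_0 gam01 gam_ni dom2 C1 AC dg vg good (beta := c / 2)) => //.
  by rewrite divr_gt0.
have vE1 : vanishes (fun n => \sum_x (if x \in E1 then Z n x else 0)).
  apply: vanishes_sum => x; have [xE1|_] := boolP (x \in E1).
    by apply: Zout; rewrite nE2.
  by move=> eps eps0; exists 0%N => n _; rewrite normr0 ltW.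
have [|N0 HN0] := vE1 (1 / 2); first by rewrite divr_gt0.
move=> N; exists (maxn N N0); first exact: leq_maxl.
have := HN0 _ (leq_maxr N N0); set n := maxn N N0.
have [Z0 Z1] := Zp n; rewrite -big_mkcond /= => /(le_trans (ler_norm _)) le1.
have half : 1 / 2 <= \sum_(x in E2) Z n x.
  by move: Z1; rewrite /total_mass sum_E12; lra.
apply: (@le_trans _ _ (c * \sum_(x in E2) Z n x)).
  by rewrite ler_wpM2l ?(ltW c0) // -[_^-1]mul1r.
rewrite mulr_sumr /coefS; apply: ler_sum => x xE2.
by rewrite mulrC ler_wpM2l // hc.
Qed.

(** The negation of escape bounds the mass of E1 below only along a subsequence, which is all that
    [occ_cvg] asks for. *)
Lemma not_escapes_cvg : ~ escapes X ->
  forall x, vanishes (fun n => occ gam (hist X n) x - mstar x).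
Proof.
move=> nesc; have [C C1 AC] := Amass_bound A_green.
have vmu := mu_smooth_vanishes A_green gam_0 gam01 gam_ni C1 AC dg vg good.
have Zp n : is_prob (Z n) by exact: (smooth_prob A_green).
have [c c0 hc] := mass1_h1.
have [e e0 He] : exists2 e, 0 < e & forall N, exists2 n, (N <= n)%N & e <= mass1 (hist X n).
  apply: contrapT => H; apply: nesc => eps eps0.
  apply: contrapT => /forallNP H2; apply: H; exists eps => // N.
  have /existsNP[n /not_implyP[Nn /negP]] := H2 N.
  by rewrite -ltNge ger0_norm // => /ltW ?; exists n.
have vE1 : vanishes (fun n => \sum_x `|occ gam (hist X n) x - Z n x|).
  apply: vanishes_sum => x eps /(vmu x)[N HN]; exists N => n /HN.
  by rewrite normr_id.
have [|N0 HN0] := vE1 (e / 2); first by rewrite divr_gt0.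
apply: (occ_cvg A_green gam_0 gam01 gam_ni dom1 C1 AC dg vg good (beta := c * (e / 2))).
- by rewrite big_setT.
- by move=> x; rewrite inE.
- by move=> x; rewrite inE.
- by rewrite mulr_gt0 // divr_gt0.
move=> N; have [n] := He (maxn N N0).
rewrite geq_max => /andP[Nn N0n] en; exists n => //.
have [Z0 Z1] := Zp n.
rewrite /coefS big_setT; apply: le_trans (hc _ Z0); rewrite ler_wpM2l ?(ltW c0) //.
have := HN0 n N0n; move=> /(le_trans (ler_norm _)) le1.
have : mass1 (hist X n) - \sum_(x in E1) Z n x <=
    \sum_x `|occ gam (hist X n) x - Z n x|.
  rewrite /mass1 -sumrB sum_E12; apply: ler_wpDr; first by rewrite sumr_ge0.
  by apply: ler_sum => x _; exact: ler_norm.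
lra.
Qed.

End Deterministic.

(** * Probabilities of the two limits *)

Section Random.
Variables (d : measure_display) (Omega : measurableType d).
Variable P : probability Omega R.
Variables (eta : nat -> R) (F : nat -> set (set Omega)) (x0 : E).
Variable X : nat -> Omega -> E.
Hypothesis eta0 : forall n, 0 < eta n.
Hypothesis X_reinforced : reinforced P K eta F x0 X.

Local Notation gam := (gamma_ eta).
Local Notation H n w := (hist (X ^~ w) n).
Local Notation mu s := (occ gam s).
Local Notation tr := (transition K gam).

Hypothesis gam_ni : forall i j, (i <= j)%N -> gam j <= gam i.
Hypothesis dg : diverges gam.
Hypothesis gam_ln : vanishes (fun n => gam n * ln n%:R).

Let gam_0 : gam 0%N = 1. Proof. exact: gamma_0. Qed.
Let gam01 n : 0 <= gam n <= 1.
Proof. by rewrite ltW ?gamma_gt0 // gamma_le1. Qed.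
Let vg : vanishes gam. Proof. exact: gamma_vanishes. Qed.
Let mX := X_measurable X_reinforced.
Let chain := reinforced_chain eta0 X_reinforced.
Let tr0 : forall s y, 0 <= tr s y. Proof. exact: transition_ge0. Qed.
Let mH n (Q : seq E -> Prop) : measurable [set w | Q (H n w)].
Proof. exact: measurable_hist. Qed.

Definition escape_event : set Omega := [set w | escapes gam (X ^~ w)].

Lemma escape_event_measurable : measurable escape_event.
Proof.
rewrite (_ : escape_event = \bigcap_i \bigcup_N \bigcap_(n in [set n | (N <= n)%N])
    [set w | `|mass1 gam (H n w)| <= i.+1%:R^-1]).
  apply: bigcapT_measurable => i; apply: bigcupT_measurable => N.
  apply: bigcap_measurable => [|n _]; first by exists N => /=.
  exact: (mH n (fun s => `|mass1 gam s| <= i.+1%:R^-1)).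
apply/seteqP; split=> w /=.
  move=> esc i _; have [|N HN] := esc (i.+1%:R^-1); first by rewrite invr_gt0.
  by exists N => // n /HN.
move=> esc eps eps0; pose i := Num.trunc (eps^-1).
have i_eps : i.+1%:R^-1 <= eps.
  rewrite invf_ple ?posrE ?ltr0n //; exact/ltW/truncnS_gt.
have [N _ HN] := esc i I; exists N => n Nn.
by apply: le_trans i_eps; exact: HN.
Qed.

(** Defined for every [w] by the escape event and not as a pointwise limit: measurability and the
    two possible values are immediate, and only convergence is almost sure. *)
Definition mu_lim (w : Omega) : E -> R :=
  if `[< escape_event w >] then m2 else mstar.

Lemma mu_lim_measurable x : measurable_fun setT (fun w => mu_lim w x).
Proof.
rewrite (_ : (fun w => _) = (fun w => if `[< escape_event w >] then m2 x else mstar x)).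
  apply: measurable_fun_ifT => //; apply: (measurable_fun_bool true).
  rewrite setTI (_ : _ @^-1` _ = escape_event); first exact: escape_event_measurable.
  by apply/seteqP; split=> w /= /asboolP.
by apply/funext => w; rewrite /mu_lim; case: ifP.
Qed.

Lemma mu_lim_ae : {ae P, forall w,
  (forall x, occupation eta X n w x @[n --> \oo] --> mu_lim w x) /\
  (mu_lim w = m2 \/ mu_lim w = mstar)}.
Proof.
apply: negligibleS (good_noise_ae K_sub A_green eta0 X_reinforced gam_ni gam_ln).
move=> w /= nQ ng; apply: nQ; split; last first.
  by rewrite /mu_lim; case: ifP => _; [left|right].
move=> x; apply/cvgrPdist_le => eps eps0.
have v : vanishes (fun n => mu (H n w) x - mu_lim w x).
  rewrite /mu_lim; case: ifPn => [/asboolP esc|/asboolPn nesc].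
    exact: (escapes_cvg gam_0 gam01 gam_ni dg vg ng esc).
  exact: (not_escapes_cvg gam_0 gam01 gam_ni dg vg ng nesc).
have [N HN] := v _ eps0; exists N => // n /= Nn.
by rewrite distrC (occupation_occ X eta0) HN.
Qed.

Lemma occ_supp (S : {set E}) s x : all (fun y => y \in S) s -> x \notin S -> mu s x = 0.
Proof.
move=> + xS; elim: s => [//|y s IH] /= /andP[yS /IH->].
rewrite mulr0 add0r; case: eqP => [yx|_]; last by rewrite mulr0.
by rewrite yx (negPf xS) in yS.
Qed.

Lemma mass1_all s : s != [::] -> all (fun y => y \in E1) s -> mass1 gam s = 1.
Proof.
move=> s0 sE1; have [_ <-] := occ_prob gam_0 gam01 s0.
by rewrite /mass1 /total_mass -sum_supp // => x; exact: occ_supp.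
Qed.

Lemma K_le_transition x s y : K x y <= tr (x :: s) y.
Proof.
rewrite /transition /resurrected /mass !big_set1 lerDl mulr_ge0 ?(killing_ge0 K_sub) //.
by case: (occ_prob gam_0 gam01 (s := x :: s) isT).
Qed.

(** From E2 only resurrection leads to E1, and the killing probability is at most 1. *)
Lemma transition_E1_le x s y : x \in E2 -> y \in E1 -> tr (x :: s) y <= mu (x :: s) y.
Proof.
move=> xE2 yE1; rewrite /transition /resurrected /mass !big_set1 KE2 ?nE2 // add0r.
have [m0 _] := occ_prob gam_0 gam01 (s := x :: s) isT.
by rewrite ler_piMl // /killing gerBl sumr_ge0.
Qed.

(** The potential is the indicator of having left E2: while the history lies in E2, the occupation
    measure does not charge E1 and the probability of jumping there is 0. *)
Lemma stays_E2 : x0 \in E2 -> {ae P, forall w,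
  (forall n, X n w \in E2) /\ mu_lim w = m2}.
Proof.
move=> x0E2; pose V (s : seq E) : R := (~~ all (fun y => y \in E2) s)%:R.
pose bad s : Prop := ~~ all (fun y => y \in E2) s.
have := @hitting_bound _ _ _ P _ _ tr mX chain V bad 0 [:: x0].
rewrite /V /= x0E2 /= mulr0 => HB.
have {HB} HB : pr P [set w | H 0 w = [:: x0] /\ exists j, bad (H (0 + j) w)] <= 0.
  apply: HB => // [s bs|[//|x s] _ _ /negP/negPn /= sE2].
    by rewrite (_ : ~~ _ = true).
  have /andP[xE2 _] := sE2.
  rewrite sE2 /= big1 // => y _; rewrite andbT.
  have [yE2|yE2] := boolP (y \in E2); first by rewrite mulr0.
  rewrite mulr1; apply/eqP; rewrite eq_le; apply/andP; split; last exact: (tr0 (x :: s) y).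
  rewrite nE2 in yE2; apply: le_trans (transition_E1_le s xE2 yE2) _.
  by rewrite (@occ_supp E2) // nE2.
pose N := \bigcup_j [set w | bad (H j w)].
have mN : measurable N by apply: bigcupT_measurable => j; exact: mH.
have NE : [set w | H 0 w = [:: x0] /\ exists j, bad (H (0 + j) w)] = N.
  apply/seteqP; split=> w /=; first by move=> [_ [j bj]]; exists j.
  move=> [j _ bj]; split; last by exists j.
  by case: X_reinforced => _ _ -> _.
rewrite NE in HB.
exists N; split=> //.
  transitivity (pr P N)%:E; first exact: prE.
  by congr (_%:E); apply/eqP; rewrite eq_le HB fine_ge0.
move=> w /= nQ; apply: contrapT => nN; apply: nQ.
have allE2 n : all (fun y => y \in E2) (H n w).
  by apply/negPn/negP => nb; apply: nN; exists n.
split=> [n|]; first by have := allE2 n; case: n => [|n] /= /andP[].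
rewrite /mu_lim (asboolT (P := escape_event w)) // => eps eps0; exists 0%N => n _.
rewrite /mass1 big1 ?normr0 ?ltW // => x xE1.
by rewrite (@occ_supp E2) // nE2.
Qed.

Lemma path_E1 n : x0 \in E1 -> exists2 s, 0 < pr P [set w | H n w = s] &
  s != [::] /\ all (fun y => y \in E1) s.
Proof.
move=> x0E1; elim: n => [|n [s ps [s0 sE1]]].
  by exists [:: x0]; rewrite ?(pr_hist0 X_reinforced) //= x0E1.
case: s ps s0 sE1 => // x s ps _ /= /andP[xE1 sE1].
have [y yE1 Kxy] := E1_step xE1.
exists [:: y, x & s]; last by rewrite /= yE1 xE1.
by apply: (pr_hist_pos chain) => //; apply: lt_le_trans (K_le_transition _ _ _).
Qed.

Lemma mu_lim_star_measurable : measurable [set w | mu_lim w = mstar].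
Proof.
have [e|ne] := pselect (m2 = mstar).
  rewrite (_ : [set w | _] = setT) //; apply/seteqP; split=> w //= _.
  by rewrite /mu_lim e; case: ifP.
rewrite (_ : [set w | _] = ~` escape_event).
  by apply: measurableC; exact: escape_event_measurable.
apply/seteqP; split=> w /=; rewrite /mu_lim; first by case: asboolP.
by case: asboolP.
Qed.

(** Given a path staying in E1 up to time m, which has positive probability, the later noise exceeds
    eps with probability less than 1; otherwise [persists] forbids escape. *)
Lemma not_escape_pos : x0 \in E1 -> 0 < pr P [set w | mu_lim w = mstar].
Proof.
move=> x0E1; have [eps eps0 pers] := persists gam_0 gam01 gam_ni.
have [M1 HM1] := noise_tail K_sub A_green eta0 X_reinforced gam_ni gam_ln eps0.
have [M2 HM2] := vg eps0.
pose c : R := #|{: E * bool}|%:R * 2.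
(* The last term makes c / (m + 1) < 1 in the union bound. *)
pose m := maxn (maxn M1 M2) (Num.trunc c).
have m1 : (M1 <= m)%N by rewrite !leq_max leqnn.
have m2' : (M2 <= m)%N by rewrite !leq_max leqnn orbT.
have [s ps [s0 sE1]] := path_E1 m x0E1.
have := HM1 m m1 m s (leqnn _); rewrite mulrA -/c; set B := [set w | _ /\ _] => pB.
have mB : measurable B.
  rewrite (_ : B = [set w | H m w = s] `&`
      \bigcup_j [set w | bad_noise A eta m eps (H (m + j) w)]).
    apply: measurableI; first exact: (mH m (fun h => h = s)).
    by apply: bigcupT_measurable => j; exact: (mH (m + j)).
  by apply/seteqP; split=> w /= [Hs [j]]; split=> //; exists j.
have cm : c / m.+1%:R < 1.
  rewrite ltr_pdivrMr // mul1r (lt_le_trans (truncnS_gt _)) //.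
  by rewrite ler_nat ltnS leq_maxr.
have sub : pr P [set w | H m w = s] <= pr P B + pr P [set w | mu_lim w = mstar].
  have mG := mu_lim_star_measurable.
  apply: le_trans (pr_setU P mB mG); apply: pr_le.
  - exact: (mH m (fun h => h = s)).
  - exact: measurableU.
  move=> w /= Hs; have [Bw|nB] := pselect (B w); [by left|right].
  rewrite /mu_lim; case: asboolP => // esc; exfalso.
  apply: (pers (X ^~ w) m _ _ _ esc).
  - by have := HM2 m m2' => /(le_trans (ler_norm _)).
  - by rewrite Hs; exact: mass1_all.
  move=> j z; rewrite leNgt; apply/negP => lt; apply: nB; split=> //; exists j.
  by split; [rewrite size_hist ltnS leq_addr|exists z; exact: ltW].
have : pr P B < pr P [set w | H m w = s].
  by apply: le_lt_trans pB _; rewrite gtr_pMr.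
lra.
Qed.

Definition eventually_E2 : set Omega :=
  [set w | exists N : nat, forall n : nat, (N <= n)%N -> X n w \in E2].

Lemma eventually_E2_measurable : measurable eventually_E2.
Proof.
rewrite (_ : eventually_E2 = \bigcup_N \bigcap_(n in [set n | (N <= n)%N])
    [set w | X n w \in E2]).
  apply: bigcupT_measurable => N; apply: bigcap_measurable => [|n _]; first by exists N => /=.
  rewrite (_ : [set w | _] = [set w | if H n w is y :: _ then y \in E2 else true]).
    exact: (mH n (fun s => if s is y :: _ then y \in E2 else true)).
  by apply/seteqP; split=> w /=; case: (n).
by apply/seteqP; split=> w /= [N]; [exists N|move=> _ ?; exists N].
Qed.

Lemma mass1_step y s : y \in E2 -> mass1 gam (y :: s) = (1 - gam (size s)) * mass1 gam s.
Proof.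
move=> yE2; rewrite /mass1 mulr_sumr; apply: eq_bigr => x xE1 /=.
have [yx|_] := eqVneq y x; last by rewrite mulr0 addr0.
by rewrite -nE1 yx xE1 in yE2.
Qed.

Lemma eventually_E2_escapes w : eventually_E2 w -> mu_lim w = m2.
Proof.
move=> [N HN]; rewrite /mu_lim; case: asboolP => // nesc; exfalso; apply: nesc.
apply: (@vanishes_unshift _ _ N).
have massE n : mass1 gam (H (N + n) w) = (\prod_(j < n) (1 - gam (N + j.+1))) * mass1 gam (H N w).
  elim: n => [|n IH]; first by rewrite addn0 big_ord0 mul1r.
  rewrite addnS /= mass1_step; last by apply: HN; rewrite -addnS leq_addr.
  by rewrite IH size_hist big_ord_recr /= addnS mulrA [_ * \prod_(_ < _) _]mulrC.
have dgN : diverges (fun j => gam (N + j.+1)).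
  by have /= := diverges_shift N.+1 dg; under eq_fun do rewrite addSnnS.
move=> eps /(vanishesM (mass1 gam (H N w)) (prod_contract_vanishes (fun j => gam01 (N + j.+1)) dgN)).
by move=> [M HM]; exists M => n /HM; rewrite massE mulrC.
Qed.

(** The product starts at 1 because the factor 1 - gam 0 is 0. *)
Let survival n : R := \prod_(1 <= i < n.+1) (1 - gam i).

Lemma survival_gt0 n : 0 < survival n.
Proof.
rewrite /survival big_nat prodr_gt0 // => i /andP[i1 _].
by case: i i1 => // i _; rewrite subr_gt0 gamma_lt1.
Qed.

Lemma survivalS n : survival n.+1 = survival n * (1 - gam n.+1).
Proof. by rewrite /survival big_nat_recr. Qed.

Lemma pr_hist_size n s : 0 < pr P [set w | H n w = s] -> size s = n.+1.
Proof.
have [//|ns] := eqVneq (size s) n.+1.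
rewrite (_ : [set w | _] = set0) ?/pr ?measure0 ?ltxx //.
apply/seteqP; split=> w //= Hs; move: ns.
by rewrite -Hs size_hist eqxx.
Qed.

(** The states reached with positive probability form a closed set, since the resurrected kernel
    dominates K; a nonempty closed set contains E2. *)
Lemma path_E2 : exists n x s, x \in E2 /\ 0 < pr P [set w | H n w = x :: s].
Proof.
have [x xE2] := E2_neq0.
have [|u v [n [s ps]] Kuv|n [s ps]] := E2_reached
  (C := fun x => exists n s, 0 < pr P [set w | H n w = x :: s]) _ _ xE2.
- by exists x0, 0%N, [::]; rewrite (pr_hist0 X_reinforced).
- exists n.+1, (u :: s); apply: (pr_hist_pos chain) => //.
  exact: lt_le_trans (K_le_transition _ _ _).
by exists n, x, s.
Qed.

(** During a stay in E2, [mass1] and [survival] are multiplied by the same factor, so [r] is common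
    to all [j] and the stay can be prolonged after [r] is known. *)
Lemma path_E2_long : exists n r, forall j, exists x s,
  [/\ x \in E2, 0 < pr P [set w | H (n + j) w = x :: s]
    & mass1 gam (x :: s) = r * survival (n + j)].
Proof.
have [n [x [s [xE2 ps]]]] := path_E2.
exists n, (mass1 gam (x :: s) / survival n); elim=> [|j [y [t [yE2 pt mt]]]].
  by exists x, s; rewrite addn0 divfK // gt_eqF // survival_gt0.
have [z Kyz] : exists z, 0 < K y z.
  by apply: sum_gt0_ex; case: K_sub => _ /(_ y)/andP[].
have zE2 : z \in E2 by apply: contraTT Kyz => /(KE2 yE2)->; rewrite ltxx.
exists z, (y :: t); split=> //.
  rewrite addnS; apply: (pr_hist_pos chain) => //.
  exact: lt_le_trans (K_le_transition _ _ _).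
rewrite mass1_step // mt (pr_hist_size pt) addnS survivalS.
by rewrite mulrC mulrA.
Qed.

Variable L : R.
Hypothesis survival_le : forall n, \sum_(k < n) survival k <= L.
Hypothesis survival_lim : forall e : R, 0 < e -> exists n, L - e <= \sum_(k < n) survival k.

Let tau n : R := L - \sum_(k < n) survival k.

Let tau_ge0 n : 0 <= tau n. Proof. by rewrite subr_ge0. Qed.

Let tauS n : tau n = survival n + tau n.+1.
Proof. by rewrite /tau big_ord_recr /=; ring. Qed.

(* After time n, the chain in E2 returns to E1 at step k with probability at
   most mass1 = r * survival k. *)
Let return_potential (s : seq E) : R := if s is x :: s' then
  if x \in E1 then 1 else mass1 gam s / survival (size s') * tau (size s')
  else 0.

Let mass1_ge0 s : 0 <= mass1 gam s.
Proof.
have [->|s0] := eqVneq s [::]; first by rewrite /mass1 sumr_ge0.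
by rewrite sumr_ge0 // => x _; case: (occ_prob gam_0 gam01 s0).
Qed.

Let return_potential_ge0 s : 0 <= return_potential s.
Proof.
case: s => [|x s] //=; case: ifP => // _.
by rewrite mulr_ge0 // divr_ge0 // ltW // survival_gt0.
Qed.

(** With n = size s, tau n = survival n + tau (n + 1): the first part pays [mass1], which bounds the
    probability of jumping to E1; the second is the potential of every continuation in E2. *)
Lemma return_potential_super x s : x \in E2 ->
  \sum_y tr (x :: s) y * return_potential (y :: x :: s) <= return_potential (x :: s).
Proof.
move=> xE2; set t := x :: s; set n := size s.
have pn := survival_gt0 n; have pn1 := survival_gt0 n.+1.
have xE1 : (x \in E1) = false by apply/negbTE; rewrite nE1.
have tE2 y : y \in E2 -> return_potential (y :: t) = mass1 gam t / survival n * tau n.+1.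
  move=> yE2; have yE1 : (y \in E1) = false by apply/negbTE; rewrite nE1.
  rewrite /return_potential yE1 (mass1_step _ yE2) /= -/n survivalS.
  have g1 : 1 - gam n.+1 != 0 by rewrite gt_eqF // subr_gt0 gamma_lt1.
  by field; rewrite g1 gt_eqF.
rewrite sum_E12 [leRHS]/return_potential /t xE1 -/t -/n tauS mulrDr.
rewrite divfK ?gt_eqF //; apply: lerD.
  rewrite /mass1; apply: ler_sum => y yE1.
  by rewrite /return_potential yE1 mulr1; exact: transition_E1_le.
under eq_bigr => y yE2 do rewrite tE2 //.
rewrite -mulr_suml ler_piMl //; first by rewrite mulr_ge0 // divr_ge0 // ltW.
rewrite -(transition_sum K eta0 (s := t) isT) [leRHS]sum_E12 lerDr.
by rewrite sumr_ge0.
Qed.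

Lemma eventually_E2_pos : 0 < pr P eventually_E2.
Proof.
have [n [r long]] := path_E2_long.
have r0 : 0 <= r.
  have [x [s [_ _ mr]]] := long 0%N.
  by rewrite -(pmulr_lge0 _ (survival_gt0 (n + 0))) -mr.
have r1 : 0 < r + 1 by rewrite ltr_wpDl.
(* As [r] does not depend on the length of the stay, the stay is prolonged until r times the tail
   [tau] is at most 1/2. *)
have [|N HN] := survival_lim (e := (r + 1)^-1 / 2); first by rewrite !divr_gt0 // invr_gt0.
have [x [s [xE2 ps mr]]] := long N.
have tauN : tau (n + N) <= (r + 1)^-1 / 2.
  rewrite /tau (@sum_ord_split _ _ N) ?leq_addl //.
  have : 0 <= \sum_(k < n + N - N) survival (N + k).
    by rewrite sumr_ge0 // => k _; rewrite ltW // survival_gt0.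
  move: HN; lra.
pose bad (s : seq E) : Prop := if s is y :: _ then y \in E1 else False.
have sz : size s = (n + N)%N by have := pr_hist_size ps; case.
have xE1 : (x \in E1) = false by apply/negbTE; rewrite nE1.
have V1 : return_potential (x :: s) < 1.
  rewrite /return_potential xE1 mr sz mulfK ?gt_eqF ?survival_gt0 //.
  apply: le_lt_trans (ler_wpM2l r0 tauN) _.
  rewrite mulrA; have : r / (r + 1) <= 1 by rewrite ler_pdivrMr // mul1r lerDl.
  lra.
set B := [set w | H (n + N) w = x :: s /\ exists j, bad (H (n + N + j) w)].
have pB : pr P B <= pr P [set w | H (n + N) w = x :: s] * return_potential (x :: s).
  apply: (@hitting_bound _ _ _ P _ X tr mX chain return_potential bad (n + N) (x :: s)
    return_potential_ge0) => [[//|y t] /= -> //|].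
  move=> [//|y t] _ _ /negP; rewrite nE1 => yE2.
  exact: return_potential_super.
have mB : measurable B.
  rewrite (_ : B = [set w | H (n + N) w = x :: s] `&` \bigcup_j [set w | bad (H (n + N + j) w)]).
    apply: measurableI; first exact: (mH (n + N) (fun h => h = x :: s)).
    by apply: bigcupT_measurable => j; exact: (mH (n + N + j)).
  by apply/seteqP; split=> w /= [Hs [j]]; split=> //; exists j.
have mG := eventually_E2_measurable.
have sub : pr P [set w | H (n + N) w = x :: s] <= pr P B + pr P eventually_E2.
  apply: le_trans (pr_setU P mB mG); apply: pr_le.
  - exact: (mH (n + N) (fun h => h = x :: s)).
  - exact: measurableU.
  move=> w /= Hs; have [Bw|nB] := pselect (B w); [by left|right].
  exists (n + N)%N => k nk; rewrite -nE1; apply/negP => kE1; apply: nB.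
  split=> //; exists (k - (n + N))%N; rewrite subnKC //.
  by case: (k) kE1.
have : pr P B < pr P [set w | H (n + N) w = x :: s].
  by apply: le_lt_trans pB _; rewrite gtr_pMr.
lra.
Qed.

End Random.
End Endgame.

(** * From extended real series to partial sums *)

Section SeriesConversions.
Variables (R : realType) (u : nat -> R).
Hypothesis u0 : forall n, 0 <= u n.

Let sum_EFin n : (\sum_(0 <= k < n) (u k)%:E)%E = (\sum_(k < n) u k)%:E.
Proof. by rewrite sumEFin big_mkord. Qed.

Lemma nneseries_diverges : (\sum_(0 <= n <oo) (u n)%:E = +oo)%E -> diverges u.
Proof.
move=> sum_oo B; apply: contrapT => /forallNP H.
have : (\sum_(0 <= n <oo) (u n)%:E <= B%:E)%E.
  apply: lime_le; first by apply: is_cvg_nneseries => n _ _; rewrite lee_fin.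
  apply: nearW => n; rewrite sum_EFin lee_fin leNgt; apply/negP => /ltW.
  exact: H.
by rewrite sum_oo.
Qed.

Lemma nneseries_summable : (\sum_(0 <= n <oo) (u n)%:E < +oo)%E -> exists L : R,
  (forall n, \sum_(k < n) u k <= L) /\
  (forall e, 0 < e -> exists n, L - e <= \sum_(k < n) u k).
Proof.
move=> sum_lt; set S : \bar R := limn _ in sum_lt.
have S_ge n : ((\sum_(k < n) u k)%:E <= S)%E.
  by rewrite -sum_EFin; apply: nneseries_lim_ge => k _; rewrite lee_fin.
have S_fin : S \is a fin_num.
  rewrite ge0_fin_numE //; apply: le_trans (S_ge 0%N).
  by rewrite big_ord0.
pose U := range (fun n => \sum_(k < n) u k).
have Usup : has_sup U.
  split; first by exists 0, 0%N; rewrite ?big_ord0.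
  exists (fine S) => _ [n _ <-]; rewrite -lee_fin fineK //.
exists (sup U); split=> [n|e e0].
  by apply: sup_upper_bound => //; exists n.
have [_ [n _ <-] lt] := sup_adherent e0 Usup.
by exists n; exact: ltW.
Qed.

End SeriesConversions.

Lemma eigen_qsd (R : realType) (T : finType) (K : T -> T -> R) (m : T -> R) (Th : R) :
  is_prob m -> 0 < Th -> (forall y, mu_mul m K y = Th * m y) -> is_qsd K m.
Proof.
move=> pm Th0 mK; split=> // y.
have -> : extinction_rate K m = Th.
  rewrite /extinction_rate /total_mass; under eq_bigr => z _ do rewrite mK.
  by rewrite -mulr_sumr; case: pm => _; rewrite /total_mass => ->; rewrite mulr1.
by rewrite mK mulrAC divff ?mul1r // gt_eqF.
Qed.

Theorem theorem3p4 (R : realType) (E : finType) (E1 E2 : {set E})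
    (K : E -> E -> R)
    (E1_neq0 : E1 != finset.set0) (E2_neq0 : E2 != finset.set0)
    (E12_disjoint : (E1 :&: E2)%SET = finset.set0)
    (E12_cover : (E1 :|: E2)%SET = [set: E]%SET)
    (K_sub : sub_markovian K)
    (E1_irr : forall x y, x \in E1 -> y \in E1 -> leads K x y)
    (E2_irr : forall x y, x \in E2 -> y \in E2 -> leads K x y)
    (E1_to_E2 : leads_set K E1 E2)
    (E2_not_to_E1 : ~ leads_set K E2 E1)
    (E2_killed : exists2 x, x \in E2 & total_mass (K x) < 1)
    (E1_not_killed : forall x, x \in E1 -> total_mass (K x) = 1)
    (mu1 : {x : E | x \in E1} -> R) (mu2 : {x : E | x \in E2} -> R)
    (mu1_qsd : is_qsd (restrict_kernel E1 K) mu1)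
    (mu2_qsd : is_qsd (restrict_kernel E2 K) mu2)
    (Theta12 : extinction_rate (restrict_kernel E1 K) mu1
               > extinction_rate (restrict_kernel E2 K) mu2) :
  is_qsd K (extend_by0 mu2) /\
  exists mu_star : E -> R,
    [/\ is_qsd K mu_star, mu_star <> extend_by0 mu2, forall x, 0 < mu_star x
      & forall (d : measure_display) (Omega : measurableType d)
          (P : probability Omega R) (F : nat -> set (set Omega))
          (eta : nat -> R) (x0 : E) (X : nat -> Omega -> E),
        (forall n, 0 < eta n) ->
        reinforced P K eta F x0 X ->
        nonincreasing_seq (gamma_ eta) ->
        (\sum_(0 <= n <oo) (gamma_ eta n)%:E = +oo)%E ->
        (fun n => gamma_ eta n * ln n%:R) @ \oo --> (0 : R) ->
        exists mu_oo : Omega -> E -> R,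
          [/\ forall x, measurable_fun setT (fun w => mu_oo w x),
              {ae P, forall w,
                (forall x, occupation eta X n w x @[n --> \oo] --> mu_oo w x) /\
                (mu_oo w = extend_by0 mu2 \/ mu_oo w = mu_star)},
              x0 \in E2 ->
                {ae P, forall w,
                  (forall n, X n w \in E2) /\ mu_oo w = extend_by0 mu2},
              x0 \in E1 -> (0 < P [set w | mu_oo w = mu_star])%E
            & (\sum_(0 <= n <oo)
                 (\prod_(1 <= i < n.+1) (1 - gamma_ eta i))%:E < +oo)%E ->
              (0 < P [set w | exists N : nat, forall n : nat,
                                (N <= n)%N -> X n w \in E2])%E /\
              {ae P, forall w,
                (exists N : nat, forall n : nat, (N <= n)%N -> X n w \in E2) ->
                mu_oo w = extend_by0 mu2}]].
Proof.
have K0 : forall x y, 0 <= K x y by case: K_sub.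
set m1 := extend_by0 mu1; set m2 := extend_by0 mu2.
set Th1 := extinction_rate _ mu1 in Theta12; set Th2 := extinction_rate _ mu2 in Theta12.
have m1_ge0 : forall x, 0 <= m1 x := extend_ge0 mu1_qsd.
have m2_ge0 : forall x, 0 <= m2 x := extend_ge0 mu2_qsd.
have m1_out : forall x, x \notin E1 -> m1 x = 0 := extend_out mu1.
have m2_out : forall x, x \notin E2 -> m2 x = 0 := extend_out mu2.
have m1_sum : \sum_x m1 x = 1 := extend_sum mu1_qsd.
have m2_sum : \sum_x m2 x = 1 := extend_sum mu2_qsd.
have m1_pos : exists2 x, x \in E1 & 0 < m1 x := extend_pos mu1_qsd.
have m2_pos : exists2 x, x \in E2 & 0 < m2 x := extend_pos mu2_qsd.
have m1_eig : forall y, y \in E1 -> \sum_(x in E1) m1 x * K x y = Th1 * m1 y :=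
  @extend_eigen _ _ _ _ _ K0 mu1_qsd.
have m2_eig : forall y, y \in E2 -> \sum_(x in E2) m2 x * K x y = Th2 * m2 y :=
  @extend_eigen _ _ _ _ _ K0 mu2_qsd.
have Th2_gt0 : 0 < Th2 := extend_rate_gt0 K0 mu2_qsd.
have Th1_gt0 : 0 < Th1 := lt_trans Th2_gt0 Theta12.
have m2K y : mu_mul m2 K y = Th2 * m2 y.
  exact: (m2_left E12_disjoint E12_cover K_sub E2_not_to_E1 m2_out m2_eig).
split; first by apply: eigen_qsd Th2_gt0 m2K.
have [mstar [mstar_gt0 mstar_sum mstarK]] : exists m : E -> R,
    [/\ forall x, 0 < m x, \sum_x m x = 1 & forall y, mu_mul m K y = Th1 * m y].
  exact: (full_left_eigen E12_disjoint E12_cover K_sub E1_irr E2_irr E1_to_E2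
    E2_not_to_E1 m1_ge0 m1_pos m1_eig m2_ge0 m2_pos m2_eig Th2_gt0 Theta12).
exists mstar; split=> //.
- apply: eigen_qsd Th1_gt0 mstarK; split=> // x; exact: ltW.
- have [x xE1 _] := m1_pos; move=> /(congr1 (fun f => f x)).
  rewrite m2_out ?(notin_E2 E12_disjoint E12_cover) // => m0.
  by have := mstar_gt0 x; rewrite m0 ltxx.
have kills := K_kills E12_disjoint E12_cover K_sub E1_irr E2_irr E1_to_E2 E2_killed.
have [A A_green] := green_exists K_sub kills.
have [h2 [k2 [dom2 _]]] := class2 E12_disjoint E12_cover K_sub E1_irr E2_irr E1_to_E2
  E2_not_to_E1 E2_killed m1_ge0 m1_out m1_sum m1_pos m1_eig m2_ge0 m2_out m2_pos m2_eig
  Th2_gt0 Theta12 A_green.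
have [h1 [w1 [k1 [dom1 h1_pos h1_out]]]] := class1 E12_disjoint E12_cover K_sub E1_irr
  E2_irr E1_to_E2 E2_not_to_E1 E2_killed m1_ge0 m1_out m1_sum m1_pos m1_eig m2_ge0 m2_out
  m2_pos m2_eig Th2_gt0 Theta12 A_green mstar_gt0 mstarK.
have m2_sum2 : \sum_(x in E2) m2 x = 1 by rewrite -(sum_supp m2_out).
(* Th1 h(x) > 0 provides a successor in E1; irreducibility alone does not when E1 is a singleton, as
   [leads] counts n = 0. *)
have E1_step x : x \in E1 -> exists2 y, y \in E1 & 0 < K x y.
  move=> xE1.
  have [h [hpos hout Kh]] := right_eigen1 E12_disjoint E12_cover K_sub E1_irr E2_not_to_E1
    m1_ge0 m1_pos m1_eig Th2_gt0 Theta12.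
  have [y Khy] : exists y, 0 < K x y * h y.
    by apply: sum_gt0_ex; rewrite -/(app K h x) Kh mulr_gt0 // hpos.
  have yE1 : y \in E1 by apply: contraTT Khy => /hout->; rewrite mulr0 ltxx.
  by exists y => //; move: Khy; rewrite pmulr_lgt0 // hpos.
have reach := closed_E2 E12_disjoint E12_cover K_sub E1_irr E2_irr E1_to_E2.
have E2_ex : exists x, x \in E2 by case: m2_pos => x; exists x.
move=> d Omega P F eta x0 X eta0 X_re gam_dec gam_sum gam_lim.
have gam_ni i j : (i <= j)%N -> gamma_ eta j <= gamma_ eta i by move=> /gam_dec.
have gam_ge0 n : 0 <= gamma_ eta n by rewrite ltW // gamma_gt0.
have dg : diverges (gamma_ eta) by exact: nneseries_diverges.
have gam_ln : vanishes (fun n => gamma_ eta n * ln n%:R).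
  move=> eps eps0; move/cvgrPdist_le: gam_lim => /(_ eps eps0)[N _ HN].
  by exists N => n Nn; have := HN n Nn; rewrite sub0r normrN.
have prEM (B : set Omega) : measurable B -> 0 < pr P B -> (0 < P B)%E.
  by move=> mB; rewrite -lte_fin -prE.
exists (mu_lim E1 m2 mstar eta X); split.
- by move=> x; exact: (@mu_lim_measurable R E E1 K m2 mstar d Omega P eta F x0 X X_re x).
- exact: (mu_lim_ae E12_disjoint E12_cover K_sub A_green dom1 dom2 h1_pos h1_out
    mstar_sum m2_sum2 m2_out eta0 X_re gam_ni dg gam_ln).
- exact: (stays_E2 E12_disjoint E12_cover K_sub E2_not_to_E1 m2 mstar eta0 X_re).
- move=> x0E1; apply: prEM; first exact: (@mu_lim_star_measurable R E E1 K m2 mstar d Omega P eta F x0 X X_re).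
  exact: (not_escape_pos K_sub A_green m2 dom1 h1_pos h1_out E1_step eta0 X_re gam_ni gam_ln x0E1).
move=> surv_lt.
have surv0 n : 0 <= \prod_(1 <= i < n.+1) (1 - gamma_ eta i).
  by rewrite prodr_ge0 // => i _; rewrite subr_ge0 gamma_le1.
have [L [L1 L2]] := nneseries_summable surv0 surv_lt.
split.
  apply: prEM; first exact: (@eventually_E2_measurable R E E2 K d Omega P eta F x0 X X_re).
  exact: (eventually_E2_pos E12_disjoint E12_cover K_sub E2_not_to_E1 reach E2_ex eta0 X_re L1 L2).
(* This clause holds for every [w], since the limit is defined through the escape event. *)
apply: aeW => w.
exact: (eventually_E2_escapes E12_disjoint E12_cover m2 mstar eta0 dg).
Qed.
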